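(* Let $\mu_0,\mu_1$ be probability measures on $\mathbb{R}^d$ with Lebesgue densities $p_0,p_1$, and let $\phi_j=-\log p_j$, $j=0,1$. Assume: (U2) for some real $\beta>2$, each $\phi_j$ is twice differentiable and there are constants $C_m$, $C_\beta<\infty$ such that for $j=0,1$, $$\sup_{x\in\mathbb{R}^d,\,\|k\|_1=m}\Big|\frac{\partial^m\phi_j(x)}{\partial x_1^{k_1}\cdots\partial x_d^{k_d}}\Big|\le C_m,\quad 2\le m\le\lceil\beta\rceil-1,$$ $$\max_{\|k\|_1=\lceil\beta\rceil-1}\sup_{x\ne y}\Big|\frac{\partial^{\|k\|_1}\phi_j(x)}{\partial x_1^{k_1}\cdots\partial x_d^{k_d}}-\frac{\partial^{\|k\|_1}\phi_j(y)}{\partial y_1^{k_1}\cdots\partial y_d^{k_d}}\Big|\le C_\beta\|x-y\|^{\beta-\lceil\beta\rceil+1};$$ (U3) $p_0,p_1$ are strongly log-concave with parameter $\alpha>0$: $\phi_j(x)\ge\phi_j(x')+\nabla\phi_j(x')^\top(x-x')+\frac{\alpha}{2}\|x-x'\|^2$ for all $x,x'\in\mathbb{R}^d$, $j=0,1$. Let $X_0\sim\mu_0$, $X_1\sim\mu_1$ be independent, $X_t=(1-t)X_0+tX_1$, $v(t,z)=\mathbb{E}[X_1-X_0\mid X_t=z]$, and for $x\in\mathbb{R}^d$ let $t\mapsto\mathfrak{R}(t,x)$ solve $\frac{d}{dt}\mathfrak{R}(t,x)=v(t,\mathfrak{R}(t,x))$, $t\in[0,1]$, $\mathfrak{R}(0,x)=x$.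 Then the rectified map $R(x)=\mathfrak{R}(1,x)$ is (well defined and) twice continuously differentiable. Moreover, it satisfies the marginal preserving property: if $X_0\sim\mu_0$, then for each $t\in[0,1]$, $\mathfrak{R}(t,X_0)$ has the same law as $X_t=(1-t)X_0+tX_1$.
   Context: Here $k=(k_1,\dots,k_d)$ ranges over vectors of non-negative integers and $\|k\|_1=\sum_j k_j$. *)

(* Defs.v *)
From HB Require Import structures.
From mathcomp Require Import all_boot all_order all_algebra.
From mathcomp Require Import all_classical all_reals all_analysis.
Set Implicit Arguments. Unset Strict Implicit. Unset Printing Implicit Defensive.
Import Order.TTheory GRing.Theory Num.Theory.
Import numFieldNormedType.Exports.
Local Open Scope classical_set_scope.
Local Open Scope ring_scope.

Section Defs.
Variables (R : realType) (d : nat).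
Notation V := 'rV[R]_d.

Definition ebasis (i : 'I_d) : V := delta_mx 0 i.

Definition enorm (x : V) : R := Num.sqrt (\sum_i x 0 i ^+ 2).

Definition borel_set (B : set V) : Prop := <<s [set: V], open >> B.

Fixpoint pds (s : seq 'I_d) (f : V -> R) : V -> R :=
  match s with
  | [::] => f
  | i :: s' => fun x => derive (pds s' f) x (ebasis i)
  end.

Fixpoint pds_exist (s : seq 'I_d) (f : V -> R) : Prop :=
  match s with
  | [::] => True
  | i :: s' => pds_exist s' f /\ forall x, derivable (pds s' f) x (ebasis i)
  end.

Definition mnorm (k : 'I_d -> nat) : nat := (\sum_i k i)%N.
Definition mseq (k : 'I_d -> nat) : seq 'I_d :=
  flatten [seq nseq (k i) i | i <- enum 'I_d].
Definition pdk (k : 'I_d -> nat) (f : V -> R) : V -> R := pds (mseq k) f.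

Definition potential (p : V -> R) : V -> R := fun x => - ln (p x).

Definition U2 (beta : R) (C : nat -> R) (Cb : R) (phi : V -> R) : Prop :=
  (forall x, differentiable phi x) /\
  (forall i x, differentiable (pds [:: i] phi) x) /\
  (forall k, (mnorm k)%:Z <= Num.ceil beta - 1 -> pds_exist (mseq k) phi) /\
  (forall (m : nat) k, (2 <= m)%N -> m%:Z <= Num.ceil beta - 1 ->
      mnorm k = m -> forall x, `|pdk k phi x| <= C m) /\
  (forall k, (mnorm k)%:Z = Num.ceil beta - 1 -> forall x y, x != y ->
      `|pdk k phi x - pdk k phi y| <=
        Cb * enorm (x - y) `^ (beta - (Num.ceil beta)%:~R + 1)).

Definition U3 (alpha : R) (phi : V -> R) : Prop :=
  forall x x', phi x' + \sum_i pds [:: i] phi x' * (x - x') 0 i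
                 + alpha / 2 * enorm (x - x') ^+ 2 <= phi x.

Fixpoint iint (s : seq 'I_d) (f : V -> \bar R) (x : V) : \bar R :=
  match s with
  | [::] => f x
  | i :: s' => (\int[lebesgue_measure]_(y in [set: R])
                 iint s' f (\row_j (if j == i then y else x ord0 j)%R))%E
  end.
Definition intRd (f : V -> \bar R) : \bar R := iint (enum 'I_d) f 0.

Definition C2map (F : V -> V) : Prop :=
  let Fc (l : 'I_d) : V -> R := fun x => F x 0 l in
  forall l, (forall x, differentiable (Fc l) x) /\
    (forall i x, differentiable (pds [:: i] (Fc l)) x) /\
    (forall i j, continuous (pds [:: i; j] (Fc l))).

(* g solves d/dt g(t) = v(t, g(t)) on [0,1], g(0) = x
   (one-sided derivatives at the endpoints) *)
Definition ode_solution (v : R -> V -> V) (x : V) (g : R -> V) : Prop :=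
  g 0 = x /\
  forall t, 0 <= t <= 1 ->
    (fun h => h^-1 *: (g (t + h) - g t))
      @ within (fun h => 0 <= t + h <= 1) ((0:R)^') --> v t (g t).

End Defs.

Section Prob.
Variables (R : realType) (d : nat) (dO : measure_display) (Om : measurableType dO)
  (P : probability Om R).
Notation V := 'rV[R]_d.

Definition random_vector (X : Om -> V) : Prop :=
  forall B, borel_set B -> measurable (X @^-1` B).

Definition has_density (X : Om -> V) (p : V -> R) : Prop :=
  forall B, borel_set B -> P (X @^-1` B) = intRd (fun x => (p x * \1_B x)%:E).

Definition indep_vec (X Y : Om -> V) : Prop :=
  forall A B, borel_set A -> borel_set B ->
    P (X @^-1` A `&` Y @^-1` B) = (P (X @^-1` A) * P (Y @^-1` B))%E.

Definition cond_exp_version (Y Z : Om -> V) (g : V -> V) : Prop :=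
  (forall B, borel_set B -> borel_set (g @^-1` B)) /\
  forall i, P.-integrable [set: Om] (fun w => (g (Z w) 0 i)%:E) /\
    forall B, borel_set B ->
      (\int[P]_(w in Z @^-1` B) (Y w 0 i)%:E =
       \int[P]_(w in Z @^-1` B) (g (Z w) 0 i)%:E)%E.

End Prob.

(* Main.v *)
(* With p_j = exp(- phi_j) and Phi(t, z, w) = phi_0(z - t w) + phi_1(z + (1 - t) w),
   the pair (X_t, X_1 - X_0) has density exp(- Phi), so v(t, z) is the mean of w
   under the density proportional to exp(- Phi(t, z, .)); this formula makes
   sense for every real t.  Hoelder control of the top derivatives forces all
   second derivatives of phi_j, in any order, to be bounded and continuous, so
   v is C^2 in z by differentiation under the integral.  Its Jacobian is minus
   the covariance of w and grad_z Phi; by strong convexity the density is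
   squeezed between two Gaussians centred at its mode, which bounds this
   covariance locally uniformly in t.  Hence v has a global flow, and the flow
   is C^2 in the initial point: its first derivative is a component of the flow
   of the augmented system (x, y)' = (v(x), Dv(x) y).  Any other continuous
   version of v coincides with this one because X_t charges every open set.

   For the marginals, let u(s, x) be f evaluated at time T along the trajectory
   through x at time s.  Then
     d/ds E u(s, X_s) = E [grad u(s, X_s) . (X_1 - X_0 - v(s, X_s))] = 0
   by the definition of v, so E f(R(T, X_0)) = E f(X_T); let f decrease to the
   indicator of a closed box. *)
Require Import Defs.
From HB Require Import structures.
From mathcomp Require Import all_boot all_order all_algebra.
From mathcomp Require Import all_classical all_reals all_analysis.
From mathcomp Require Import measurable_realfun ring lra.
Import Order.TTheory GRing.Theory Num.Theory.
Import numFieldNormedType.Exports.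
Local Open Scope classical_set_scope.
Local Open Scope ring_scope.
Set Implicit Arguments. Unset Strict Implicit. Unset Printing Implicit Defensive.

(** * Calculus on row vectors *)

(** The smoothness hypothesis bounds partial derivatives only in increasing order of the indices.
    The other orders are recovered from finite differences, which always commute.

    Taking the velocity by its formula at every real time keeps all curves differentiable from both
    sides. The unit interval and the given version of the velocity enter only at the end, through
    uniqueness.

    The covariance estimate bounds the first space derivative of the velocity; the second is only
    shown to be continuous, so the augmented field need not be globally Lipschitz. Differentiability
    of flows is therefore proved for any field with continuous Jacobian whose flow is already given
    and bounded on bounded sets.

    The flow is never differentiated in its starting time: by the group property, u(r, y) is u(s, .)
    at the point reached by flowing y from time r back to time s, so only the space derivative of u
    at the fixed time s enters.

    Integrals over row vectors are taken for one measure built from the iterated integral of the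
    definitions; the law of X_t then comes from shears and Tonelli. *)

Section DeriveLambda.
Context {R : realType} {V : normedModType R}.

(** Restriction to a line brings directional derivatives under the one-variable chain rule and mean
    value theorem. *)
Lemma is_derive_line {W : normedModType R} (f : V -> W) (x v : V) (df : W) :
  is_derive x v f df <-> is_derive (0:R) 1 (fun h => f (h *: v + x)) df.
Proof.
have E : 'D_v f x = 'D_1 (fun h : R => f (h *: v + x)) 0.
  rewrite /derive; set g1 := fun h => h^-1 *: _; set g2 := fun h => h^-1 *: _.
  suff -> : g1 = g2 by [].
  by rewrite funeqE /g1 /g2 => h /=; rewrite addr0 scale0r add0r [_%:A]mulr1.
split=> -[d1 d2].
  by apply: DeriveDef; [exact: (derivable1P _ _ _).1 d1 | rewrite -E].
by apply: DeriveDef; [exact: (derivable1P _ _ _).2 d1 | rewrite E].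
Qed.

Lemma is_derive_comp1 (g : R -> R) (f : V -> R) (x v : V) (dg df : R) :
  is_derive (f x) 1 g dg -> is_derive x v f df ->
  is_derive x v (fun y => g (f y)) (dg * df).
Proof.
move=> hg hf; apply/(@is_derive_line R).
have {}hf := (@is_derive_line R f x v df).1 hf.
have hg' : is_derive ((fun h : R => f (h *: v + x)) 0) 1 g dg.
  by rewrite /= scale0r add0r.
by have := is_derive1_comp hg' hf.
Qed.

End DeriveLambda.

Section DeriveLambda2.
Context {R : realType} {V : normedModType R}.
Implicit Types f g : V -> R.

Lemma is_derD f g x v df dg : is_derive x v f df -> is_derive x v g dg ->
  is_derive x v (fun y => f y + g y) (df + dg).
Proof. exact: is_deriveD. Qed.

Lemma is_derN f x v df : is_derive x v f df ->
  is_derive x v (fun y => - f y) (- df).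
Proof. exact: is_deriveN. Qed.

Lemma is_derB f g x v df dg : is_derive x v f df -> is_derive x v g dg ->
  is_derive x v (fun y => f y - g y) (df - dg).
Proof. exact: is_deriveB. Qed.

Lemma is_derM f g x v df dg : is_derive x v f df -> is_derive x v g dg ->
  is_derive x v (fun y => f y * g y) (df * g x + f x * dg).
Proof.
by move=> hf hg; apply: is_derive_eq; rewrite addrC mulrC.
Qed.

Lemma is_derZ (c : R) f x v df : is_derive x v f df ->
  is_derive x v (fun y => c * f y) (c * df).
Proof. exact: is_deriveZ. Qed.

Lemma is_der_sum (I : finType) (f : I -> V -> R) x v (df : I -> R) :
  (forall i, is_derive x v (f i) (df i)) ->
  is_derive x v (fun y => \sum_i f i y) (\sum_i df i).
Proof.
move=> h; have -> : (fun y => \sum_i f i y) = \sum_i f i.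
  by apply/funext => y; rewrite fct_sumE.
elim/big_ind2 : _ => // [|] *; [exact: is_derive_cst|exact: is_deriveD].
Qed.

Lemma is_derive_ext f g x v df : f =1 g -> is_derive x v f df -> is_derive x v g df.
Proof. by move=> /funext ->. Qed.

End DeriveLambda2.

Lemma cvg_sumr {R : realType} {T : Type} (F : set_system T) {FF : Filter F} (I : finType)
    (f : I -> T -> R) (l : I -> R) :
  (forall i, f i x @[x --> F] --> l i) ->
  \sum_i f i x @[x --> F] --> \sum_i l i.
Proof.
move=> h; have -> : (fun x => \sum_i f i x) = \sum_i f i.
  by apply/funext => y; rewrite fct_sumE.
elim/big_ind2 : _ => // [|f1 l1 f2 l2 h1 h2]; first exact: cvg_cst.
exact: cvgD.
Qed.

Lemma continuous_sumr {R : realType} {T : topologicalType} (x : T) (I : finType)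
    (f : I -> T -> R) :
  (forall i, {for x, continuous (f i)}) -> {for x, continuous (fun y => \sum_i f i y)}.
Proof. by move=> h; apply: cvg_sumr => i; exact: h. Qed.

Lemma continuous_eps {R : realType} {V W : normedModType R} (f : V -> W) (x : V) :
  (forall e : R, 0 < e -> exists2 del : R, 0 < del &
     forall y, `|x - y| < del -> `|f x - f y| <= e) ->
  {for x, continuous f}.
Proof.
move=> h; apply/(@cvgrPdist_le _ _ _ _ (nbhs_filter x)) => e e0.
have [del d0 hd] := h e e0; apply/nbhs_normP; by exists del.
Qed.

Section Coord.
Context {R : realType} {n : nat}.
Notation V := 'rV[R]_n.
Notation E := (@ebasis R n).

Lemma norm_coord (x : V) i : `|x 0 i| <= `|x|.
Proof.
by rewrite [leRHS]/Num.Def.normr/= mx_normrE; apply: le_trans (le_bigmax _ _ (0,i)).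
Qed.

Lemma norm_le_coord (x : V) e : 0 <= e -> (forall i, `|x 0 i| <= e) -> `|x| <= e.
Proof.
move=> e0 h; rewrite [leLHS]/Num.Def.normr/= mx_normrE (bigmax_le _ e0)//= => -[i j] _.
by rewrite ord1.
Qed.

(** Row vectors carry the maximum norm, while the Euclidean sum of squares is differentiable and has
    Gaussians that factorise. This bound and the next one pass between the two at the cost of a
    factor [n]. *)
Lemma norm_sqr_le (x : V) : `|x| ^+ 2 <= \sum_i x 0 i ^+ 2.
Proof.
have s0 : 0 <= \sum_i x 0 i ^+ 2 by apply: sumr_ge0 => i _; exact: sqr_ge0.
rewrite -[leRHS]sqr_sqrtr// ler_sqr ?nnegrE ?sqrtr_ge0//.
apply: norm_le_coord; first exact: sqrtr_ge0.
move=> i; rewrite -sqrtr_sqr ler_wsqrtr// (bigD1 i)//= lerDl.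
by apply: sumr_ge0 => j _; exact: sqr_ge0.
Qed.

Lemma sqr_le_norm (x : V) : \sum_i x 0 i ^+ 2 <= n%:R * `|x| ^+ 2.
Proof.
apply: (@le_trans _ _ (\sum_(i < n) `|x| ^+ 2)).
  by apply: ler_sum => i _; rewrite -real_normK ?num_real// ler_sqr ?nnegrE// norm_coord.
by rewrite sumr_const card_ord mulr_natl.
Qed.

Lemma is_derive_coord {W : normedModType R} (g : W -> V) t v dg :
  is_derive t v g dg <-> forall i, is_derive t v (fun s => g s 0 i) (dg 0 i).
Proof.
split=> [[h1 h2] i|h].
  have hi := (derivable_mxP g t v).1 h1 0 i.
  by apply: DeriveDef => //; rewrite -h2 derive_mx// mxE.
have d1 : derivable g t v.
  by apply/derivable_mxP => i j; rewrite ord1; exact: (@ex_derive _ _ _ _ _ _ _ (h j)).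
apply: DeriveDef => //; rewrite derive_mx//; apply/rowP => j; rewrite mxE.
by rewrite derive_val.
Qed.

Lemma ebasisE i j : E i 0 j = (j == i)%:R :> R.
Proof. by rewrite /ebasis mxE eqxx. Qed.

Lemma MVT01 (f df : R -> R) : (forall t : R, 0 <= t <= 1 -> is_derive t 1 f (df t)) ->
  exists2 c, 0 <= c <= 1 & f 1 - f 0 = df c.
Proof.
move=> h; have [x||c] := @MVT_segment R f df 0 1 ler01.
- by rewrite in_itv/= => /andP[a b]; apply: h; rewrite !ltW.
- apply: derivable_within_continuous => x; rewrite in_itv/= => hx.
  by have /@ex_derive := h x hx.
by rewrite in_itv/= => hc ->; exists c; rewrite // subr0 mulr1.
Qed.

(** The vertices of the coordinate staircase from [0] to [z]: consecutive ones differ in a single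
    coordinate. *)
Definition trunc_row j (z : V) : V := \row_(i < n) (if (i < j)%N then z 0 i else 0).

(* Telescoping over the coordinates: only partial derivatives are needed. *)
Lemma MVT_coord (g : V -> R) (x z : V) (a : V) (e : R) :
  (forall y k, derivable g y (E k)) ->
  (forall y k, `|y - x| <= `|z| -> `|'D_(E k) g y - a 0 k| <= e) ->
  `|g (x + z) - g x - \sum_k a 0 k * z 0 k| <= n%:R * e * `|z|.
Proof.
move=> dg hb.
have tr0 : trunc_row 0 z = 0 by apply/rowP => i; rewrite !mxE.
have trn : trunc_row n z = z by apply/rowP => i; rewrite !mxE ltn_ord.
have -> : g (x + z) - g x - \sum_k a 0 k * z 0 k =
    \sum_(k < n) (g (x + trunc_row k.+1 z) - g (x + trunc_row k z) - a 0 k * z 0 k).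
  rewrite sumrB; congr (_ - _).
  rewrite -(big_mkord xpredT (fun k => g (x + trunc_row k.+1 z) - g (x + trunc_row k z))).
  by rewrite telescope_sumr// tr0 trn addr0.
apply: le_trans (ler_norm_sum _ _ _) _.
apply: (@le_trans _ _ (\sum_(k < n) (e * `|z|))); last first.
  by rewrite sumr_const card_ord -mulrA mulr_natl.
apply: ler_sum => k _.
have trS : trunc_row k.+1 z = z 0 k *: E k + trunc_row k z.
  apply/rowP => i; rewrite !mxE eqxx ltnS leq_eqVlt /=.
  have [->|nik] := eqVneq i k; first by rewrite eqxx ltnn mulr1 addr0.
  by rewrite mulr0 add0r (negbTE (_ : (i != k :> nat))).
pose p (s : R) : V := s * z 0 k *: E k + (x + trunc_row k z).
have hp (s : R) : is_derive s 1 (fun s => g (p s)) (z 0 k * 'D_(E k) g (p s)).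
  apply/(is_derive_line (W:=R)).
  have h := (is_derive_line (W:=R) _ _ _ _).1 (derivableP (dg (p s) k)).
  have hz : is_derive (0:R) 1 (fun h : R => h * z 0 k) (z 0 k).
    have := is_derM (is_derive_id (0:R) 1) (is_derive_cst (z 0 k) (0:R) 1).
    by rewrite mulr0 addr0 mul1r.
  have h' : is_derive ((0:R) * z 0 k) 1 (fun h : R => g (h *: E k + p s)) ('D_(E k) g (p s)).
    by rewrite mul0r.
  have := is_derive_comp1 (f := fun h : R => h * z 0 k) (x := (0:R)) h' hz; rewrite mulrC; apply: is_derive_ext => h0.
  by rewrite /p [_%:A]mulr1 mulrDl scalerDl addrA.
have [c /andP[c0 c1]] := MVT01 (fun t _ => hp t).
rewrite /p mul1r mul0r scale0r add0r addrCA -trS => ->.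
rewrite mulrC -mulrBl normrM; apply: ler_pM => //; last exact: norm_coord.
(* Each coordinate of a staircase point is zero or at most that of [z] in absolute value, so the
   staircase stays in the ball of radius [|z|] for the maximum norm. *)
apply: hb; rewrite addrCA addrAC subrr add0r.
apply: norm_le_coord => // i; rewrite !mxE eqxx /=.
have [->|nik] := eqVneq i k.
  rewrite ltnn addr0 mulr1 normrM ger0_norm//.
  by apply: le_trans (norm_coord z k); exact: ler_piMl.
rewrite mulr0 add0r; case: ifP => _; first exact: norm_coord.
by rewrite normr0.
Qed.

(** The staircase estimate with zero as reference gradient. *)
Lemma lipschitz_coord (g : V -> R) (x y : V) (A : R) :
  (forall y k, derivable g y (E k)) ->
  (forall y' k, `|y' - x| <= `|y - x| -> `|'D_(E k) g y'| <= A) ->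
  `|g y - g x| <= n%:R * A * `|y - x|.
Proof.
move=> dg hb; have := @MVT_coord g x (y - x) 0 A dg.
have -> : x + (y - x) = y by rewrite addrC subrK.
rewrite big1 ?subr0; last by move=> i _; rewrite mxE mul0r.
by apply => y' k hy'; rewrite mxE subr0; exact: hb.
Qed.

Lemma near_coord_approx (g : V -> R) (x : V) (e : R) : 0 < e ->
  (forall y k, derivable g y (E k)) ->
  (forall k, {for x, continuous ('D_(E k) g)}) ->
  \forall z \near (0 : V),
   `|g (x + z) - g x - \sum_k 'D_(E k) g x * z 0 k| <= e * `|z|.
Proof.
(* Compensates the factor [n] of the staircase estimate; the [+ 1] covers [n = 0]. *)
move=> e0 dg cg; have e1 : 0 < e / (n%:R + 1) by rewrite divr_gt0// ltr_wpDl.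
have : \forall y \near x, forall k, `|'D_(E k) g y - 'D_(E k) g x| <= e / (n%:R + 1).
  apply: (@filter_forall _ _ (fun k y => `|'D_(E k) g y - 'D_(E k) g x| <= e / (n%:R + 1)) _ (nbhs_filter x)) => k.
  have /cvgrPdist_le/(_ _ e1) := cg k.
  by apply: filterS => y; rewrite distrC.
move=> /nbhs_normP[r /= r0 hr]; apply/nbhs_norm0P; exists r => //= z zr.
have := @MVT_coord g x z (\row_k 'D_(E k) g x) (e / (n%:R + 1)) dg.
have -> : \sum_k (\row_k0 'D_(E k0) g x) 0 k * z 0 k = \sum_k 'D_(E k) g x * z 0 k.
  by apply: eq_bigr => k _; rewrite mxE.
move=> h; apply: le_trans (h _) _.
  move=> y k yz; rewrite mxE; apply: hr; rewrite /ball_/= distrC.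
  exact: le_lt_trans yz zr.
apply: ler_wpM2r => //; rewrite mulrCA -[leRHS]mulr1 ler_wpM2l ?ltW//.
by rewrite ltr_pdivrMr ?ltr_wpDl// mul1r ltrDl.
Qed.

Definition grad_lin (a : V) (z : V) : R := \sum_k a 0 k * z 0 k.

Lemma grad_lin_is_linear a : linear (grad_lin a).
Proof.
move=> c u v; rewrite /grad_lin scaler_sumr -big_split/=; apply: eq_bigr => k _.
by rewrite !mxE mulrDr mulrCA.
Qed.

HB.instance Definition _ a := GRing.isLinear.Build R V R *:%R (grad_lin a) (grad_lin_is_linear a).

Lemma continuous_grad_lin a : continuous (grad_lin a).
Proof.
move=> x; apply: (@continuous_sumr R V) => k.
apply: (@continuousM R V (cst (a 0 k)) (fun z : V => z 0 k)); first exact: cst_continuous.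
exact: coord_continuous.
Qed.

(** The staircase estimate with the gradient at [x] as reference is exactly the little-o expansion
    that characterises the differential. *)
Lemma C1_is_diff (g : V -> R) (x : V) :
  (forall y k, derivable g y (E k)) ->
  (forall k, {for x, continuous ('D_(E k) g)}) ->
  is_diff x g (grad_lin (\row_k 'D_(E k) g x)).
Proof.
move=> dg cg; set L := grad_lin _.
have cL : continuous L by exact: continuous_grad_lin.
have o : g \o shift x = cst (g x) + L +o_ (0 : V) id.
  apply/eqaddoP => e e0; have := @near_coord_approx g x e e0 dg cg.
  apply: filterS => z; rewrite !fctE /= [z + x]addrC opprD addrA.
  by rewrite /L /grad_lin; under [in X in _ -> X]eq_bigr do rewrite mxE.
have dE : 'd g x = L :> (V -> R) by exact: diff_unique.
apply: DiffDef => //.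
by apply/diff_locallyP; rewrite dE; split.
Qed.

Lemma is_derive_comp_C1 (g : V -> R) (z : R -> V) t (dz : V) :
  (forall y k, derivable g y (E k)) ->
  (forall k, {for z t, continuous ('D_(E k) g)}) ->
  is_derive t 1 z dz ->
  is_derive t 1 (fun s => g (z s)) (\sum_k 'D_(E k) g (z t) * dz 0 k).
Proof.
move=> dg cg hz; have hd := C1_is_diff dg cg.
have dz1 : differentiable z t by apply/derivable1_diffP; exact: ex_derive.
have dg1 : differentiable g (z t) by exact: ex_diff.
have dc := differentiable_comp dz1 dg1.
apply: DeriveDef; first exact/derivable1_diffP.
rewrite deriveE// diff_comp//= -(deriveE (1:R) dz1) (@derive_val _ _ _ _ _ _ _ hz).
rewrite (@diff_val _ _ _ _ _ _ _ hd).
by apply: eq_bigr => k _; rewrite mxE.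
Qed.

End Coord.
(** * Gronwall estimates *)

Section Gronwall.
Context {R : realType}.

(** Multiplied by the integrating factor [exp (- K (t - a))], [q] has nonpositive derivative, so the
    product is largest at [a]. *)
Lemma gronwall_fwd (q dq : R -> R) (K a b : R) :
  {within `[a, b], continuous q} ->
  (forall t, a < t < b -> is_derive t 1 q (dq t)) ->
  (forall t, a < t < b -> dq t <= K * q t) ->
  forall t, a <= t <= b -> q t <= q a * expR (K * (t - a)).
Proof.
move=> cq hq hK t /andP[at_ tb].
pose e s := expR (- K * (s - a)).
have he (s : R) : is_derive s 1 e (- K * e s).
  have h0 : is_derive s 1 (fun s => - K * (s - a)) (- K).
    have := is_derZ (- K) (is_derB (is_derive_id s 1) (is_derive_cst a s 1)).
    by rewrite subr0 mulr1.
  by rewrite mulrC; exact: is_derive_comp1 (is_derive_expR _) h0.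
have hp (s : R) : a < s < b -> is_derive s 1 (fun s => q s * e s) (dq s * e s + q s * (- K * e s)).
  by move=> hs; apply: is_derM => //; exact: hq.
have cp : {within `[a, b], continuous (fun s => q s * e s)}.
  move=> x; apply: cvgM; first exact: cq.
  suff ce : continuous e by exact: (continuous_subspaceT ce).
  move=> y; apply/differentiable_continuous/derivable1_diffP.
  exact: (@ex_derive _ _ _ _ _ _ _ (he y)).
have le : q t * e t <= q a * e a.
  apply: (@ler0_derive1_le_cc _ (fun s => q s * e s) a b) => //.
  - move=> x; rewrite in_itv/= => hx.
    exact: (@ex_derive _ _ _ _ _ _ _ (hp x hx)).
  - move=> x; rewrite in_itv/= => hx; rewrite derive1E.
    rewrite (@derive_val _ _ _ _ _ _ _ (hp x hx)).
    have -> : dq x * e x + q x * (- K * e x) = (dq x - K * q x) * e x by ring.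
    by rewrite mulr_le0_ge0 ?expR_ge0// subr_le0 hK.
  - by rewrite in_itv/= at_.
  - by rewrite in_itv/= lexx (le_trans at_ tb).
have ea : e a = 1 by rewrite /e subrr mulr0 expR0.
have et : e t * expR (K * (t - a)) = 1.
  by rewrite /e -expRD mulNr addNr expR0.
rewrite -[q t]mulr1 -et mulrA ler_wpM2r ?expR_ge0//.
by rewrite -[q a]mulr1 -ea.
Qed.

Context {n : nat}.
Notation V := 'rV[R]_n.

(** Growth rate of the square sum of a curve with [|f'| <= L |f| + e]: each of the [n] coordinates
    contributes at most [2 (L |f| + e) |f| <= (2 L + 1) (|f| ^ 2 + e ^ 2)]. *)
Definition gronwall_rate (L : R) : R := n%:R * (2 * L + 1).

(** The scalar estimate is applied to the sum of squares plus [e ^ 2]: squaring makes the norm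
    differentiable, and the added constant absorbs the inhomogeneity. Changing norms costs the
    factor [n.+1]; the square root of the exponential is bounded by the exponential itself, which is
    at least [1]. *)
Lemma gronwall_vec_fwd (f df : R -> V) (L e a b : R) : 0 <= L -> 0 <= e ->
  (forall i, {within `[a, b], continuous (fun t => f t 0 i)}) ->
  (forall t, a < t < b -> is_derive t 1 f (df t)) ->
  (forall t, a < t < b -> `|df t| <= L * `|f t| + e) ->
  forall t, a <= t <= b ->
    `|f t| <= (n.+1)%:R * (`|f a| + e) * expR (gronwall_rate L * (t - a)).
Proof.
move=> L0 e0 cf hf hb t hab.
pose q t := \sum_i f t 0 i ^+ 2 + e ^+ 2.
pose dq t := \sum_i 2 * (df t 0 i * f t 0 i).
have qf s : `|f s| ^+ 2 + e ^+ 2 <= q s by rewrite lerD2r norm_sqr_le.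
have cq : {within `[a, b], continuous q}.
  move=> x; apply: cvgD; last exact: cvg_cst.
  apply: continuous_sumr => i.
  have -> : (fun x => f x 0 i ^+ 2) = (fun x => f x 0 i * f x 0 i).
    by apply/funext => y; rewrite expr2.
  by apply: cvgM; exact: cf.
have hq s : a < s < b -> is_derive s 1 q (dq s).
  move=> hs; rewrite -[dq s]addr0.
  apply: (@is_derD R R (fun t => \sum_i f t 0 i ^+ 2) (cst (e ^+ 2)) s 1 (dq s) 0).
  apply: is_der_sum => i.
  have hi := (is_derive_coord f s 1 (df s)).1 (hf s hs) i.
  have -> : 2 * (df s 0 i * f s 0 i) = df s 0 i * f s 0 i + f s 0 i * df s 0 i by ring.
  by apply: is_derive_ext (is_derM hi hi) => y; rewrite expr2.
have K0 : 0 <= gronwall_rate L by rewrite /gronwall_rate mulr_ge0// addr_ge0// mulr_ge0.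
have hK s : a < s < b -> dq s <= gronwall_rate L * q s.
  move=> hs; have h := hb s hs.
  apply: (@le_trans _ _ (gronwall_rate L * (`|f s| ^+ 2 + e ^+ 2))); last first.
    by rewrite ler_wpM2l.
  rewrite /gronwall_rate -mulrA mulr_natl -[X in _ *+ X]card_ord -sumr_const.
  apply: ler_sum => i _.
  have h1 : df s 0 i * f s 0 i <= (L * `|f s| + e) * `|f s|.
    apply: le_trans (ler_norm _) _; rewrite normrM; apply: ler_pM => //.
      exact: le_trans (norm_coord _ _) h.
    exact: norm_coord.
  have h2 : 2 * (e * `|f s|) <= `|f s| ^+ 2 + e ^+ 2.
    by rewrite -subr_ge0 (_ : _ - _ = (`|f s| - e) ^+ 2) ?sqr_ge0//; ring.
  have h3 : 0 <= L * e ^+ 2 by rewrite mulr_ge0// sqr_ge0.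
  by nra.
have := gronwall_fwd cq hq hK hab; set E := expR _ => hE.
have E1 : 1 <= E.
  rewrite /E -expR0 ler_expR mulr_ge0// subr_ge0.
  by case/andP: hab.
have qa : q a <= ((n.+1)%:R * (`|f a| + e)) ^+ 2.
  apply: (@le_trans _ _ (n%:R * `|f a| ^+ 2 + e ^+ 2)).
    by rewrite lerD2r sqr_le_norm.
  rewrite -natr1; have := normr_ge0 (f a); set A := `|_| => A0.
  have n0 : 0 <= n%:R :> R by [].
  have h1 : 0 <= n%:R * (A ^+ 2) by rewrite mulr_ge0// sqr_ge0.
  have h2 : 0 <= n%:R * (A * e) by rewrite !mulr_ge0.
  have h3 : 0 <= n%:R * (e ^+ 2) by rewrite mulr_ge0// sqr_ge0.
  have h4 : 0 <= (n%:R * (A + e)) ^+ 2 by exact: sqr_ge0.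
  by have := mulr_ge0 A0 e0; nra.
rewrite -ler_sqr ?nnegrE ?mulr_ge0 ?addr_ge0 ?expR_ge0//.
apply: (@le_trans _ _ (q t)).
  by apply: le_trans (norm_sqr_le _) _; rewrite /q lerDl sqr_ge0.
apply: le_trans hE _; rewrite [leRHS]exprMn.
have : E <= E ^+ 2 by rewrite expr2 ler_peMl// (le_trans _ E1).
by move=> h; apply: ler_pM => //; rewrite ?expR_ge0// (le_trans _ (qf a)) ?addr_ge0 ?sqr_ge0.
Qed.

Lemma is_derive_reflect {W : normedModType R} (f : R -> W) (c t : R) df :
  is_derive (c - t) 1 f df -> is_derive t 1 (fun s => f (c - s)) (- df).
Proof.
move=> hf; have hr : is_derive t 1 (fun s : R => c - s) (-1).
  by have := is_derB (is_derive_cst c t 1) (is_derive_id t 1); rewrite sub0r.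
have d1 : differentiable (fun s : R => c - s) t by apply/derivable1_diffP; exact: ex_derive.
have d2 : differentiable f (c - t) by apply/derivable1_diffP; exact: ex_derive.
have d3 := differentiable_comp d1 d2.
apply: DeriveDef; first exact/derivable1_diffP.
rewrite deriveE// diff_comp//= -(deriveE (1:R) d1) (@derive_val _ _ _ _ _ _ _ hr).
by rewrite linearN/= -(deriveE (1:R) d2) (@derive_val _ _ _ _ _ _ _ hf).
Qed.

(** Backward in time, this is the forward estimate for the reflected curve [s -> f (2 t0 - s)]. *)
Lemma gronwall_vec (f df : R -> V) (L e t0 T : R) : 0 <= L -> 0 <= e ->
  (forall t : R, is_derive t 1 f (df t)) ->
  (forall t, `|t - t0| <= T -> `|df t| <= L * `|f t| + e) ->
  forall t, `|t - t0| <= T ->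
    `|f t| <= (n.+1)%:R * (`|f t0| + e) * expR (gronwall_rate L * T).
Proof.
have fwd (g dg : R -> V) (s0 : R) : 0 <= L -> 0 <= e ->
  (forall t : R, is_derive t 1 g (dg t)) ->
  (forall t, `|t - s0| <= T -> `|dg t| <= L * `|g t| + e) ->
  forall t, s0 <= t -> `|t - s0| <= T ->
    `|g t| <= (n.+1)%:R * (`|g s0| + e) * expR (gronwall_rate L * T).
  move=> L0 e0 hg hb t s0t hT.
  have htT : t <= s0 + T by rewrite -lerBlDl -[leLHS]ger0_norm// subr_ge0.
  have := @gronwall_vec_fwd g dg L e s0 (s0 + T) L0 e0.
  have cg i : {within `[s0, s0 + T], continuous (fun t => g t 0 i)}.
    apply: derivable_within_continuous => x _.
    exact: (@ex_derive _ _ _ _ _ _ _ ((is_derive_coord g x 1 (dg x)).1 (hg x) i)).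
  have hb' s : s0 < s < s0 + T -> `|dg s| <= L * `|g s| + e.
    move=> /andP[h1 h2]; apply: hb.
    by rewrite ger0_norm ?subr_ge0 ?lerBlDl; exact: ltW.
  move=> /(_ cg (fun s _ => hg s) hb' t); rewrite s0t htT => /(_ isT) h.
  apply: le_trans h _; rewrite ler_wpM2l ?mulr_ge0 ?addr_ge0// ler_expR.
  rewrite ler_wpM2l ?lerBlDl//.
  by rewrite /gronwall_rate mulr_ge0// addr_ge0// mulr_ge0.
move=> L0 e0 hf hb t hT; have [h|h] := leP t0 t; first exact: (fwd f df).
have := @fwd (fun s => f (2 * t0 - s)) (fun s => - df (2 * t0 - s)) t0 L0 e0.
have E s : 2 * t0 - s - t0 = - (s - t0) by ring.
move=> /(_ _ _ (2 * t0 - t)).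
have -> : 2 * t0 - (2 * t0 - t) = t by ring.
have -> : 2 * t0 - t0 = t0 by ring.
apply.
- by move=> s; apply: is_derive_reflect; exact: hf.
- move=> s hs; rewrite normrN; apply: hb.
  by rewrite E normrN.
- by move: h; lra.
- by rewrite E normrN.
Qed.

End Gronwall.

(** * Global existence for ordinary differential equations *)

Section Antiderivative.
Context {R : realType}.
Notation mu := (@lebesgue_measure R).

Lemma norm_MVT (f df : R -> R) (a b M : R) : a <= b ->
  (forall t, a < t < b -> is_derive t 1 f (df t)) ->
  {within `[a, b], continuous f} ->
  (forall t, a < t < b -> `|df t| <= M) -> `|f b - f a| <= M * (b - a).
Proof.
move=> ab hf cf hM.
move: ab; rewrite le_eqVlt => /predU1P[->|ab].
  by rewrite !subrr normr0 mulr0.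
have hf' (x : R) : x \in `]a, b[ -> is_derive x 1 f (df x) by rewrite in_itv/=; exact: hf.
have [c] := MVT ab hf' cf.
have ba0 : 0 <= b - a by rewrite subr_ge0 ltW.
by rewrite in_itv/= => hc ->; rewrite normrM (ger0_norm ba0) ler_wpM2r// hM.
Qed.

(** The fundamental theorem of calculus works on a bounded window. Primitives normalised at [0]
    agree on common windows, so the window may depend on the point. *)
Lemma antiderivative (c : R -> R) : continuous c ->
  exists C : R -> R, forall t : R, is_derive t 1 C (c t).
Proof.
move=> cc.
pose F (N t : R) := (\int[mu]_(s in `[- N, t]) c s)%R.
have dF (N t : R) : - N < t < N -> is_derive t 1 (F N) (c t).
  move=> /andP[h1 h2].
  have fi : mu.-integrable `[- N, N] (EFin \o c).
    apply: continuous_compact_integrable; first exact: segment_compact.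
    exact: continuous_subspaceT.
  have [d1 d2] := continuous_FTC1_closed h2 fi h1 (cc t).
  by apply: (DeriveDef d1); rewrite -derive1E.
pose B N t := F N t - F N 0.
have dB (N t : R) : - N < t < N -> is_derive t 1 (B N) (c t).
  move=> h; rewrite -[c t]subr0.
  apply: (@is_derB R R (F N) (cst (F N 0))); exact: dF.
have BB (N M t : R) : - N < t < N -> - M < t < M -> B N t = B M t.
  move=> hN hM; pose D s := B N s - B M s.
  have D0 : D 0 = 0 by rewrite /D /B !subrr.
  have hD (s : R) : - N < s < N -> - M < s < M -> is_derive s 1 D 0.
    by move=> h1 h2; rewrite -(subrr (c s)); apply: is_derB; exact: dB.
  have N0 : 0 < N by lra.
  have M0 : 0 < M by lra.
  suff : `|D t - D 0| <= 0 by rewrite D0 subr0 normr_le0 subr_eq0 => /eqP.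
  have key a b : a <= b -> - N < a -> b < N -> - M < a -> b < M -> `|D b - D a| <= 0.
    move=> ab h1 h2 h3 h4; rewrite -[leRHS](mul0r (b - a)).
    apply: (@norm_MVT D (fun=> 0)) => //.
    - by move=> s hs; apply: hD; lra.
    - apply: derivable_within_continuous => s; rewrite in_itv/= => hs.
      by apply: (@ex_derive _ _ _ _ _ _ _ (hD s _ _)); lra.
    - by move=> s _; rewrite normr0.
  have [h|h] := leP 0 t; first by apply: key; lra.
  by rewrite distrC; apply: key; lra.
(* Near [t] the moving window [|s| + 1] gives the same values as the fixed window [|t| + 2], on
   which the derivative is known. *)
exists (fun t => B (`|t| + 1) t) => t.
apply: (@near_eq_is_derive _ _ _ (B (`|t| + 2))); last first.
  by apply: dB; have := ler_norm t; have := ler_norm (- t); rewrite normrN; lra.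
apply/nbhs_normP; exists 1 => //= s; rewrite /ball_/= => hs.
have h1 := ler_norm s; have h2 := ler_norm (- s); have h3 := ler_norm t.
have h4 := ler_norm (- t); rewrite !normrN in h2 h4.
have h5 := lerB_dist s t; rewrite distrC in h5.
by apply: BB; lra.
Qed.

(** With [e n] the tail of the geometric series, [u n - e n] increases and [u n + e n] decreases;
    the supremum of the former lies between the two, which gives the limit together with its
    rate. *)
Lemma geo_lim (u : nat -> R) (A : R) :
  (forall n, `|u n.+1 - u n| <= A / 2 ^+ n) ->
  exists l, forall n, `|l - u n| <= 2 * A / 2 ^+ n.
Proof.
move=> h; pose e n := 2 * A / 2 ^+ n.
have eS n : e n = e n.+1 + A / 2 ^+ n.
  by rewrite /e exprS; field; rewrite expf_neq0.
have A0 : 0 <= A by have := h 0%N; rewrite expr0 divr1; exact: le_trans.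
have e0 n : 0 <= e n by rewrite /e divr_ge0 ?exprn_ge0// mulr_ge0.
pose v n := u n - e n; pose w n := u n + e n.
have vS n : v n <= v n.+1.
  rewrite /v (eS n); move: (h n); rewrite ler_norml => /andP[]; set a := A / _ => h1 h2; lra.
have wS n : w n.+1 <= w n.
  rewrite /w (eS n); move: (h n); rewrite ler_norml => /andP[]; set a := A / _ => h1 h2; lra.
have vmono m n : (m <= n)%N -> v m <= v n.
  by apply: (homo_leq (r := fun x y => x <= y)) => //; exact: le_trans.
have wmono m n : (m <= n)%N -> w n <= w m.
  by apply: (homo_leq (r := fun x y => y <= x)) => // y x z h1 h2; exact: le_trans h2 h1.
have vw m n : v m <= w n.
  apply: (le_trans (vmono _ _ (leq_maxl m n))).
  apply: (le_trans _ (wmono _ _ (leq_maxr m n))).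
  by rewrite /v /w; have := e0 (maxn m n); lra.
exists (sup (range v)) => n.
have h1 : v n <= sup (range v).
  apply: ub_le_sup; last by exists n.
  by exists (w 0%N) => _ [m _ <-]; exact: vw.
have h2 : sup (range v) <= w n.
  by apply: ge_sup; [exists (v 0%N), 0%N | move=> _ [m _ <-]; exact: vw].
by rewrite ler_norml /v /w /e in h1 h2 *; lra.
Qed.

Lemma continuous_bounded {W : normedModType R} (g : R -> W) (N : R) : continuous g ->
  exists2 K, 0 <= K & forall t, `|t| <= N -> `|g t| <= K.
Proof.
move=> cg; have [N0|N0] := leP 0 N; last first.
  by exists 0 => // t ht; have := le_lt_trans ht N0; rewrite normr_lt0.
have [||c hc] := @EVT_max R (fun t => `|g t|) (- N) N; first lra.
  apply: continuous_subspaceT => x; apply: continuous_comp; first exact: cg.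
  exact: norm_continuous.
move=> hmax; exists `|g c| => // t; rewrite ler_norml => ht.
by apply: hmax; rewrite in_itv.
Qed.

End Antiderivative.

Section Picard.
Context {R : realType} {n : nat}.
Notation V := 'rV[R]_n.

Lemma is_derive_continuous {W : normedModType R} (g : R -> W) dg :
  (forall t : R, is_derive t 1 g (dg t)) -> continuous g.
Proof.
move=> h t; apply/differentiable_continuous/derivable1_diffP.
exact: (@ex_derive _ _ _ _ _ _ _ (h t)).
Qed.

Lemma continuous_coordP {T : topologicalType} (g : T -> V) (x : T) :
  {for x, continuous g} <-> forall i, {for x, continuous (fun t => g t 0 i)}.
Proof.
split=> [cg i|h].
  by apply: (@continuous_comp _ _ _ g (fun v : V => v 0 i)) => //; exact: coord_continuous.
apply/cvgrPdist_le => e e0; near=> y.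
apply: norm_le_coord; first exact: ltW.
move=> i; rewrite !mxE; move: i; near: y.
apply: (@filter_forall _ _ _ _ (nbhs_filter x)) => i.
by have /cvgrPdist_le/(_ _ e0) := h i.
Unshelve. all: by end_near. Qed.

(* Source of the contraction in Picard iteration: integrating the weight
   [exp (c |t - t0|)] divides it by [c]. *)
Lemma exp_growth_le (f df : R -> V) (A c t0 N : R) : 0 <= A -> 0 < c -> f t0 = 0 ->
  (forall t : R, is_derive t 1 f (df t)) ->
  (forall t, `|t| <= N -> `|df t| <= A * expR (c * `|t - t0|)) -> `|t0| <= N ->
  forall t, `|t| <= N -> `|f t| <= A / c * expR (c * `|t - t0|).
Proof.
have fwd (g dg : R -> V) (s0 N1 N2 : R) : 0 <= A -> 0 < c -> g s0 = 0 ->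
  (forall t : R, is_derive t 1 g (dg t)) ->
  (forall t, N1 <= t <= N2 -> `|dg t| <= A * expR (c * `|t - s0|)) -> N1 <= s0 ->
  forall t, s0 <= t <= N2 -> `|g t| <= A / c * expR (c * `|t - s0|).
  move=> A0 c0 g0 hg hb N1s t /andP[s0t tN2].
  rewrite ger0_norm ?subr_ge0//.
  have Ac : 0 <= A / c by rewrite divr_ge0// ltW.
  apply: norm_le_coord => [|i]; first by rewrite mulr_ge0// expR_ge0.
  pose p (s : R) := A / c * expR (c * (s - s0)).
  have hp (s : R) : is_derive s 1 p (A * expR (c * (s - s0))).
    have h0 : is_derive s 1 (fun s => c * (s - s0)) c.
      have := is_derZ c (is_derB (is_derive_id s 1) (is_derive_cst s0 s 1)).
      by rewrite subr0 mulr1.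
    have := is_derZ (A / c) (is_derive_comp1 (is_derive_expR _) h0).
    have -> : A / c * (expR (c * (s - s0)) * c) = A * expR (c * (s - s0)).
      by field; rewrite gt_eqF.
    by [].
  have key (k dk : R -> R) : k s0 = 0 -> (forall t : R, is_derive t 1 k (dk t)) ->
      (forall t, N1 <= t <= N2 -> dk t <= A * expR (c * `|t - s0|)) -> k t <= p t.
    move=> k0 hk kb.
    have hq (s : R) : is_derive s 1 (fun s => k s - p s) (dk s - A * expR (c * (s - s0))).
      exact: is_derB.
    have : k t - p t <= k s0 - p s0.
      apply: (@ler0_derive1_le_cc _ (fun s => k s - p s) s0 t) => //.
      - move=> x; rewrite in_itv/= => /andP[h1 h2]; rewrite derive1E.
        rewrite (@derive_val _ _ _ _ _ _ _ (hq x)) subr_le0.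
        have xs : 0 <= x - s0 by rewrite subr_ge0 ltW.
        have := kb x; rewrite (ger0_norm xs); apply.
        by rewrite (le_trans N1s (ltW h1)) (le_trans (ltW h2)).
      - apply: continuous_subspaceT; exact: is_derive_continuous hq.
      - by rewrite in_itv/= lexx s0t.
      - by rewrite in_itv/= lexx s0t.
    rewrite k0 sub0r => h; rewrite -subr_le0; apply: (le_trans h).
    by rewrite oppr_le0 /p mulr_ge0// expR_ge0.
  have hi (s : R) := (is_derive_coord g s 1 (dg s)).1 (hg s) i.
  have g0i : g s0 0 i = 0 by rewrite g0 mxE.
  rewrite ler_norml; apply/andP; split.
    rewrite lerNl; apply: (key (fun s => - g s 0 i) (fun s => - dg s 0 i)).
    - by rewrite g0i oppr0.
    - move=> s hs; apply: le_trans (hb s hs).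
      by apply: le_trans (norm_coord _ i); rewrite -normrN; exact: ler_norm.
  apply: (key (fun s => g s 0 i) (fun s => dg s 0 i)) => //.
  move=> s hs; apply: le_trans (hb s hs).
  by apply: le_trans (norm_coord _ i); exact: ler_norm.
move=> A0 c0 f0 hf hb ht0 t hT.
move: ht0 hT; rewrite !ler_norml => /andP[a1 a2] /andP[b1 b2].
have [h|h] := leP t0 t.
  apply: (@fwd f df t0 (- N) N) => //; last by rewrite h.
  by move=> s hs; apply: hb; rewrite ler_norml.
have := @fwd (fun s => f (2 * t0 - s)) (fun s => - df (2 * t0 - s)) t0
  (2 * t0 - N) (2 * t0 + N) A0 c0.
have E s : 2 * t0 - s - t0 = - (s - t0) by ring.
have -> : 2 * t0 - t0 = t0 by ring.
move=> /(_ f0 _ _ _ (2 * t0 - t)).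
have -> : 2 * t0 - (2 * t0 - t) = t by ring.
rewrite E normrN; apply.
- by move=> s; apply: is_derive_reflect; exact: hf.
- move=> s hs; rewrite normrN.
  have -> : `|s - t0| = `|2 * t0 - s - t0| by rewrite E normrN.
  by apply: hb; rewrite ler_norml; lra.
- lra.
- lra.
Qed.

Definition jcont {W : topologicalType} (f : R -> V -> W) : Prop :=
  continuous (fun p : R * V => f p.1 p.2).

Lemma continuous_for_pair {T U W : topologicalType} (f : T -> U) (g : T -> W) (x : T) :
  {for x, continuous f} -> {for x, continuous g} ->
  {for x, continuous (fun p => (f p, g p))}.
Proof. by move=> cf cg; exact: (cvg_pair cf cg). Qed.

Lemma jcont_comp {T W : topologicalType} (f : R -> V -> W) (a : T -> R) (b : T -> V) (x : T) :
  jcont f -> {for x, continuous a} -> {for x, continuous b} ->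
  {for x, continuous (fun p => f (a p) (b p))}.
Proof.
move=> cf ca cb.
apply: (@continuous_comp _ _ _ (fun p => (a p, b p)) (fun p => f p.1 p.2)); last exact: cf.
exact: continuous_for_pair.
Qed.

Lemma jcont_curve {W : topologicalType} (f : R -> V -> W) (y : R -> V) : jcont f ->
  continuous y -> continuous (fun t => f t (y t)).
Proof.
by move=> cf cy t; exact: (@jcont_comp R W f id y t cf (@cvg_id _ (nbhs t)) (cy t)).
Qed.

Definition lipx (f : R -> V -> V) : Prop := forall N : R, exists2 L : R, 0 <= L &
  forall t, `|t| <= N -> forall x y, `|f t x - f t y| <= L * `|x - y|.

Lemma antiderivative_vec (c : R -> V) (t0 : R) (x0 : V) : continuous c ->
  exists2 C : R -> V, C t0 = x0 & forall t : R, is_derive t 1 C (c t).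
Proof.
move=> cc.
have /choice[C hC] : forall i, exists C : R -> R, forall t : R, is_derive t 1 C (c t 0 i).
  by move=> i; apply: antiderivative => t; exact: (continuous_coordP c t).1 (cc t) i.
exists (fun t => x0 + (\row_i C i t - \row_i C i t0)); first by rewrite subrr addr0.
move=> t; apply/is_derive_coord => i.
have : is_derive t 1 (fun s => (x0 0 i - C i t0) + C i s) (0 + c t 0 i).
  exact: (@is_derD R R (cst (x0 0 i - C i t0)) (C i)).
by rewrite add0r; apply: is_derive_ext => s; rewrite !mxE; ring.
Qed.

(** All iterates live on the whole line. On [|t| <= N] the weighted growth estimate with rate [2 L]
    halves the distance of successive iterates, so convergence is geometric and locally uniform, and
    no local solutions have to be glued. *)
Lemma picard (f : R -> V -> V) (t0 : R) (x0 : V) : jcont f -> lipx f ->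
  exists2 y : R -> V, y t0 = x0 & forall t : R, is_derive t 1 y (f t (y t)).
Proof.
move=> cf lf.
have /choice[S hS] : forall y : R -> V, exists Y : R -> V, continuous y ->
    Y t0 = x0 /\ forall t : R, is_derive t 1 Y (f t (y t)).
  move=> y; have [cy|ncy] := pselect (continuous y); last by exists y.
  have [Y Y0 hY] := antiderivative_vec t0 x0 (jcont_curve cf cy).
  by exists Y => _.
pose ys k := iter k S (cst x0).
have cys k : continuous (ys k).
  elim: k => [|k ih]; first by move=> t; exact: cst_continuous.
  by have [_ h] := hS _ ih; exact: is_derive_continuous h.
have ys0 k : ys k t0 = x0.
  by case: k => // k; have [] := hS _ (cys k).
have hys k (t : R) : is_derive t 1 (ys k.+1) (f t (ys k t)).
  by have [_] := hS _ (cys k); exact.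
have rate N : `|t0| <= N -> exists A, forall k t, `|t| <= N ->
    `|ys k.+1 t - ys k t| <= A / 2 ^+ k.
  move=> hN; have [L' L'0 hL'] := lf N.
  (* The weight rate [2 * L] must be positive. *)
  pose L := L' + 1; have L0 : 0 < L by rewrite /L; lra.
  have hL t x y : `|t| <= N -> `|f t x - f t y| <= L * `|x - y|.
    move=> ht; apply: (le_trans (hL' t ht x y)); rewrite ler_wpM2r// /L; lra.
  have [K K0 hK] : exists2 K, 0 <= K & forall t, `|t| <= N -> `|ys 1%N t - ys 0%N t| <= K.
    apply: (@continuous_bounded R _ (fun t => ys 1%N t - ys 0%N t)) => t.
    by apply: cvgB; exact: cys.
  have step k t : `|t| <= N -> `|ys k.+1 t - ys k t| <= K / 2 ^+ k * expR (2 * L * `|t - t0|).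
    elim: k t => [|k ih] t hT.
      rewrite expr0 divr1; apply: (@le_trans _ _ K).
        exact: hK t hT.
      by rewrite ler_peMr// -expR0 ler_expR mulr_ge0// mulr_ge0// ltW.
    have hd (s : R) : is_derive s 1 (fun s => ys k.+2 s - ys k.+1 s)
        (f s (ys k.+1 s) - f s (ys k s)).
      exact: (is_deriveB (hys k.+1 s) (hys k s)).
    have := @exp_growth_le _ _ (L * (K / 2 ^+ k)) (2 * L) t0 N _ _ _ hd _ hN t hT.
    have -> : L * (K / 2 ^+ k) / (2 * L) = K / 2 ^+ k.+1.
      by rewrite exprS; field; rewrite expf_neq0//= gt_eqF.
    apply.
    - by rewrite mulr_ge0 ?divr_ge0 ?exprn_ge0// ltW.
    - by rewrite mulr_gt0.
    - by rewrite !ys0 subrr.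
    - move=> s hs; apply: (le_trans (hL s _ _ hs)).
      by rewrite -mulrA; apply: ler_wpM2l; [exact: ltW|exact: ih].
  exists (K * expR (2 * L * (N + N))) => k t hT.
  apply: (le_trans (step k t hT)); rewrite mulrAC ler_wpM2r ?invr_ge0 ?exprn_ge0//.
  rewrite ler_wpM2l// ler_expR ler_wpM2l//; first by rewrite mulr_ge0// ltW.
  by apply: (le_trans (ler_normB _ _)); exact: lerD.
have /choice[A hA] : forall N, exists A, `|t0| <= N -> forall k t, `|t| <= N ->
    `|ys k.+1 t - ys k t| <= A / 2 ^+ k.
  move=> N; have [h|h] := pselect (`|t0| <= N); last by exists 0.
  by have [A ?] := rate N h; exists A.
have /choice[y hy] : forall t, exists y : V, forall N, `|t0| <= N -> `|t| <= N ->
    forall k, `|y - ys k t| <= 2 * A N / 2 ^+ k.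
  move=> t; pose M := Num.max `|t0| `|t|.
  have M0 : `|t0| <= M by rewrite le_max lexx.
  have M1 : `|t| <= M by rewrite le_max lexx orbT.
  have /choice[l hl] : forall i, exists l : R, forall k, `|l - ys k t 0 i| <= 2 * A M / 2 ^+ k.
    move=> i; apply: geo_lim => k; apply: le_trans (hA M M0 k t M1).
    by have := norm_coord (ys k.+1 t - ys k t) i; rewrite !mxE.
  exists (\row_i l i) => N h1 h2 k.
  have AN0 : 0 <= A N by have := hA N h1 0%N t h2; rewrite expr0 divr1; exact: le_trans.
  apply: norm_le_coord => [|i]; first by rewrite divr_ge0 ?exprn_ge0// mulr_ge0.
  (* The rate attached to [N] yields its own limit [l']; it equals [l i] because the same iterates
     converge to both. *)
  have [l' hl'] : exists l', forall k, `|l' - ys k t 0 i| <= 2 * A N / 2 ^+ k.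
    apply: geo_lim => j; apply: le_trans (hA N h1 j t h2).
    by have := norm_coord (ys j.+1 t - ys j t) i; rewrite !mxE.
  rewrite !mxE; suff <- : l' = l i by [].
  apply/eqP; rewrite -subr_eq0 -normr_le0; apply/ler_addgt0Pr => e e0; rewrite add0r.
  have B0 : 0 <= 2 * A N + 2 * A M.
    by have := hA M M0 0%N t M1; rewrite expr0 divr1 => /(le_trans (normr_ge0 _)); lra.
  have [j hj] : exists j, (2 * A N + 2 * A M) / 2 ^+ j <= e.
    have /cvgrPdist_le/(_ e e0) : geometric (2 * A N + 2 * A M) (2^-1 : R) @ \oo --> 0.
      by apply: cvg_geometric; rewrite ger0_norm ?invr_ge0// invf_lt1// ltrDl.
    move=> [j _ /(_ j (leqnn j))]; rewrite /geometric /= sub0r normrN exprVn => h.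
    by exists j; apply: le_trans h; exact: ler_norm.
  apply: le_trans hj; rewrite mulrDl.
  apply: le_trans (lerD (hl' j) (hl i j)).
  by rewrite [`|l i - _|]distrC -(subrKA (ys j t 0 i)) ler_normD.
have small N e : 0 < e -> exists j, forall k, (j <= k)%N -> 2 * A N / 2 ^+ k <= e.
  move=> e0; have /cvgrPdist_le/(_ e e0) : geometric (2 * A N) (2^-1 : R) @ \oo --> 0.
    by apply: cvg_geometric; rewrite ger0_norm ?invr_ge0// invf_lt1// ltrDl.
  move=> [j _ h]; exists j => k jk; have := h k jk.
  by rewrite /geometric /= sub0r normrN exprVn; apply: le_trans; exact: ler_norm.
have cy : continuous y.
  move=> t; apply/cvgrPdist_le => e e0.
  pose N := Num.max `|t0| (`|t| + 1).
  have N0 : `|t0| <= N by rewrite le_max lexx.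
  have N1 : `|t| + 1 <= N by rewrite le_max lexx orbT.
  have N2 : `|t| <= N by apply: le_trans N1; rewrite lerDl.
  have e3 : 0 < e / 3 by rewrite divr_gt0.
  have [j /(_ j (leqnn j)) hj] := small N (e / 3) e3.
  have /cvgrPdist_le/(_ _ e3) := cys j t.
  have near1 : \forall s \near t, `|s| <= N.
    apply/nbhs_normP; exists 1 => //= s; rewrite /ball_/= => hs.
    by apply: le_trans N1; have := lerB_dist s t; rewrite distrC in hs; lra.
  move=> h; near=> s.
  have hs : `|s| <= N by near: s.
  have h1 := hy t N N0 N2 j; have h2 := hy s N N0 hs j.
  have h3 : `|ys j t - ys j s| <= e / 3 by near: s.
  have -> : y t - y s = (y t - ys j t) + (ys j t - ys j s) + (ys j s - y s).
    by rewrite !subrKA.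
  apply: (le_trans (ler_normD _ _)).
  have h4 := ler_normD (y t - ys j t) (ys j t - ys j s).
  rewrite [`|ys j s - y s|]distrC; lra.
have [Y0 hY] := hS y cy.
(* [S y] is close to [ys j.+1] because [y] is close to [ys j]; letting [j] grow identifies [S y],
   which is differentiable by construction, with [y]. *)
suff E t : S y t = y t.
  by exists (S y) => // t; rewrite E.
pose N := Num.max `|t0| `|t|.
have M0 : `|t0| <= N by rewrite le_max lexx.
have M1 : `|t| <= N by rewrite le_max lexx orbT.
have [L L0 hL] := lf N.
apply/eqP; rewrite -subr_eq0 -normr_le0; apply/ler_addgt0Pr => e e0; rewrite add0r.
pose c := L * expR (1 * `|t - t0|) + 1.
have c0 : 0 < c by rewrite ltr_wpDl// mulr_ge0// expR_ge0.
have [j hj] := small N (e / c) (divr_gt0 e0 c0).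
have hj0 := hj j (leqnn j); have hj1 := hj j.+1 (leqnSn j).
have A0 : 0 <= 2 * A N / 2 ^+ j by exact: le_trans (hy t N M0 M1 j).
have hd (s : R) : is_derive s 1 (fun s => S y s - ys j.+1 s) (f s (y s) - f s (ys j s)).
  exact: (is_deriveB (hY s) (hys j s)).
have := @exp_growth_le _ _ (L * (2 * A N / 2 ^+ j)) 1 t0 N _ _ _ hd _ M0 t M1.
rewrite divr1 => h.
have {}h : `|S y t - ys j.+1 t| <= L * (2 * A N / 2 ^+ j) * expR (1 * `|t - t0|).
  apply: h => //.
  - by rewrite mulr_ge0.
  - by rewrite Y0 ys0 subrr.
  - move=> s hs; apply: (le_trans (hL s hs _ _)); apply: (@le_trans _ _ (L * (2 * A N / 2 ^+ j))).
      by rewrite ler_wpM2l// hy.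
    apply: ler_peMr; first by rewrite mulr_ge0.
    by rewrite -expR0 ler_expR mulr_ge0.
have -> : S y t - y t = (S y t - ys j.+1 t) + (ys j.+1 t - y t) by rewrite addrA subrK.
apply: (le_trans (ler_normD _ _)); rewrite [`|ys _ _ - _|]distrC.
have h2 := hy t N M0 M1 j.+1.
have -> : e = e / c * c by rewrite divfK// gt_eqF.
rewrite /c mulrDr mulr1; apply: lerD; last exact: le_trans h2 hj1.
apply: (le_trans h); rewrite mulrAC mulrC ler_wpM2r//.
by rewrite mulr_ge0// expR_ge0.
Unshelve. all: by end_near. Qed.

End Picard.

(** * Dependence of the flow on the initial point *)

Section FlowC1.
Context {R : realType} {n : nat}.
Notation V := 'rV[R]_n.
Notation E := (@ebasis R n).
Implicit Types (g : R -> V -> R) (t : R) (x y z : V).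

Lemma jbounded g (N B : R) : jcont g -> exists2 L, 0 <= L &
  forall t x, `|t| <= N -> `|x| <= B -> `|g t x| <= L.
Proof.
move=> cg.
pose K : set (R * V) := `[- N, N] `*` [set v : V | forall i, `[- B, B]%classic (v ord0 i)].
have cK : compact K.
  apply: compact_setX; first exact: segment_compact.
  by apply: (@rV_compact _ _ (fun=> `[- B, B]%classic)) => i; exact: segment_compact.
have inK t x : `|t| <= N -> `|x| <= B -> K (t, x).
  move=> ht hx; split => /=; first by rewrite in_itv/= -ler_norml.
  by move=> i; rewrite in_itv/= -ler_norml; exact: le_trans (norm_coord x i) hx.
have [[p Kp]|K0] := pselect (K !=set0); last first.
  by exists 0 => // t x ht hx; exfalso; apply: K0; exists (t, x); exact: inK.
have ck : {within K, continuous (fun p : R * V => `|g p.1 p.2|)}.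
  apply: continuous_subspaceT => q; apply: continuous_comp; first exact: cg.
  exact: norm_continuous.
have [|c _ hc] := compact_EVT_max _ cK ck; first by exists p.
exists `|g c.1 c.2| => // t x ht hx.
by apply: (hc (t, x)); rewrite inE; exact: inK.
Qed.

Lemma fin_bound (I : finType) (P : I -> R -> Prop) :
  (forall i L L', P i L -> L <= L' -> P i L') ->
  (forall i, exists2 L, 0 <= L & P i L) -> exists2 L, 0 <= L & forall i, P i L.
Proof.
move=> mono h.
have /choice[L hL] : forall i, exists L, 0 <= L /\ P i L.
  by move=> i; have [L] := h i; exists L.
exists (\sum_i L i) => [|i]; first by apply: sumr_ge0 => i _; case: (hL i).
apply: (mono _ (L i)); first by case: (hL i).
by rewrite (bigD1 i)//= lerDl; apply: sumr_ge0 => j _; case: (hL j).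
Qed.

Lemma jbounded_fin (I : finType) (g : I -> R -> V -> R) (N B : R) :
  (forall i, jcont (g i)) -> exists2 L, 0 <= L &
  forall i t x, `|t| <= N -> `|x| <= B -> `|g i t x| <= L.
Proof.
move=> cg; have [|i|L L0 hL] := @fin_bound I (fun i L => forall t x,
    `|t| <= N -> `|x| <= B -> `|g i t x| <= L).
- by move=> i L L' h LL t x ht hx; exact: le_trans (h t x ht hx) LL.
- exact: jbounded.
- by exists L.
Qed.

(** Compactness of the time interval turns joint continuity into a modulus of continuity valid in a
    whole tube around the curve [c]. *)
Lemma unif_near g (c : R -> V) (N e : R) : jcont g -> continuous c -> 0 < e ->
  exists2 del, 0 < del & forall t, `|t| <= N -> forall z, `|z| <= del ->
    `|g t (c t + z) - g t (c t)| <= e.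
Proof.
move=> cg cc e0.
have /compact_near_coveringP/(_ V (nbhs (0 : V))
    (fun z t => `|g t (c t + z) - g t (c t)| <= e) (nbhs_filter _)) :=
    @segment_compact R (- N) N.
have H : forall x : R, `[- N, N]%classic x ->
    \forall x' \near x & i \near (0 : V), `|g x' (c x' + i) - g x' (c x')| <= e.
  move=> t _; pose h (p : R * V) := g p.1 (c p.1 + p.2) - g p.1 (c p.1).
  have ch : {for (t, 0), continuous h}.
    have c1 : {for (t, 0 : V), continuous (fun p : R * V => c p.1)}.
      by apply: continuous_comp; [exact: cvg_fst | exact: cc].
    have c2 : {for (t, 0 : V), continuous (fun p : R * V => p.1)} by exact: cvg_fst.
    apply: (@continuousB R R _ (fun p : R * V => g p.1 (c p.1 + p.2)) (fun p => g p.1 (c p.1))).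
      apply: (@jcont_comp R n (R * V)%type R g fst (fun p => c p.1 + p.2) (t, 0) cg c2).
      apply: (@continuousD R V _ (fun p : R * V => c p.1) snd (t, 0) c1).
      exact: cvg_snd.
    exact: (@jcont_comp R n (R * V)%type R g fst (fun p => c p.1) (t, 0) cg c2 c1).
  have /cvgrPdist_le/(_ _ e0) := ch.
  have h0 : h (t, 0) = 0 by rewrite /h /= addr0 subrr.
  rewrite h0; apply: filterS => -[t' z] /=.
  by rewrite sub0r normrN.
move=> /(_ H) /nbhs_norm0P[del /= del0 hdel].
exists (del / 2) => [|t ht z hz]; first by rewrite divr_gt0.
apply: (hdel z) => /=; first by apply: le_lt_trans hz _; lra.
by rewrite in_itv/= -ler_norml.
Qed.

(** The Jacobian applied to [y]: [d k l] is the partial derivative of the component [l] in the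
    direction [k]. *)
Definition lin (d : 'I_n -> 'I_n -> R -> V -> R) t x y : V :=
  \row_l \sum_k y 0 k * d k l t x.

Lemma lin_bound d t x y L : 0 <= L -> (forall k l, `|d k l t x| <= L) ->
  `|lin d t x y| <= n%:R * L * `|y|.
Proof.
move=> L0 hL; apply: norm_le_coord => [|l]; first by rewrite !mulr_ge0.
rewrite mxE; apply: le_trans (ler_norm_sum _ _ _) _.
apply: (@le_trans _ _ (\sum_(k < n) (L * `|y|))).
  apply: ler_sum => k _; rewrite normrM mulrC.
  by apply: ler_pM => //; exact: norm_coord.
by rewrite sumr_const card_ord -mulrA mulr_natl.
Qed.

Lemma linB d t x y z : lin d t x (y - z) = lin d t x y - lin d t x z.
Proof.
apply/rowP => l; rewrite !mxE -sumrB; apply: eq_bigr => k _.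
by rewrite !mxE mulrBl.
Qed.

Lemma linZ d t x y (c : R) : lin d t x (c *: y) = c *: lin d t x y.
Proof.
apply/rowP => l; rewrite !mxE mulr_sumr; apply: eq_bigr => k _.
by rewrite !mxE mulrA.
Qed.

Section Field.
Variables (f : R -> V -> V) (d : 'I_n -> 'I_n -> R -> V -> R).
Hypothesis hd : forall t y k l, is_derive y (E k) (fun y => f t y 0 l) (d k l t y).

Lemma field_MVT t x z (e : R) : 0 <= e ->
  (forall y k l, `|y - x| <= `|z| -> `|d k l t y - d k l t x| <= e) ->
  `|f t (x + z) - f t x - lin d t x z| <= n%:R * e * `|z|.
Proof.
move=> e0 h; apply: norm_le_coord => [|l]; first by rewrite !mulr_ge0.
have := @MVT_coord R n (fun y => f t y 0 l) x z (\row_k d k l t x) e.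
rewrite !mxE (eq_bigr (fun k => z 0 k * d k l t x)); last first.
  by move=> k _; rewrite mxE mulrC.
apply=> y k; first exact: (@ex_derive _ _ _ _ _ _ _ (hd t y k l)).
by move=> hy; rewrite mxE (@derive_val _ _ _ _ _ _ _ (hd t y k l)) h.
Qed.

Lemma field_lip t x y (L : R) : 0 <= L ->
  (forall y' k l, `|y' - x| <= `|y - x| -> `|d k l t y'| <= L) ->
  `|f t y - f t x| <= n%:R * L * `|y - x|.
Proof.
move=> L0 h; apply: norm_le_coord => [|l]; first by rewrite !mulr_ge0.
have := @lipschitz_coord R n (fun y => f t y 0 l) x y L.
rewrite !mxE; apply=> y' k; first exact: (@ex_derive _ _ _ _ _ _ _ (hd t y' k l)).
by move=> hy; rewrite (@derive_val _ _ _ _ _ _ _ (hd t y' k l)) h.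
Qed.

Lemma bounded_d_lipx : (forall N : R, exists2 L : R, 0 <= L &
    forall k l t x, `|t| <= N -> `|d k l t x| <= L) -> lipx f.
Proof.
move=> hb N; have [L L0 hL] := hb N.
exists (n%:R * L); first by rewrite mulr_ge0.
by move=> t ht x y; apply: field_lip => // y' k l _; exact: hL.
Qed.

Hypothesis cd : forall k l, jcont (d k l).
Variables (s : R) (flow : V -> R -> V).
Hypothesis flow_s : forall x, flow x s = x.
Hypothesis flow_ode : forall x t, is_derive t 1 (flow x) (f t (flow x t)).
(** Boundedness on bounded sets stands in for a global Lipschitz condition on [f], so that the
    results also apply to the augmented system, whose Jacobian grows with [y]. *)
Hypothesis flow_bounded : forall N M : R, exists2 B : R, 0 <= B &
  forall t x, `|t| <= N -> `|x| <= M -> `|flow x t| <= B.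

Lemma d_bounded (N B : R) : exists2 L : R, 0 <= L &
  forall k l t x, `|t| <= N -> `|x| <= B -> `|d k l t x| <= L.
Proof.
have [L L0 hL] := @jbounded_fin ('I_n * 'I_n)%type (fun i => d i.1 i.2) N B
  (fun i => @cd i.1 i.2).
by exists L => // k l t x; exact: (hL (k, l)).
Qed.

Lemma flow_locally_lip (N M : R) : exists2 C : R, 0 <= C & forall t x x',
  `|t| <= N -> `|x| <= M -> `|x'| <= M -> `|flow x t - flow x' t| <= C * `|x - x'|.
Proof.
(* Gronwall is run over times within [N + |s|] of [s], hence of size at most [N + 2 |s|]. Points no
   farther from one trajectory than the other trajectory is have norm at most [B + 2 B]. *)
have [B B0 hB] := flow_bounded (N + 2 * `|s|) M.
have [L L0 hL] := d_bounded (N + 2 * `|s|) (3 * B).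
pose K := (n.+1)%:R * expR (gronwall_rate (n := n) (n%:R * L) * (N + `|s|)).
exists K => [|t x x' ht hx hx']; first by rewrite mulr_ge0// expR_ge0.
have hder (r : R) : is_derive r 1 (fun r => flow x r - flow x' r)
    (f r (flow x r) - f r (flow x' r)).
  exact: (is_deriveB (flow_ode x r) (flow_ode x' r)).
have := @gronwall_vec R n _ _ (n%:R * L) 0 s (N + `|s|) _ _ hder _ t.
rewrite !flow_s addr0 /K mulrAC; apply => //; first by rewrite mulr_ge0.
- move=> r hr; have hr' : `|r| <= N + 2 * `|s|.
    have -> : r = (r - s) + s by rewrite subrK.
    by apply: (le_trans (ler_normD _ _)); lra.
  rewrite addr0; apply: field_lip => // y k l hy; apply: hL => //.
  have -> : y = (y - flow x' r) + flow x' r by rewrite subrK.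
  apply: (le_trans (ler_normD _ _)).
  have := ler_normB (flow x r) (flow x' r).
  by have := hB r x hr' hx; have := hB r x' hr' hx'; lra.
- by apply: (le_trans (ler_normB _ _)); rewrite lerD2r.
Qed.

Lemma continuous_flow t : continuous (fun x => flow x t).
Proof.
move=> x; have [C C0 hC] := flow_locally_lip `|t| (`|x| + 1).
apply: continuous_eps => e e0.
exists (Num.min 1 (e / (C + 1))) => /=.
  by rewrite lt_min ltr01 divr_gt0// ltr_wpDl.
move=> y; rewrite lt_min => /andP[h1 h2].
have hy : `|y| <= `|x| + 1.
  have -> : y = x - (x - y) by rewrite opprB addrC subrK.
  by apply: (le_trans (ler_normB _ _)); rewrite lerD2l ltW.
have hx : `|x| <= `|x| + 1 by rewrite lerDl.
apply: (le_trans (hC t x y (lexx _) hx hy)).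
have C1 : 0 < C + 1 by rewrite ltr_wpDl.
rewrite ltr_pdivlMr// in h2; apply: le_trans (ltW h2).
by rewrite mulrC ler_wpM2l// lerDl.
Qed.

Variables (e : V) (Y : V -> R -> V).
Hypothesis Y_s : forall x, Y x s = e.
Hypothesis Y_ode : forall x t, is_derive t 1 (Y x) (lin d t (flow x t) (Y x t)).

Lemma unif_near_d x (N eps : R) : 0 < eps -> exists2 del, 0 < del &
  forall k l t, `|t| <= N -> forall z, `|z| <= del ->
    `|d k l t (flow x t + z) - d k l t (flow x t)| <= eps.
Proof.
move=> eps0.
have cfl : continuous (flow x) by exact: is_derive_continuous (flow_ode x).
have /choice[del hdel] : forall i : 'I_n * 'I_n, exists del, 0 < del /\
    forall t, `|t| <= N -> forall z, `|z| <= del ->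
    `|d i.1 i.2 t (flow x t + z) - d i.1 i.2 t (flow x t)| <= eps.
  by move=> i; have [del d0 hdel] := unif_near N (@cd i.1 i.2) cfl eps0; exists del.
exists (\big[Num.min/1]_i del i).
  by apply: lt_bigmin => // i _; case: (hdel i).
move=> k l t ht z hz; apply: (hdel (k, l)).2 => //.
by apply: (le_trans hz); exact: bigmin_le_cond.
Qed.

(** The remainder [flow (x + h e) - flow x - h Y] vanishes at time [s] and solves the linearised
    equation up to an error. Uniform continuity of the Jacobian along the trajectory makes that
    error a small multiple of [|h|], and Gronwall transfers this to time [T]. *)
Lemma is_derive_flow x T : is_derive x e (fun x => flow x T) (Y x T).
Proof.
pose N := `|T| + 2 * `|s|; pose M := `|x| + `|e|.
have [C C0 hC] := flow_locally_lip N M.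
have [B B0 hB] := flow_bounded N M.
have [L L0 hL] := d_bounded N B.
pose G := (n.+1)%:R * expR (gronwall_rate (n := n) (n%:R * L) * (`|T| + `|s|)).
have G0 : 0 <= G by rewrite mulr_ge0// expR_ge0.
have key eps : 0 < eps -> \forall h \near (0 : R),
    `|flow (h *: e + x) T - flow x T - h *: Y x T| <= eps * `|h|.
  move=> eps0.
  (* Chosen so that the Gronwall bound comes out as [(D - 1) / D * (eps * |h|)]; the [+ 1] keeps it
     positive. *)
  pose D := n%:R * (C * `|e|) * G + 1.
  have D0 : 0 < D by rewrite ltr_wpDl// !mulr_ge0.
  have [del del0 hdel] := unif_near_d x N (divr_gt0 eps0 D0).
  apply/nbhs_norm0P; exists (Num.min 1 (del / (C * `|e| + 1))) => /=.
    by rewrite lt_min ltr01 divr_gt0// ltr_wpDl// mulr_ge0.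
  move=> h /=; rewrite lt_min => /andP[h1 h2].
  rewrite ltr_pdivlMr ?ltr_wpDl ?mulr_ge0// in h2.
  have xM : `|x| <= M by rewrite lerDl.
  have xhM : `|h *: e + x| <= M.
    apply: (le_trans (ler_normD _ _)); rewrite addrC lerD2l normrZ.
    by apply: ler_piMl => //; exact: ltW.
  pose z r := flow (h *: e + x) r - flow x r.
  have hz r : `|r| <= N -> `|z r| <= C * `|e| * `|h|.
    move=> hr; have := hC r _ _ hr xhM xM.
    by rewrite addrK normrZ mulrA mulrAC.
  have hzdel r : `|r| <= N -> `|z r| <= del.
    move=> hr; apply: (le_trans (hz r hr)).
    apply: le_trans (ltW h2); rewrite mulrC ler_wpM2l// lerDl//.
  have hder (r : R) : is_derive r 1 (fun r => z r - h *: Y x r)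
      ((f r (flow (h *: e + x) r) - f r (flow x r)) - h *: lin d r (flow x r) (Y x r)).
    exact: (is_deriveB (is_deriveB (flow_ode _ r) (flow_ode x r)) (is_deriveZ _ (Y_ode x r))).
  have ed : 0 <= eps / D by rewrite ltW// divr_gt0.
  have e1 : 0 <= n%:R * (eps / D) * (C * `|e| * `|h|).
    by apply: mulr_ge0; [exact: mulr_ge0 | rewrite !mulr_ge0].
  have := @gronwall_vec R n _ _ (n%:R * L) (n%:R * (eps / D) * (C * `|e| * `|h|))
    s (`|T| + `|s|) _ e1 hder _ T.
  rewrite /z !flow_s Y_s addrK subrr normr0 add0r => gr.
  apply: (le_trans (gr _ _ _)).
  - by rewrite mulr_ge0.
  - move=> r hr; have hr' : `|r| <= N.
      have -> : r = (r - s) + s by rewrite subrK.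
      by apply: (le_trans (ler_normD _ _)); rewrite /N; lra.
    have -> : f r (flow (h *: e + x) r) - f r (flow x r) - h *: lin d r (flow x r) (Y x r) =
       (f r (flow x r + z r) - f r (flow x r) - lin d r (flow x r) (z r)) +
       lin d r (flow x r) (z r - h *: Y x r).
      rewrite (linB _ _ _ (z r) (h *: Y x r)) linZ [flow x r + z r]addrC.
      by rewrite {1}/z subrK addrA subrK.
    apply: (le_trans (ler_normD _ _)); rewrite addrC; apply: lerD.
      by apply: lin_bound => // k l; apply: hL => //; exact: hB.
    apply: (@le_trans _ _ (n%:R * (eps / D) * `|z r|)).
      apply: field_MVT => // y k l hy.
      have -> : y = flow x r + (y - flow x r) by rewrite addrC subrK.
      by apply: hdel => //; exact: le_trans hy (hzdel r hr').
    by apply: ler_wpM2l; [rewrite mulr_ge0 | exact: hz].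
  - by apply: (le_trans (ler_normB _ _)).
  have -> : n.+1%:R * (n%:R * (eps / D) * (C * `|e| * `|h|)) *
      expR (gronwall_rate (n := n) (n%:R * L) * (`|T| + `|s|)) = (D - 1) / D * (eps * `|h|).
    have -> : D - 1 = n%:R * (C * `|e|) * G by rewrite /D addrK.
    by rewrite /G; field; rewrite gt_eqF.
  have D1 : (D - 1) / D <= 1 by rewrite ler_pdivrMr// mul1r gerBl.
  by apply: ler_piMl => //; apply: mulr_ge0 => //; exact: ltW.
have lim : (fun h : R => h^-1 *: (flow (h *: e + x) T - flow x T)) @ 0^' --> Y x T.
  apply/cvgrPdist_le => eps eps0.
  have /nbhs_norm0P[r /= r0 hr] := key eps eps0.
  apply/nbhs_normP; exists r => //= h; rewrite /ball_/= sub0r normrN => hhr hn0.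
  rewrite distrC; have := hr h hhr; rewrite /=.
  have -> : flow (h *: e + x) T - flow x T - h *: Y x T =
      h *: (h^-1 *: (flow (h *: e + x) T - flow x T) - Y x T).
    by rewrite scalerBr scalerA divff// scale1r.
  by rewrite normrZ mulrC ler_pM2r ?normr_gt0.
apply: DeriveDef; first by apply/cvg_ex; exists (Y x T).
exact: cvg_lim lim.
Qed.

(** The difference of two linearised solutions solves the equation linearised along one trajectory,
    with the change of Jacobian between the trajectories, applied to [Y x], as a source. *)
Lemma continuous_flow_deriv T : continuous (fun x => Y x T).
Proof.
move=> x; pose N := `|T| + 2 * `|s|; pose M := `|x| + 1.
have [C C0 hC] := flow_locally_lip N M.
have [B B0 hB] := flow_bounded N M.
have [L L0 hL] := d_bounded N B.
have [A' A'0 hA] := @continuous_bounded R _ (Y x) N (is_derive_continuous (Y_ode x)).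
pose G := (n.+1)%:R * expR (gronwall_rate (n := n) (n%:R * L) * (`|T| + `|s|)).
have G0 : 0 <= G by rewrite mulr_ge0// expR_ge0.
apply: continuous_eps => eps eps0.
pose D := n%:R * A' * G + 1.
have D0 : 0 < D by rewrite ltr_wpDl// !mulr_ge0.
have ed : 0 <= eps / D by rewrite ltW// divr_gt0.
have [del del0 hdel] := unif_near_d x N (divr_gt0 eps0 D0).
exists (Num.min 1 (del / (C + 1))) => /=.
  by rewrite lt_min ltr01 divr_gt0// ltr_wpDl.
move=> y; rewrite lt_min => /andP[h1 h2].
rewrite ltr_pdivlMr ?ltr_wpDl// in h2.
have xM : `|x| <= M by rewrite lerDl.
have yM : `|y| <= M.
  have -> : y = x - (x - y) by rewrite opprB addrC subrK.
  by apply: (le_trans (ler_normB _ _)); rewrite lerD2l ltW.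
have hder (r : R) : is_derive r 1 (fun r => Y y r - Y x r)
    (lin d r (flow y r) (Y y r) - lin d r (flow x r) (Y x r)).
  exact: (is_deriveB (Y_ode y r) (Y_ode x r)).
have e1 : 0 <= n%:R * (eps / D) * A' by apply: mulr_ge0 => //; exact: mulr_ge0.
have := @gronwall_vec R n _ _ (n%:R * L) (n%:R * (eps / D) * A')
    s (`|T| + `|s|) _ e1 hder _ T.
rewrite !Y_s subrr normr0 add0r => gr; rewrite distrC.
apply: (le_trans (gr _ _ _)).
- by rewrite mulr_ge0.
- move=> r hr; have hr' : `|r| <= N.
    have -> : r = (r - s) + s by rewrite subrK.
    by apply: (le_trans (ler_normD _ _)); rewrite /N; lra.
  (* The change of Jacobian is presented as a coefficient family that ignores its position, so that
     [lin_bound] applies to it. *)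
  pose dd k l t (_ : V) := d k l t (flow y t) - d k l t (flow x t).
  have -> : lin d r (flow y r) (Y y r) - lin d r (flow x r) (Y x r) =
      lin d r (flow y r) (Y y r - Y x r) + lin dd r x (Y x r).
    apply/rowP => l; rewrite !mxE -sumrB -big_split/=; apply: eq_bigr => k _.
    by rewrite !mxE /dd; ring.
  apply: (le_trans (ler_normD _ _)); apply: lerD.
    by apply: lin_bound => // k l; apply: hL => //; exact: hB.
  apply: (@le_trans _ _ (n%:R * (eps / D) * `|Y x r|)).
    apply: lin_bound => // k l; rewrite /dd.
    have -> : flow y r = flow x r + (flow y r - flow x r) by rewrite addrC subrK.
    apply: hdel => //; apply: (le_trans (hC r y x hr' yM xM)).
    apply: le_trans (ltW h2); rewrite distrC mulrC ler_wpM2l// lerDl//.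
  by apply: ler_wpM2l; [rewrite mulr_ge0 | exact: hA].
- by apply: (le_trans (ler_normB _ _)).
have -> : n.+1%:R * (n%:R * (eps / D) * A') *
    expR (gronwall_rate (n := n) (n%:R * L) * (`|T| + `|s|)) = (D - 1) / D * eps.
  have -> : D - 1 = n%:R * A' * G by rewrite /D addrK.
  by rewrite /G; field; rewrite gt_eqF.
have D1 : (D - 1) / D <= 1 by rewrite ler_pdivrMr// mul1r gerBl.
by apply: ler_piMl => //; exact: ltW.
Qed.

End Field.
End FlowC1.

(** * Linear equations, uniqueness and growth of solutions *)

Section LinearODE.
Context {R : realType} {n : nat}.
Notation V := 'rV[R]_n.

Lemma continuous_curve_bound (N : R) (g : 'I_n -> 'I_n -> R -> V -> R) (c : R -> V) :
  (forall k l, jcont (g k l)) -> continuous c -> exists2 L : R, 0 <= L &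
    forall k l t, `|t| <= N -> `|g k l t (c t)| <= L.
Proof.
move=> cg cc; have [B B0 hB] := continuous_bounded N cc.
have [L L0 hL] := @jbounded_fin R n ('I_n * 'I_n)%type (fun i => g i.1 i.2) N B
  (fun i => @cg i.1 i.2).
by exists L => // k l t ht; apply: (hL (k, l)) => //; exact: hB.
Qed.

(** Along a fixed curve the coefficients are bounded on bounded times, so the field is Lipschitz in
    [y] even when [d] is unbounded in space. *)
Lemma linear_ode (d : 'I_n -> 'I_n -> R -> V -> R) (c : R -> V) (s : R) (e : V) :
  (forall k l, jcont (d k l)) -> continuous c ->
  exists2 Y : R -> V, Y s = e & forall t : R, is_derive t 1 Y (lin d t (c t) (Y t)).
Proof.
move=> cd cc; apply: (@picard R n (fun t y => lin d t (c t) y)).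
  move=> p; apply/continuous_coordP => l.
  have -> : (fun t : R * V => lin d t.1 (c t.1) t.2 0 l) =
      (fun q => \sum_k q.2 0 k * d k l q.1 (c q.1)).
    by apply/funext => q; rewrite mxE.
  apply: continuous_sumr => k.
  apply: (@continuousM R _ (fun q : R * V => q.2 0 k) (fun q : R * V => d k l q.1 (c q.1))).
    apply: (@continuous_comp _ _ _ snd (fun v : V => v 0 k)); first exact: cvg_snd.
    exact: coord_continuous.
  apply: (@jcont_comp R n (R * V)%type R (d k l) fst (fun p => c p.1) p (@cd k l)).
    exact: cvg_fst.
  apply: (@continuous_comp _ _ _ fst c); first exact: cvg_fst.
  exact: cc.
move=> N; have [L L0 hL] := continuous_curve_bound N cd cc.
exists (n%:R * L); first by rewrite mulr_ge0.
move=> t ht x y; rewrite -linB; apply: lin_bound => // k l; exact: hL.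
Qed.

Lemma ode_unique (f : R -> V -> V) (y z : R -> V) (s : R) : lipx f -> y s = z s ->
  (forall t : R, is_derive t 1 y (f t (y t))) ->
  (forall t : R, is_derive t 1 z (f t (z t))) -> forall t, y t = z t.
Proof.
move=> lf yz hy hz t; have [L L0 hL] := lf (`|t| + 2 * `|s|).
have hder (r : R) : is_derive r 1 (fun r => y r - z r) (f r (y r) - f r (z r)).
  exact: (is_deriveB (hy r) (hz r)).
have := @gronwall_vec R n _ _ L 0 s (`|t| + `|s|) L0 (lexx _) hder _ t.
rewrite yz subrr normr0 addr0 mulr0 mul0r normr_le0 subr_eq0 => h.
apply/eqP; apply: h.
- move=> r hr; rewrite addr0; apply: hL.
  have -> : r = (r - s) + s by rewrite subrK.
  by apply: (le_trans (ler_normD _ _)); lra.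
- by apply: (le_trans (ler_normB _ _)).
Qed.

(** The inhomogeneity is the field at the origin, bounded on bounded times; hence one constant
    serves all solutions and all starting times in the range. *)
Lemma ode_growth (f : R -> V -> V) (N : R) : jcont f -> lipx f ->
  exists2 C : R, 0 <= C & forall (s : R) (y : R -> V), `|s| <= N ->
  (forall t : R, is_derive t 1 y (f t (y t))) ->
  forall t, `|t| <= N -> `|y t| <= C * (`|y s| + 1).
Proof.
move=> cf lf; have [L L0 hL] := lf (3 * N).
have [A A0 hA] := continuous_bounded (3 * N) (jcont_curve cf (@cst_continuous R V 0)).
exists ((n.+1)%:R * (1 + A) * expR (gronwall_rate (n := n) L * (2 * N))).
  by rewrite !mulr_ge0 ?addr_ge0// expR_ge0.
move=> s y hs hy t ht.
have := @gronwall_vec R n _ _ L A s (2 * N) L0 A0 hy _ t.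
move=> h; apply: le_trans (h _ _) _.
- move=> r hr; have hr' : `|r| <= 3 * N.
    have -> : r = (r - s) + s by rewrite subrK.
    by apply: (le_trans (ler_normD _ _)); lra.
  have -> : f r (y r) = (f r (y r) - f r 0) + f r 0 by rewrite subrK.
  apply: (le_trans (ler_normD _ _)); apply: lerD; last exact: hA.
  by have := hL r hr' (y r) 0; rewrite subr0.
- by apply: (le_trans (ler_normB _ _)); lra.
rewrite [leRHS]mulrAC ler_wpM2r ?expR_ge0// -mulrA ler_wpM2l//.
by have := mulr_ge0 A0 (normr_ge0 (y s)); nra.
Qed.

End LinearODE.

(** * Second derivatives of the flow *)

Section Augmented.
Context {R : realType} {n : nat}.
Notation V := 'rV[R]_n.
Notation W := 'rV[R]_(n + n).
Notation E := (@ebasis R n).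
Notation EW := (@ebasis R (n + n)).

Lemma is_derive_lsubmx (g : V -> R) (p u : W) dg :
  is_derive (lsubmx p) (lsubmx u) g dg -> is_derive p u (fun p => g (lsubmx p)) dg.
Proof.
move=> h; apply/(is_derive_line (W := R)).
have := (is_derive_line (W := R) _ _ _ _).1 h.
by apply: is_derive_ext => r; rewrite linearD linearZ.
Qed.

Lemma is_derive_coordinate m (p u : 'rV[R]_m) k : is_derive p u (fun p => p 0 k) (u 0 k).
Proof. by have := (is_derive_coord id p u u).1 (is_derive_id p u) k. Qed.

Lemma lsubmx_lE k : lsubmx (EW (lshift n k)) = E k.
Proof.
by apply/rowP => i; rewrite !mxE !eqxx /= (inj_eq (@lshift_inj _ _)).
Qed.

Lemma lsubmx_rE k : lsubmx (EW (rshift n k)) = 0.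
Proof. by apply/rowP => i; rewrite !mxE eq_lrshift andbF. Qed.

Lemma rsubmx_lE k : rsubmx (EW (lshift n k)) = 0.
Proof. by apply/rowP => i; rewrite !mxE eq_rlshift andbF. Qed.

Lemma lE_row_mx k : EW (lshift n k) = row_mx (E k) 0.
Proof. by rewrite -[LHS]hsubmxK lsubmx_lE rsubmx_lE. Qed.

Lemma norm_row_mx (x y : V) : `|row_mx x y| <= `|x| + `|y|.
Proof.
apply: norm_le_coord => [|i]; first by rewrite addr_ge0.
rewrite mxE; case: (fintype.split i) => j; apply: (le_trans (norm_coord _ _)).
  by rewrite lerDl.
by rewrite lerDr.
Qed.

Lemma norm_lsubmx (p : W) : `|lsubmx p| <= `|p|.
Proof. by apply: norm_le_coord => // i; rewrite mxE norm_coord. Qed.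

Lemma norm_rsubmx (p : W) : `|rsubmx p| <= `|p|.
Proof. by apply: norm_le_coord => // i; rewrite mxE norm_coord. Qed.

Lemma continuous_lsubmx : continuous (fun p : W => lsubmx p).
Proof.
move=> p; apply/continuous_coordP => i.
have -> : (fun t : W => lsubmx t 0 i) = (fun t => t 0 (lshift n i)).
  by apply/funext => t; rewrite mxE.
exact: coord_continuous.
Qed.

Lemma continuous_rsubmx : continuous (fun p : W => rsubmx p).
Proof.
move=> p; apply/continuous_coordP => i.
have -> : (fun t : W => rsubmx t 0 i) = (fun t => t 0 (rshift n i)).
  by apply/funext => t; rewrite mxE.
exact: coord_continuous.
Qed.

Lemma continuous_row_mx_l (y : V) : continuous (fun x : V => row_mx x y : W).
Proof.
move=> x; apply/continuous_coordP => i.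
have -> : (fun t : V => row_mx t y 0 i) =
    (fun t => match fintype.split i with inl k => t 0 k | inr k => y 0 k end).
  by apply/funext => t; rewrite mxE.
by case: (fintype.split i) => k; [exact: coord_continuous | exact: cst_continuous].
Qed.

Variables (v : R -> V -> V) (d : 'I_n -> 'I_n -> R -> V -> R).
Variable dd : 'I_n -> 'I_n -> 'I_n -> R -> V -> R.
Hypothesis hd : forall t y k l, is_derive y (E k) (fun y => v t y 0 l) (d k l t y).
Hypothesis hdd : forall t y j k l, is_derive y (E j) (d k l t) (dd j k l t y).
Hypothesis cv : jcont v.
Hypothesis cd : forall k l, jcont (d k l).
Hypothesis cdd : forall j k l, jcont (dd j k l).
Hypothesis bd : forall N : R, exists2 L : R, 0 <= L &
  forall k l t x, `|t| <= N -> `|d k l t x| <= L.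

(* The system (x, y)' = (v(x), Dv(x) y): its flow carries the first derivative
   of the flow of v in the second component. *)
Definition aug (t : R) (p : W) : W :=
  row_mx (v t (lsubmx p)) (lin d t (lsubmx p) (rsubmx p)).

(** The Jacobian of [aug] by blocks. Only the second component depends on [y], and linearly through
    the Jacobian of [v], whence the same diagonal blocks. *)
Definition daug (K L : 'I_(n + n)) (t : R) (p : W) : R :=
  match fintype.split K, fintype.split L with
  | inl k, inl l => d k l t (lsubmx p)
  | inr k, inl l => 0
  | inl j, inr l => \sum_k rsubmx p 0 k * dd j k l t (lsubmx p)
  | inr k, inr l => d k l t (lsubmx p)
  end.

Lemma is_derive_aug t p K L : is_derive p (EW K) (fun p => aug t p 0 L) (daug K L t p).
Proof.
rewrite /daug; have -> : (fun p => aug t p 0 L) =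
    (fun p => match fintype.split L with inl l => v t (lsubmx p) 0 l
      | inr l => \sum_k p 0 (rshift n k) * d k l t (lsubmx p) end).
  apply/funext => q; rewrite mxE; case: (fintype.split L) => l //.
  by rewrite mxE; apply: eq_bigr => k _; rewrite mxE.
case: (split_ordP K) => k ->; rewrite ?(unsplitK (inl _)) ?(unsplitK (inr _)).
  case: (fintype.split L) => l.
    by apply: (@is_derive_lsubmx (fun x => v t x 0 l)); rewrite lsubmx_lE.
  apply: is_der_sum => i.
  have h1 := is_derive_coordinate p (EW (lshift n k)) (rshift n i).
  have h2 : is_derive p (EW (lshift n k)) (fun p => d i l t (lsubmx p)) (dd k i l t (lsubmx p)).
    by apply: is_derive_lsubmx; rewrite lsubmx_lE.
  have := is_derM h1 h2; rewrite mxE eq_rlshift andbF mul0r add0r.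
  by rewrite mxE.
case: (fintype.split L) => l.
  apply: (@is_derive_lsubmx (fun x => v t x 0 l)); rewrite lsubmx_rE.
  exact: is_derive0.
rewrite [X in is_derive _ _ _ X](_ : _ =
    \sum_i (i == k)%:R * d i l t (lsubmx p)); last first.
  rewrite (bigD1 k)//= eqxx mul1r big1 ?addr0// => i /negbTE ->.
  by rewrite mul0r.
apply: is_der_sum => i.
have h1 := is_derive_coordinate p (EW (rshift n k)) (rshift n i).
have h2 : is_derive p (EW (rshift n k)) (fun p => d i l t (lsubmx p)) 0.
  by apply: is_derive_lsubmx; rewrite lsubmx_rE; exact: is_derive0.
have := is_derM h1 h2; rewrite mulr0 addr0 mxE eqxx /=.
by rewrite (inj_eq (@rshift_inj _ _)).
Qed.

Lemma jcont_lsubmx (g : R -> V -> R) : jcont g -> jcont (fun t (p : W) => g t (lsubmx p)).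
Proof.
move=> cg p; apply: (@jcont_comp R n (R * W)%type R g fst (fun q => lsubmx q.2) p cg).
  exact: cvg_fst.
apply: (@continuous_comp _ _ _ snd (fun q : W => lsubmx q)); first exact: cvg_snd.
exact: continuous_lsubmx.
Qed.

Lemma jcont_daug K L : jcont (daug K L).
Proof.
rewrite /daug; case: (fintype.split K) => k; case: (fintype.split L) => l.
- exact: jcont_lsubmx.
- move=> p; apply: continuous_sumr => i.
  apply: (@continuousM R _ (fun q : R * W => rsubmx q.2 0 i)
    (fun q : R * W => dd k i l q.1 (lsubmx q.2))).
    have -> : (fun q : R * W => rsubmx q.2 0 i) = (fun q : R * W => q.2 0 (rshift n i)).
      by apply/funext => q; rewrite mxE.
    apply: (@continuous_comp _ _ _ snd (fun v : W => v 0 (rshift n i))); first exact: cvg_snd.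
    exact: coord_continuous.
  exact: (jcont_lsubmx (@cdd k i l)).
- by move=> p; exact: cst_continuous.
- exact: jcont_lsubmx.
Qed.

Lemma lipx_v : lipx v.
Proof. exact: (bounded_d_lipx hd). Qed.

Lemma flow_exists : exists flow : R -> V -> R -> V,
  (forall s x, flow s x s = x) /\
  forall s x (t : R), is_derive t 1 (flow s x) (v t (flow s x t)).
Proof.
have /choice[fl hfl] : forall p : R * V, exists y : R -> V, y p.1 = p.2 /\
    forall t : R, is_derive t 1 y (v t (y t)).
  by move=> [s x]; have [y y1 y2] := picard s x cv lipx_v; exists y.
exists (fun s x => fl (s, x)); split=> s x; first by have [] := hfl (s, x).
by have [_] := hfl (s, x).
Qed.

Variable flow : R -> V -> R -> V.
Hypothesis flow_s : forall s x, flow s x s = x.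
Hypothesis flow_ode : forall s x (t : R), is_derive t 1 (flow s x) (v t (flow s x t)).

Lemma flow_group s x r t : flow r (flow s x r) t = flow s x t.
Proof.
by apply: (@ode_unique R n v _ _ r lipx_v); rewrite ?flow_s.
Qed.

Lemma flow_bounded s (N M : R) : exists2 B : R, 0 <= B &
  forall t x, `|t| <= N -> `|x| <= M -> `|flow s x t| <= B.
Proof.
have [C C0 hC] := ode_growth (Num.max `|s| N) cv lipx_v.
exists (C * (`|M| + 1)) => [|t x ht hx]; first by rewrite mulr_ge0// addr_ge0.
have := hC s (flow s x) _ (flow_ode s x) t; rewrite flow_s => h.
apply: (le_trans (h _ _)); rewrite ?le_max ?lexx ?ht ?orbT//.
rewrite ler_wpM2l// lerD2r; apply: (le_trans hx); exact: ler_norm.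
Qed.

Variable Y : V -> R -> V -> R -> V.
Hypothesis Y_s : forall e s x, Y e s x s = e.
Hypothesis Y_ode : forall e s x (t : R),
  is_derive t 1 (Y e s x) (lin d t (flow s x t) (Y e s x t)).

(** The global bound on the Jacobian makes the estimate uniform in the base point [x]. It bounds the
    augmented flow on bounded sets and, later, the gradients of transported functions on the whole
    space. *)
Lemma Y_growth (N : R) : exists2 C : R, 0 <= C & forall e s x t,
  `|s| <= N -> `|t| <= N -> `|Y e s x t| <= C * `|e|.
Proof.
have [L L0 hL] := bd (3 * N).
exists ((n.+1)%:R * expR (gronwall_rate (n := n) (n%:R * L) * (2 * N))).
  by rewrite mulr_ge0// expR_ge0.
move=> e s x t hs ht.
have nL : 0 <= n%:R * L by rewrite mulr_ge0.
have := @gronwall_vec R n _ _ (n%:R * L) 0 s (2 * N) nL (lexx _) (Y_ode e s x) _ t.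
rewrite Y_s addr0 mulrAC; apply.
- move=> r hr; rewrite addr0; apply: lin_bound => // k l; apply: hL.
  have -> : r = (r - s) + s by rewrite subrK.
  by apply: (le_trans (ler_normD _ _)); lra.
- by apply: (le_trans (ler_normB _ _)); lra.
Qed.

Lemma is_derive_flow1 e s x T : is_derive x e (fun x => flow s x T) (Y e s x T).
Proof.
apply: (@is_derive_flow R n v d hd cd s (flow s)) => //.
exact: flow_bounded.
Qed.

Lemma continuous_flow1 e s T : continuous (fun x => Y e s x T).
Proof.
apply: (@continuous_flow_deriv R n v d hd cd s (flow s)) => //.
exact: flow_bounded.
Qed.

Lemma continuous_flow0 s T : continuous (fun x => flow s x T).
Proof.
apply: (@continuous_flow R n v d hd cd s (flow s)) => //.
exact: flow_bounded.
Qed.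

Definition aug_flow (s : R) (p : W) (t : R) : W :=
  row_mx (flow s (lsubmx p) t) (Y (rsubmx p) s (lsubmx p) t).

Lemma aug_flow_s s p : aug_flow s p s = p.
Proof. by rewrite /aug_flow flow_s Y_s hsubmxK. Qed.

Lemma aug_flow_ode s p (t : R) : is_derive t 1 (aug_flow s p) (aug t (aug_flow s p t)).
Proof.
apply/is_derive_coord => i; rewrite /aug /aug_flow !row_mxKl !row_mxKr.
case: (split_ordP i) => k ->.
  have := (is_derive_coord _ _ _ _).1 (flow_ode s (lsubmx p) t) k.
  rewrite [X in _ -> is_derive _ _ _ X](_ : _ = v t (flow s (lsubmx p) t) 0 k); last first.
    by rewrite row_mxEl.
  by apply: is_derive_ext => r; rewrite row_mxEl.
have := (is_derive_coord _ _ _ _).1 (Y_ode (rsubmx p) s (lsubmx p) t) k.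
rewrite [X in _ -> is_derive _ _ _ X](_ : _ =
  lin d t (flow s (lsubmx p) t) (Y (rsubmx p) s (lsubmx p) t) 0 k); last by rewrite row_mxEr.
by apply: is_derive_ext => r; rewrite row_mxEr.
Qed.

Lemma aug_flow_bounded s (N M : R) : exists2 B : R, 0 <= B &
  forall t p, `|t| <= N -> `|p| <= M -> `|aug_flow s p t| <= B.
Proof.
have [B B0 hB] := flow_bounded s N M.
have [C C0 hC] := Y_growth (Num.max `|s| N).
exists (B + C * `|M|) => [|t p ht hp]; first by rewrite addr_ge0// mulr_ge0.
apply: (le_trans (norm_row_mx _ _)); apply: lerD.
  by apply: hB => //; exact: le_trans (norm_lsubmx p) hp.
apply: (le_trans (hC _ _ _ _ _ _)); rewrite ?le_max ?lexx ?ht ?orbT//.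
rewrite ler_wpM2l//; apply: (le_trans (norm_rsubmx p)).
by apply: (le_trans hp); exact: ler_norm.
Qed.

(** [Y (E k) s x T] is the second half of the augmented flow started at [(x, E k)], so the
    first-order theory applied to [aug] differentiates it once more. *)
Lemma flow_C2 k j s T : exists2 Z : V -> V,
  (forall x, is_derive x (E j) (fun x => Y (E k) s x T) (Z x)) & continuous Z.
Proof.
have cflow p : continuous (aug_flow s p) by exact: is_derive_continuous (aug_flow_ode s p).
(* Varying [x] alone means moving the starting point in the direction [(E j, 0)]. *)
have /choice[Z hZ] : forall p, exists Z : R -> W, Z s = EW (lshift n j) /\
    forall t : R, is_derive t 1 Z (lin daug t (aug_flow s p t) (Z t)).
  by move=> p; have [Z z1 z2] :=
    linear_ode s (EW (lshift n j)) jcont_daug (@cflow p); exists Z.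
have zs p : Z p s = EW (lshift n j) by case: (hZ p).
have zo p : forall t : R, is_derive t 1 (Z p) (lin daug t (aug_flow s p t) (Z p t)).
  by case: (hZ p).
have h1 := @is_derive_flow R (n + n)%N aug daug is_derive_aug jcont_daug s (aug_flow s)
  (aug_flow_s s) (aug_flow_ode s) (aug_flow_bounded s) _ Z zs zo ^~ T.
have h2 := @continuous_flow_deriv R (n + n)%N aug daug is_derive_aug jcont_daug s (aug_flow s)
  (aug_flow_s s) (aug_flow_ode s) (aug_flow_bounded s) _ Z zs zo T.
exists (fun x => rsubmx (Z (row_mx x (E k)) T)) => x.
  apply/is_derive_coord => i.
  have := (is_derive_coord _ _ _ _).1 (h1 (row_mx x (E k))) (rshift n i).
  rewrite [in X in _ -> X]mxE => /(is_derive_line (W := R)) h3.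
  apply/(is_derive_line (W := R)); apply: is_derive_ext h3 => r.
  rewrite /aug_flow lE_row_mx scale_row_mx add_row_mx row_mxKl row_mxKr row_mxEr.
  by rewrite scaler0 add0r.
apply: (@continuous_comp _ _ _ (fun x => Z (row_mx x (E k)) T) (fun p : W => rsubmx p)).
  apply: (@continuous_comp _ _ _ (fun x => row_mx x (E k) : W) (fun p => Z p T)).
    exact: continuous_row_mx_l.
  exact: h2.
exact: continuous_rsubmx.
Qed.

End Augmented.

(** * Borel sets and Lebesgue measure on row vectors *)

Section BorelRV.
Context {R : realType} {n : nat}.
Notation V := 'rV[R]_n.
Notation VB := (g_sigma_algebraType (@open V)).

Lemma measurable_open (U : set V) : open U -> measurable (U : set VB).
Proof. by move=> oU; apply: sub_sigma_algebra. Qed.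

Lemma continuous_measurable_rV (g : V -> R) : continuous g ->
  measurable_fun [set: VB] g.
Proof.
move=> /continuousP cg; apply: (measurability _ (measurable_realfun.RGenOInfty.measurableE R)).
move=> _ [_ [a ->]] <-; rewrite setTI; apply: measurable_open; apply: cg.
exact: interval_open.
Qed.

Lemma measurable_coord i : measurable_fun [set: VB] (fun x : V => x 0 i).
Proof. by apply: continuous_measurable_rV; exact: coord_continuous. Qed.

Definition cbox (a b : V) : set V := [set x | forall i, a 0 i <= x 0 i <= b 0 i].

Definition ratV (a : 'rV[rat]_n) : V := \row_i ratr (a 0 i).

(** Rational corners make the union countable; statements on Borel sets thereby reduce to boxes, and
    measurability into row vectors to measurability of the coordinates. *)
Lemma open_bigcup_cbox (U : set V) : open U ->
  U = \bigcup_(p in [set p : 'rV[rat]_n * 'rV[rat]_n |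
         cbox (ratV p.1) (ratV p.2) `<=` U]) cbox (ratV p.1) (ratV p.2).
Proof.
move=> oU; apply/seteqP; split; last by move=> x [p /= pU]; exact: pU.
move=> x Ux; have /nbhs_normP[e /= e0 he] : nbhs x U by exact: open_nbhs_nbhs.
have /choice[a ha] : forall i, exists q : rat, x 0 i - e / 2 < ratr q < x 0 i.
  move=> i; have /rat_in_itvoo[q] : x 0 i - e / 2 < x 0 i by rewrite gtrBl divr_gt0.
  by rewrite in_itv/= => h; exists q.
have /choice[b hb] : forall i, exists q : rat, x 0 i < ratr q < x 0 i + e / 2.
  move=> i; have /rat_in_itvoo[q] : x 0 i < x 0 i + e / 2 by rewrite ltrDl divr_gt0.
  by rewrite in_itv/= => h; exists q.
exists (\row_i a i, \row_i b i) => /=.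
  move=> y hy; apply: he; rewrite /ball_/=.
  apply: (@le_lt_trans _ _ (e / 2)); last by rewrite ltr_pdivrMr// ltr_pMr// ltr1n.
  apply: norm_le_coord => [|i]; first by rewrite divr_ge0// ltW.
  have := hy i; rewrite !mxE ler_norml => /andP[h1 h2].
  by have /andP[h3 h4] := ha i; have /andP[h5 h6] := hb i; lra.
move=> i; rewrite !mxE.
by have /andP[h3 h4] := ha i; have /andP[h5 h6] := hb i; rewrite !ltW.
Qed.

Lemma cbox_bigcap (a b : V) :
  cbox a b = \bigcap_(i in [set: 'I_n]) [set x | a 0 i <= x 0 i <= b 0 i].
Proof.
by apply/seteqP; split => x h i; [move=> _; exact: h | exact: h].
Qed.

Lemma measurable_cbox (a b : V) : measurable (cbox a b : set VB).
Proof.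
rewrite cbox_bigcap; apply: fin_bigcap_measurable => // i _.
have := @measurable_coord i measurableT `[a 0 i, b 0 i]%classic.
rewrite setTI => /(_ (measurable_itv _)).
by congr measurable; apply/seteqP; split => x; rewrite /= in_itv.
Qed.

Lemma measurable_rV {d'} {T : measurableType d'} (f : T -> V) :
  (forall i, measurable_fun setT (fun w => f w 0 i)) ->
  measurable_fun setT (f : T -> VB).
Proof.
move=> mf; apply: (@measurability _ _ T VB setT f (@open V)) => //.
move=> _ [U oU <-]; rewrite setTI (open_bigcup_cbox oU) preimage_bigcup.
rewrite bigcup_mkcond; apply: countable_bigcupT_measurable; first exact: countableP.
move=> p; case: ifP => _; last exact: measurable0.
rewrite cbox_bigcap preimage_bigcap.
apply: fin_bigcap_measurable => // i _.
have := @mf i measurableT `[ratV p.1 0 i, ratV p.2 0 i]%classic (measurable_itv _).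
rewrite setTI.
by congr measurable; apply/seteqP; split => x; rewrite /= in_itv.
Qed.

Lemma continuous_measurable_rVV m (g : 'rV[R]_m -> V) : continuous g ->
  measurable_fun [set: g_sigma_algebraType (@open 'rV[R]_m)] (g : _ -> VB).
Proof.
move=> /continuousP cg; apply: (@measurability _ _ (g_sigma_algebraType (@open 'rV[R]_m)) VB setT g (@open V)) => //.
move=> _ [U oU <-]; rewrite setTI; apply: sub_sigma_algebra; exact: cg.
Qed.

End BorelRV.

(** * Recognising a functional as an integral *)

Section IntegralFunctional.
Context d {T : measurableType d} {R : realType}.
Local Open Scope ereal_scope.
Implicit Types f g : T -> \bar R.

(** The nonnegative measurable functions, on which extended integrals are defined and additive
    without integrability conditions. *)
Definition nnm f := measurable_fun [set: T] f /\ forall x, 0 <= f x.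

Lemma nnm_sum (I : Type) (s : seq I) (F : I -> T -> \bar R) :
  (forall i, nnm (F i)) -> nnm (fun x => \sum_(i <- s) F i x).
Proof.
move=> h; split; first by apply: emeasurable_sum => i; case: (h i).
by move=> x; apply: sume_ge0 => i _; case: (h i).
Qed.

Lemma nnm_indic (A : set T) : measurable A -> nnm (fun x => (\1_A x)%:E).
Proof.
move=> mA; split; last by move=> x; rewrite lee_fin.
exact/measurable_EFinP/measurable_indic.
Qed.

Lemma nnm_scale (r : R) f : (0 <= r)%R -> nnm f -> nnm (fun x => r%:E * f x).
Proof.
move=> r0 [mf f0]; split; first exact: measurable_funeM.
by move=> x; rewrite mule_ge0.
Qed.

Lemma nnm_EFin (f : T -> R) : measurable_fun setT f -> (forall x, (0 <= f x)%R) ->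
  nnm (fun x => (f x)%:E).
Proof. by move=> mf f0; split; [exact/measurable_EFinP | move=> x; rewrite lee_fin]. Qed.

Import HBNNSimple.

(** Homogeneity and additivity extend the agreement from indicators to simple functions, and
    monotone limits extend it to the rest. It serves for the iterated Lebesgue integral and for
    integration against a density. *)
Lemma integral_functional (mu : {measure set T -> \bar R}) (I : (T -> \bar R) -> \bar R) :
  (forall A, measurable A -> I (fun x => (\1_A x)%:E) = mu A) ->
  (forall (r : R) f, (0 <= r)%R -> nnm f -> I (fun x => r%:E * f x) = r%:E * I f) ->
  (forall f g, nnm f -> nnm g -> I (fun x => f x + g x) = I f + I g) ->
  (forall (g : nat -> T -> \bar R) f, (forall k, nnm (g k)) -> nnm f ->
     (forall x, nondecreasing_seq (fun k => g k x)) ->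
     (forall x, g k x @[k --> \oo] --> f x) -> I (g k) @[k --> \oo] --> I f) ->
  forall f, nnm f -> \int[mu]_x f x = I f.
Proof.
move=> Ii Is Ia Il f nf; have [mf f0] := nf.
have I0 : I (fun=> 0) = 0.
  transitivity (I (fun x => (\1_set0 x)%:E)); last by rewrite Ii// measure0.
  by congr I; apply/funext => x; rewrite indicE in_set0.
have Isum (K : Type) (s : seq K) (F : K -> T -> \bar R) : (forall i, nnm (F i)) ->
    I (fun x => \sum_(i <- s) F i x) = \sum_(i <- s) I (F i).
  move=> hF; elim: s => [|i s ih].
    by rewrite big_nil -[RHS]I0; congr I; apply/funext => x; rewrite big_nil.
  rewrite big_cons -ih -Ia//; last exact: nnm_sum.
  by congr I; apply/funext => x; rewrite big_cons.
pose g := nnsfun_approx measurableT mf.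
have ng k : nnm (fun x => (g k x)%:E).
  by apply: nnm_EFin => //; exact: measurable_funP.
have nd x : nondecreasing_seq (fun k => (g k x)%:E).
  by move=> a b ab; rewrite lee_fin; exact/lefP/nd_nnsfun_approx.
have cg x : (g k x)%:E @[k --> \oo] --> f x by exact: cvg_nnsfun_approx.
have Ig k : I (fun x => (g k x)%:E) = \int[mu]_x (g k x)%:E.
  pose r := range (g k).
  have fr : finite_set r by [].
  have np (y : R) : nnm (fun x => (y * \1_(g k @^-1` [set y]) x)%:E).
    split; last by move=> x; exact: nnfun_muleindic_ge0.
    exact/measurable_EFinP/measurable_funM.
  have Ey (y : R) : y \in r ->
      I (fun x => (y * \1_(g k @^-1` [set y]) x)%:E) = \int[mu]_x (y * \1_(g k @^-1` [set y]) x)%:E.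
    rewrite inE => -[x _ hx].
    have y0 : (0 <= y)%R by rewrite -hx.
    have nI : nnm (fun x => (\1_(g k @^-1` [set y]) x)%:E) by exact: nnm_indic.
    under eq_integral do rewrite EFinM.
    rewrite ge0_integralZl_EFin//; try by case: nI.
    by rewrite integral_indic// setIT -Ii// -Is.
  have -> : (fun x => (g k x)%:E) =
      (fun x => \sum_(y \in r) (y * \1_(g k @^-1` [set y]) x)%:E).
    by apply/funext => x; rewrite [in LHS]fimfunE -fsumEFin.
  have -> : (fun x => \sum_(y \in r) (y * \1_(g k @^-1` [set y]) x)%:E) =
      (fun x => \sum_(y <- finmap.enum_fset (fset_set r)) (y * \1_(g k @^-1` [set y]) x)%:E).
    by apply/funext => x; rewrite fsbig_finite.
  rewrite Isum// ge0_integral_sum//; try by move=> y; case: (np y).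
  by rewrite -!fsbig_finite//; apply: eq_fsbigr => y; exact: Ey.
have h1 : \int[mu]_x (g k x)%:E @[k --> \oo] --> \int[mu]_x f x.
  have -> : \int[mu]_x f x = \int[mu]_x limn (fun k => (g k x)%:E).
    by apply: eq_integral => x _; apply/esym/cvg_lim.
  apply: cvg_monotone_convergence => [//|k|k x _|x _]; [by case: (ng k).. |exact: nd].
have h2 := Il _ _ ng nf nd cg.
have h3 : (fun k => I (fun x => (g k x)%:E)) = (fun k => \int[mu]_x (g k x)%:E).
  by apply/funext => k; exact: Ig.
rewrite /= h3 in h2.
exact: cvg_unique h1 h2.
Qed.

End IntegralFunctional.

(** * Lebesgue measure from the iterated integral *)

Section LebesgueRV.
Context {R : realType} {n : nat}.
Notation V := 'rV[R]_n.
Notation VB := (g_sigma_algebraType (@open V)).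
Local Open Scope ereal_scope.
Implicit Types (f g : VB -> \bar R) (s : seq 'I_n).

(** Names the substitution inside [iint], so that [iint_cons] holds by conversion. *)
Definition setc (i : 'I_n) (y : R) (x : V) : V :=
  \row_j (if j == i then y else x ord0 j)%R.

Lemma measurable_setc i : measurable_fun [set: VB * R] (fun p => setc i p.2 p.1 : VB).
Proof.
apply: measurable_rV => j; rewrite /setc.
under eq_fun do rewrite mxE.
case: eqP => _; first exact: measurable_snd.
by apply: (measurableT_comp (measurable_coord j)); exact: measurable_fst.
Qed.

Lemma iint_cons i s f x : iint (i :: s) f x =
  \int[lebesgue_measure]_y iint s f (setc i y x).
Proof. by []. Qed.

Lemma nnm_setc i f x : nnm f -> nnm (fun y : R => f (setc i y x)).
Proof.
move=> [mf f0]; split => //; apply: (measurableT_comp mf).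
have -> : (fun y : R => setc i y x : VB) = (fun p : VB * R => setc i p.2 p.1) \o pair x by [].
exact: measurableT_comp (measurable_setc i) (measurable_pair1 _).
Qed.

(** Measurability of a partial integral is Tonelli on the product of the space with the line,
    through the joint measurability of [setc]. *)
Lemma nnm_iint s f : nnm f -> nnm (iint s f : VB -> \bar R).
Proof.
elim: s => // i s ih /ih[mf f0]; split; last first.
  by move=> x; rewrite iint_cons; apply: integral_ge0.
have mf' : measurable_fun setT (fun p : VB * R => iint s f (setc i p.2 p.1)).
  exact: measurableT_comp mf (measurable_setc i).
exact: (@measurable_fun_fubini_tonelli_F _ _ VB (measurableTypeR R) R lebesgue_measure _ mf' (fun p => f0 _)).
Qed.

Lemma iintZ s (r : R) f x : (0 <= r)%R -> nnm f ->
  iint s (fun x => r%:E * f x) x = r%:E * iint s f x.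
Proof.
move=> r0 nf; elim: s x => // i s ih x; rewrite !iint_cons.
under eq_integral do rewrite ih.
have [m1 m2] := nnm_setc i x (nnm_iint s nf).
by rewrite ge0_integralZl_EFin.
Qed.

Lemma iintD s f g x : nnm f -> nnm g ->
  iint s (fun x => f x + g x) x = iint s f x + iint s g x.
Proof.
move=> nf ng; elim: s x => // i s ih x; rewrite !iint_cons.
under eq_integral do rewrite ih.
have [m1 m2] := nnm_setc i x (nnm_iint s nf).
have [m3 m4] := nnm_setc i x (nnm_iint s ng).
by rewrite ge0_integralD.
Qed.

Lemma le_iint s f g x : nnm f -> nnm g -> (forall x, f x <= g x) ->
  iint s f x <= iint s g x.
Proof.
move=> nf ng fg; elim: s x => // i s ih x; rewrite !iint_cons.
have [m1 m2] := nnm_setc i x (nnm_iint s nf).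
have [m3 m4] := nnm_setc i x (nnm_iint s ng).
by apply: ge0_le_integral => //.
Qed.

Lemma iint_cvg s (g : nat -> VB -> \bar R) f x : (forall k, nnm (g k)) -> nnm f ->
  (forall x, nondecreasing_seq (fun k => g k x)) ->
  (forall x, g k x @[k --> \oo] --> f x) ->
  iint s (g k) x @[k --> \oo] --> iint s f x.
Proof.
move=> ng nf nd cg; elim: s x => [|i s ih] x; first exact: cg.
have -> : iint (i :: s) f x =
    \int[lebesgue_measure]_y limn (fun k => iint s (g k) (setc i y x)).
  by rewrite iint_cons; apply: eq_integral => y _; apply/esym/cvg_lim.
apply: cvg_monotone_convergence => [//|k|k y _|y _ a b ab].
- by case: (nnm_setc i x (nnm_iint s (ng k))).
- by case: (nnm_iint s (ng k)).
- by apply: le_iint => // z; exact: nd.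
Qed.

(** Lebesgue measure, read off the iterated integral in which [has_density] is phrased, so that
    densities and measure theory speak of the same integral. *)
Definition lebV (A : set VB) : \bar R := intRd (fun x => (\1_A x)%:E).

Let lebV0 : lebV set0 = 0.
Proof.
have := @iintZ (enum 'I_n) 0%R (fun x : VB => (\1_(set0 : set VB) x)%:E) 0%R
  (lexx _) (nnm_indic measurable0).
rewrite mul0e => h; transitivity (iint (enum 'I_n)
  (fun x : VB => 0%R%:E * (\1_(set0 : set VB) x)%:E) 0%R); last exact: h.
by congr (iint _ _ _); apply: funext => x; rewrite mul0e indicE in_set0.
Qed.

Let lebV_ge0 A : 0 <= lebV A.
Proof.
rewrite /lebV /intRd; elim: (enum _) (0%R : V) => [|i s ih] x /=.
  by rewrite lee_fin.
by apply: integral_ge0.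
Qed.

Let lebV_sigma : semi_sigma_additive lebV.
Proof.
move=> F mF tF mUF.
have E k : (\sum_(0 <= i < k) lebV (F i)) =
    intRd (fun x => \sum_(0 <= i < k) (\1_(F i) x)%:E).
  elim: k => [|k ih].
    transitivity (lebV set0); first by rewrite big_geq// lebV0.
    rewrite /lebV; congr intRd; apply/funext => x.
    by rewrite big_geq// indicE in_set0.
  rewrite big_nat_recr//= ih /lebV /intRd -iintD; first last.
  - exact: nnm_indic.
  - by apply: nnm_sum => i; exact: nnm_indic.
  by congr (iint _ _ _); apply/funext => x; rewrite big_nat_recr.
under eq_fun do rewrite E.
apply: iint_cvg.
- by move=> k; apply: nnm_sum => i; exact: nnm_indic.
- exact: nnm_indic.
- by move=> x; apply: ereal_nondecreasing_series => i _ _; rewrite lee_fin.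
- move=> x.
  have [[k _ Fkx]|nF] := pselect ((\bigcup_k F k) x).
    have -> : (\1_(\bigcup_k F k) x)%:E = 1 :> \bar R.
      by rewrite indicE mem_set//; exists k.
    apply: cvg_near_cst; exists k.+1 => // m /= km.
    rewrite big_mkord (bigD1 (Ordinal km))//= indicE mem_set// big1 ?adde0// => i ik.
    rewrite indicE memNset// => Fix; case/negP: ik; apply/eqP/val_inj => /=.
    by apply: (tF i k Logic.I Logic.I); exists x.
  rewrite [X in _ --> X](_ : _ = 0); last by rewrite indicE memNset.
  apply: cvg_near_cst; apply: nearW => m; rewrite big1// => i _.
  by rewrite indicE memNset// => Fix; apply: nF; exists i.
Qed.

HB.instance Definition _ := isMeasure.Build _ _ _ lebV lebV0 lebV_ge0 lebV_sigma.

Lemma integral_lebV f : nnm f -> \int[lebV]_x f x = intRd f.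
Proof.
apply: integral_functional => //.
- by move=> r g r0 ng; exact: iintZ.
- by move=> g h ng nh; exact: iintD.
- by move=> g h ng nh nd cg; exact: iint_cvg.
Qed.

End LebesgueRV.

(** * Translations, boxes, Gaussians and shears *)

Section LebesgueRVTheory.
Context {R : realType} {n : nat}.
Notation V := 'rV[R]_n.
Notation VB := (g_sigma_algebraType (@open V)).
Local Open Scope ereal_scope.
Implicit Types (f g : VB -> \bar R) (s : seq 'I_n).

Lemma measurable_addr_const (c : R) : @measurable_fun _ _ (measurableTypeR R)
  (measurableTypeR R) setT (fun y : R => (y + c)%R).
Proof.
have h : measurable_fun [set: R] (fun y : R => (y + c)%R) by exact: measurable_funD.
exact: h.
Qed.

Lemma lebesgue_measure_shift (c : R) (A : set (measurableTypeR R)) : measurable A ->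
  pushforward lebesgue_measure (fun y : R => (y + c)%R : measurableTypeR R) A
  = lebesgue_measure A.
Proof.
pose mphi := @isMeasurableFun.Build _ _ (measurableTypeR R) (measurableTypeR R) _
  (measurable_addr_const c).
pose phi : {mfun measurableTypeR R >-> measurableTypeR R} := HB.pack (fun y : R => (y + c)%R) mphi.
move=> mA; apply/esym; rewrite -[fun y : R => _]/(phi : _ -> _).
apply: (@lebesgue_measure_unique R (pushforward lebesgue_measure phi)) mA.
move=> _ [[a b]] _ <-; rewrite /pushforward.
rewrite [X in _ = lebesgue_measure X](_ : _ = `](a - c)%R, (b - c)%R]%classic); last first.
  by apply/seteqP; split => y /=; rewrite !in_itv/= ltrBlDr lerBrDr.
rewrite /= !lebesgue_measure_itv/= !lte_fin ltrD2r.
by case: ifP => // _; rewrite -!EFinD; congr EFin; ring.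
Qed.

Lemma integral_shift1 (c : R) (f : R -> \bar R) : nnm f ->
  \int[lebesgue_measure]_y f (y + c)%R = \int[lebesgue_measure]_y f y.
Proof.
move=> [mf f0].
have := @ge0_integral_pushforward _ _ (measurableTypeR R) (measurableTypeR R) R
  (fun y : R => (y + c)%R) (measurable_addr_const c) lebesgue_measure setT f
  measurableT mf (fun y _ => f0 y).
rewrite preimage_setT => <-.
apply: eq_measure_integral; first exact: measurable_addr_const.
by move=> mc A mA _; exact: lebesgue_measure_shift.
Qed.

Lemma iint_shift s f (a x : V) : nnm f ->
  iint s (fun x => f (x + a)%R) x = iint s f (x + a)%R.
Proof.
move=> nf; elim: s x => // i s ih x; rewrite !iint_cons.
under eq_integral do rewrite ih.
rewrite -(integral_shift1 (a 0%R i) (nnm_setc i (x + a)%R (nnm_iint s nf))).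
apply: eq_integral => y _; congr (iint _ _ _); apply/rowP => j; rewrite !mxE.
by case: eqP => [->|].
Qed.

(** Integrating over every coordinate erases the base point, so the translation that [iint_shift]
    leaves in it disappears. *)
Lemma iint_eq_outside s f (x x' : V) : (forall j, j \notin s -> x 0%R j = x' 0%R j) ->
  iint s f x = iint s f x'.
Proof.
elim: s x x' => [|i s ih] x x' h.
  by congr f; apply/rowP => j; exact: h.
rewrite !iint_cons; apply: eq_integral => y _; apply: ih => j js; rewrite !mxE.
case: eqP => // /eqP ji; apply: h.
by rewrite in_cons negb_or ji.
Qed.

Lemma nnm_shift f (a : V) : nnm f -> nnm (fun x : VB => f (x + a)%R : \bar R).
Proof.
move=> [mf f0]; split => //; apply: (measurableT_comp mf).
apply: measurable_rV => i.
have -> : (fun w : VB => (w + a)%R 0%R i) = (fun w : VB => (w 0 i + a 0 i)%R).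
  by apply: funext => w; rewrite mxE.
by apply: measurable_funD => //; exact: measurable_coord.
Qed.

Lemma integral_lebV_shift f (a : V) : nnm f ->
  \int[@lebV R n]_x f (x + a)%R = \int[@lebV R n]_x f x.
Proof.
move=> nf; rewrite (integral_lebV (nnm_shift a nf)) (integral_lebV nf).
rewrite /intRd iint_shift//; apply: iint_eq_outside => j.
by rewrite mem_enum.
Qed.

Lemma measurable_prod_coord (g : 'I_n -> R -> R) :
  (forall i, measurable_fun [set: R] (g i)) ->
  measurable_fun [set: VB] (fun x : V => \prod_i g i (x 0 i))%R.
Proof.
move=> mg; apply: measurable_prod => i _.
exact: (measurableT_comp (mg i) (measurable_coord i)).
Qed.

Lemma iint_prod (g : 'I_n -> R -> R) (I : 'I_n -> R) s (x : V) :
  (forall i, measurable_fun [set: R] (g i)) -> (forall i y, 0 <= g i y)%R ->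
  (forall i, \int[lebesgue_measure]_y (g i y)%:E = (I i)%:E) -> uniq s ->
  iint s (fun x => (\prod_i g i (x 0 i))%:E)%R x =
  ((\prod_(i <- s) I i) * \prod_(i | i \notin s) g i (x 0 i))%:E%R.
Proof.
move=> mg g0 gI; elim: s x => [|i s ih] x.
  by move=> _; rewrite big_nil mul1r.
rewrite cons_uniq => /andP[is_ us]; rewrite iint_cons.
under eq_integral do rewrite ih//.
have I0 j : (0 <= I j)%R.
  by rewrite -lee_fin -gI; apply: integral_ge0 => y _; rewrite lee_fin.
pose c := ((\prod_(j <- s) I j) * \prod_(j | j \notin i :: s) g j (x 0 j))%R.
have c0 : (0 <= c)%R by rewrite mulr_ge0// prodr_ge0.
transitivity (\int[lebesgue_measure]_y (c%:E * (g i y)%:E)).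
  apply: eq_integral => y _; rewrite -EFinM; congr EFin.
  rewrite (bigD1 i)//= mxE eqxx /c -mulrA; congr (_ * _)%R; rewrite mulrC; congr (_ * _)%R.
  apply: eq_big => [j|j].
    by rewrite in_cons negb_or andbC.
  by rewrite mxE => /andP[_ /negbTE ->].
rewrite ge0_integralZl_EFin//.
- by rewrite gI -EFinM; congr EFin; rewrite /c big_cons; ring.
- by move=> y _; rewrite lee_fin.
- by apply/measurable_EFinP; exact: mg.
Qed.

Lemma integral_lebV_prod (g : 'I_n -> R -> R) (I : 'I_n -> R) :
  (forall i, measurable_fun [set: R] (g i)) -> (forall i y, 0 <= g i y)%R ->
  (forall i, \int[lebesgue_measure]_y (g i y)%:E = (I i)%:E) ->
  \int[@lebV R n]_x (\prod_i g i (x 0 i))%:E%R = (\prod_i I i)%:E%R.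
Proof.
move=> mg g0 gI; rewrite integral_lebV; last first.
  by apply: nnm_EFin; [exact: measurable_prod_coord | move=> x; exact: prodr_ge0].
rewrite /intRd (@iint_prod g I)// ?enum_uniq//; congr EFin.
rewrite big_enum/= [X in (_ * X)%R]big1 ?mulr1// => i.
by rewrite mem_enum.
Qed.

Lemma lebV_cbox (a b : V) : (forall i, a 0 i <= b 0 i)%R ->
  lebV (cbox a b) = (\prod_i (b 0 i - a 0 i))%:E%R.
Proof.
move=> ab; have := @integral_lebV_prod (fun i => \1_`[a 0%R i, b 0%R i])
  (fun i => (b 0 i - a 0 i)%R).
move=> <-; first last.
- move=> i; rewrite integral_indic//= setIT lebesgue_measure_itv/= lte_fin.
  by case: ltgtP (ab i) => // -> _; rewrite subrr.
- by move=> i y; rewrite indicE.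
- by move=> i; exact: measurable_indic.
have mc : measurable (cbox a b : set VB) by exact: measurable_cbox.
transitivity (\int[@lebV R n]_x (\1_(cbox a b : set VB) x)%:E).
  by rewrite integral_indic// setIT.
apply: eq_integral => x _; congr EFin; rewrite indicE.
have [xc|xc] := boolP (x \in cbox a b).
  rewrite big1// => i _; rewrite indicE mem_set//= in_itv/=.
  by move: xc; rewrite inE; exact.
have [i hi] : exists i, ~ (a 0 i <= x 0 i <= b 0 i)%R.
  by apply/existsNP => h; move/negP: xc; apply; rewrite inE.
by rewrite (bigD1 i)//= indicE memNset ?mul0r//= in_itv.
Qed.

Let lebV_sigma_finite : sigma_finite [set: VB] (@lebV R n).
Proof.
exists (fun k : nat => cbox (const_mx (- k%:R)%R) (const_mx k%:R%R)).
  apply/esym; apply/seteqP; split => // x _.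
  have [k hk] : exists k : nat, (`|x| <= k%:R)%R.
    by exists (Num.bound `|x|)%R; rewrite ltW// archi_boundP.
  exists k => // i; rewrite !mxE -ler_norml.
  exact: le_trans (norm_coord x i) hk.
move=> k; split; first exact: measurable_cbox.
rewrite lebV_cbox ?ltry// => i; rewrite !mxE.
by rewrite -subr_ge0 opprK addr_ge0.
Qed.

HB.instance Definition _ := @Measure_isSigmaFinite.Build _ _ _ (@lebV R n) lebV_sigma_finite.

Lemma lebV_open_gt0 (U : set V) (x : V) : open U -> U x -> 0 < lebV (U : set VB).
Proof.
move=> oU Ux; have /nbhs_normP[e /= e0 he] : nbhs x U by exact: open_nbhs_nbhs.
pose a := (x - const_mx (e / 2)%R)%R; pose b := (x + const_mx (e / 2)%R)%R.
have e2 : (0 < e / 2)%R by rewrite divr_gt0.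
have ab i : (a 0 i <= b 0 i)%R by rewrite !mxE; lra.
have sub : cbox a b `<=` U.
  move=> y hy; apply: he; rewrite /ball_/=; apply: (@le_lt_trans _ _ (e / 2)%R); last lra.
  apply: norm_le_coord => [|i]; first lra.
  by have := hy i; rewrite !mxE ler_norml => /andP[h1 h2]; lra.
apply: (@lt_le_trans _ _ (lebV (cbox a b))).
  rewrite lebV_cbox// lte_fin; apply: prodr_gt0 => i _; rewrite !mxE; lra.
apply: le_measure; rewrite ?inE//; [exact: measurable_cbox | exact: measurable_open].
Qed.

Definition sqn (x : V) : R := (\sum_i x 0 i ^+ 2)%R.

Definition gauss (c : R) (x : V) : R := expR (- c * sqn x)%R.

Lemma gauss_gt0 c x : (0 < gauss c x)%R. Proof. exact: expR_gt0. Qed.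

Lemma continuous_sqn : continuous sqn.
Proof.
move=> x; apply: continuous_sumr => i.
apply: (@continuous_comp _ _ _ (fun x : V => x 0%R i) (fun y : R => y ^+ 2)%R).
  exact: coord_continuous.
exact: exprn_continuous.
Qed.

Lemma continuous_gauss c : continuous (gauss c).
Proof.
move=> x; apply: (@continuous_comp _ _ _ (fun x => - c * sqn x)%R (@expR R)).
  by apply: continuousM; [exact: cst_continuous | exact: continuous_sqn].
exact: continuous_expR.
Qed.

Lemma measurable_gauss c : measurable_fun [set: VB] (gauss c).
Proof. exact: continuous_measurable_rV (@continuous_gauss c). Qed.

(** The centred normal density of variance [1 / (2 c)] has exponent [- c y ^ 2]; the value is the
    inverse of its normalising constant. *)
Lemma gauss1 (c : R) : (0 < c)%R -> exists2 I : R, (0 < I)%R &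
  \int[lebesgue_measure]_y (expR (- c * y ^+ 2))%:E%R = I%:E.
Proof.
move=> c0; pose s := Num.sqrt (2 * c)^-1%R.
have s2 : (s ^+ 2 = (2 * c)^-1)%R by rewrite sqr_sqrtr// invr_ge0 mulr_ge0// ltW.
have s0 : (s != 0)%R by rewrite sqrtr_eq0 -ltNge invr_gt0 mulr_gt0.
have p0 := normal_peak_gt0 s0.
exists (normal_peak s)^-1%R; first by rewrite invr_gt0.
have := integral_normal_pdf 0%R s.
under eq_integral.
  move=> y _; rewrite normal_pdfE// /normal_fun subr0 s2.
  have -> : (- y ^+ 2 / ((2 * c)^-1 *+ 2) = - c * y ^+ 2)%R.
    by field; rewrite gt_eqF.
  rewrite EFinM; over.
rewrite ge0_integralZl_EFin//; first last.
- by rewrite ltW.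
- apply/measurable_EFinP; apply: continuous_measurable_fun => y.
  apply: (@continuous_comp _ _ _ (fun y : R => - c * y ^+ 2)%R (@expR R)).
    by apply: continuousM; [exact: cst_continuous | exact: exprn_continuous].
  exact: continuous_expR.
move=> h; set J := (X in X = _).
have -> : J = (normal_peak s)^-1%:E * ((normal_peak s)%:E * J).
  by rewrite muleA -EFinM mulVf ?mul1e// gt_eqF.
by rewrite h mule1.
Qed.

Lemma integral_gauss (c : R) : (0 < c)%R ->
  exists2 I : R, (0 < I)%R & \int[@lebV R n]_x (gauss c x)%:E = I%:E.
Proof.
move=> c0; have [I I0 hI] := gauss1 c0.
exists (\prod_(i < n) I)%R; first by apply: prodr_gt0.
rewrite -(@integral_lebV_prod (fun=> fun y => expR (- c * y ^+ 2)%R) (fun=> I))//.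
- apply: eq_integral => x _; congr EFin; rewrite /gauss /sqn mulr_sumr.
  by rewrite expR_sum.
- move=> i; apply: continuous_measurable_fun => y.
  apply: (@continuous_comp _ _ _ (fun y : R => - c * y ^+ 2)%R (@expR R)).
    by apply: continuousM; [exact: cst_continuous | exact: exprn_continuous].
  exact: continuous_expR.
Qed.

Lemma integrable_gauss (c : R) : (0 < c)%R ->
  (@lebV R n).-integrable setT (fun x => (gauss c x)%:E).
Proof.
move=> c0; apply/integrableP; split; first by apply/measurable_EFinP; exact: measurable_gauss.
under eq_integral do rewrite gee0_abs ?lee_fin ?expR_ge0//.
by have [I I0 ->] := integral_gauss c0; rewrite ltry.
Qed.

(** From [exp u >= 1 + u] one gets [1 + |x| <= A exp (a * sqn x)]. With [a] the [k]-th part of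
    [c / 2], the [k]-th power uses up exactly half of the Gaussian exponent. *)
Lemma poly_gauss (c : R) (k : nat) : (0 < c)%R -> exists2 K : R, (0 < K)%R &
  forall x : V, ((1 + `|x|) ^+ k * gauss c x <= K * gauss (c / 2) x)%R.
Proof.
move=> c0; case: k => [|k].
  exists 1%R => // x; rewrite expr0 !mul1r ler_expR ler_wpM2r//.
    by apply: sumr_ge0 => i _; exact: sqr_ge0.
  lra.
pose a := (c / 2 / k.+1%:R)%R; have a0 : (0 < a)%R by rewrite !divr_gt0.
pose A := (2 + a^-1)%R; have A0 : (0 < A)%R by rewrite addr_gt0// invr_gt0.
exists (A ^+ k.+1)%R; first exact: exprn_gt0.
move=> x; have sq : (`|x| ^+ 2 <= sqn x)%R by exact: norm_sqr_le.
have h1 : (1 + `|x| <= A * expR (a * sqn x))%R.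
  apply: (@le_trans _ _ (A * (1 + a * sqn x))%R); last first.
    by apply: ler_wpM2l; [exact: ltW | exact: expR_ge1Dx].
  have h : (1 + `|x| <= 2 + `|x| ^+ 2)%R by have := sqr_ge0 (`|x| - 2^-1)%R; nra.
  apply: (le_trans h).
  have s0 : (0 <= sqn x)%R by apply: sumr_ge0 => i _; exact: sqr_ge0.
  have -> : (A * (1 + a * sqn x) = 2 + a^-1 + 2 * (a * sqn x) + (a^-1 * a) * sqn x)%R.
    by rewrite /A; ring.
  rewrite mulVf ?gt_eqF// mul1r.
  have := mulr_ge0 (ltW a0) s0; have := invr_gt0 a; rewrite a0 => ai; lra.
have h2 : ((1 + `|x|) ^+ k.+1 <= A ^+ k.+1 * expR (c / 2 * sqn x))%R.
  have -> : (c / 2 * sqn x = k.+1%:R * (a * sqn x))%R by rewrite /a; field.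
  rewrite expRM_natl -exprMn; apply: lerXn2r => //; rewrite nnegrE.
    by rewrite addr_ge0.
  by apply: mulr_ge0; [exact: ltW | exact: expR_ge0].
apply: (@le_trans _ _ (A ^+ k.+1 * expR (c / 2 * sqn x) * gauss c x)%R).
  by rewrite ler_wpM2r// ltW// gauss_gt0.
rewrite -mulrA -expRD; apply: ler_wpM2l; first by rewrite exprn_ge0// ltW.
by rewrite ler_expR; lra.
Qed.

Lemma tonelli (f : VB * VB -> \bar R) : nnm f ->
  \int[@lebV R n]_x \int[@lebV R n]_y f (x, y) = \int[@lebV R n]_y \int[@lebV R n]_x f (x, y).
Proof. by move=> [mf f0]; exact: fubini_tonelli. Qed.

Lemma measurable_scale_add {d'} {T : measurableType d'} (r : R) (f h : T -> V) :
  measurable_fun setT (f : T -> VB) -> measurable_fun setT (h : T -> VB) ->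
  measurable_fun setT (fun w => (f w + r *: h w)%R : VB).
Proof.
move=> mf mh; apply: measurable_rV => i.
have -> : (fun w => (f w + r *: h w)%R 0%R i) = (fun w => f w 0 i + r * h w 0 i)%R.
  by apply: funext => w; rewrite !mxE.
apply: measurable_funD; first exact: (measurableT_comp (measurable_coord i) mf).
by apply: measurable_funM => //; exact: (measurableT_comp (measurable_coord i) mh).
Qed.

(* Two shears: x1 = x0 + w, then x0 = z - t w. *)
Lemma integral_shear (t : R) (f : VB * VB -> \bar R) : nnm f ->
  \int[@lebV R n]_x \int[@lebV R n]_y f (x, y) =
  \int[@lebV R n]_z \int[@lebV R n]_w f ((z - t *: w)%R, (z + (1 - t) *: w)%R).
Proof.
move=> [mf f0].
have nnf1 x : nnm (fun y : VB => f (x, y) : \bar R).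
  by split => //; exact: (measurableT_comp mf (measurable_pair1 _)).
have m1 : measurable_fun setT (fst : VB * VB -> VB) by exact: measurable_fst.
have m2 : measurable_fun setT (snd : VB * VB -> VB) by exact: measurable_snd.
have mf1 : nnm (fun p : VB * VB => f (p.1, (p.1 + 1 *: p.2)%R) : \bar R).
  split => //; apply: (measurableT_comp mf).
  by apply: measurable_fun_pair => //; exact: measurable_scale_add.
have mf2 : nnm (fun p : VB * VB => f ((p.1 - t *: p.2)%R, (p.1 + (1 - t) *: p.2)%R) : \bar R).
  split => //; apply: (measurableT_comp mf); apply: measurable_fun_pair.
    have -> : (fun p : VB * VB => (p.1 - t *: p.2)%R : VB) = (fun p => (p.1 + (- t) *: p.2)%R).
      by apply: funext => p; rewrite scaleNr.
    exact: measurable_scale_add.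
  exact: measurable_scale_add.
transitivity (\int[@lebV R n]_x \int[@lebV R n]_w f (x, (x + 1 *: w)%R)).
  apply: eq_integral => x _; rewrite -(integral_lebV_shift x (nnf1 x)).
  by apply: eq_integral => w _; rewrite scale1r addrC.
rewrite (tonelli mf1) [RHS](tonelli mf2) /=; apply: eq_integral => w _.
have nw : nnm (fun x : VB => f (x, (x + 1 *: w)%R) : \bar R).
  by split; [exact: (measurableT_comp mf1.1 (measurable_pair2 _)) | ].
rewrite -(integral_lebV_shift (- (t *: w))%R nw); apply: eq_integral => z _.
by congr (f (_, _)); rewrite scalerBl -addrA; congr (_ + _)%R; rewrite addrC.
Qed.

End LebesgueRVTheory.

(** * Integrals depending on parameters *)

Section SeqContinuous.
Context {R : realType} {U W : normedModType R}.

(** Dominated convergence is a statement on sequences; this carries it over to continuity in the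
    parameters. *)
Lemma seq_continuous (f : U -> W) (x : U) :
  (forall u : nat -> U, u k @[k --> \oo] --> x -> f (u k) @[k --> \oo] --> f x) ->
  {for x, continuous f}.
Proof.
move=> h; apply: contrapT => nc.
have [e e0 he] : exists2 e : R, 0 < e & forall del : R, 0 < del ->
    exists y, `|x - y| < del /\ ~ `|f x - f y| <= e.
  apply: contrapT => hn; apply: nc; apply: continuous_eps => e e0.
  apply: contrapT => hd; apply: hn; exists e => // del del0.
  apply: contrapT => hy; apply: hd; exists del => // y xy.
  by apply: contrapT => hfy; apply: hy; exists y.
have /choice[u hu] : forall k : nat, exists y, `|x - y| < k.+1%:R^-1 /\ ~ `|f x - f y| <= e.
  by move=> k; apply: he; rewrite invr_gt0.
have cu : u k @[k --> \oo] --> x.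
  apply/cvgrPdist_lt => d d0; exists (Num.bound d^-1) => // k /= kN.
  apply: lt_le_trans (hu k).1 _.
  have hk : d^-1 <= k.+1%:R.
    apply: (@le_trans _ _ (Num.bound d^-1)%:R).
      by apply: ltW; apply: archi_boundP; rewrite invr_ge0 ltW.
    by rewrite ler_nat leqW.
  by rewrite -[leRHS]invrK lef_pV2 ?posrE ?invr_gt0.
have /cvgrPdist_le/(_ e e0)[k _ /(_ k (leqnn k))] := h u cu.
by case: (hu k).
Qed.

End SeqContinuous.

Section Parametric.
Context {R : realType} {n : nat}.
Notation V := 'rV[R]_n.
Notation VB := (g_sigma_algebraType (@open V)).
Notation E := (@ebasis R n).
Notation leb := (@lebV R n).
Variable c : R.
Hypothesis c0 : 0 < c.
Implicit Types h : R -> V -> VB -> R.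

(** The exponent [c] is common to all parameters and only the factor [K] depends on their range, so
    one integrable majorant serves near each parameter. *)
Definition gdominated h := forall M : R, exists2 K : R, 0 <= K &
  forall t z w, `|t| <= M -> `|z| <= M -> `|h t z w| <= K * gauss c w.

Definition gparam h := [/\ forall w, jcont (fun t z => h t z w),
  forall t z, measurable_fun [set: VB] (h t z) & gdominated h].

Definition pint h t z : R := \int[leb]_w h t z w.

Lemma gparam_bound h (t : R) (z : V) : gparam h -> exists2 K : R, 0 <= K &
  forall w, `|h t z w| <= K * gauss c w.
Proof.
move=> [_ _ hd]; have [K K0 hK] := hd (Num.max `|t| `|z|).
by exists K => // w; apply: hK; rewrite le_max lexx ?orbT.
Qed.

Lemma integrableK (K : R) : leb.-integrable setT (fun w => (K * gauss c w)%:E).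
Proof.
under eq_fun do rewrite EFinM.
by apply: integrableZl => //; exact: integrable_gauss.
Qed.

Lemma gparam_integrable h t z : gparam h -> leb.-integrable setT (EFin \o h t z).
Proof.
move=> gh; have [K K0 hK] := gparam_bound t z gh; have [_ mh _] := gh.
apply: (@le_integrable _ _ _ leb setT _ _ (fun w => (K * gauss c w)%:E)) => //.
- by apply/measurable_EFinP; exact: mh.
- move=> w _ /=; rewrite lee_fin; apply: (le_trans (hK w)); exact: ler_norm.
- exact: integrableK.
Qed.

Lemma jcont_pint h : gparam h -> jcont (pint h).
Proof.
move=> gh; have [ch mh dh] := gh; move=> p; apply: seq_continuous => u cu.
have [K K0 hK] := dh (`|p| + 1).
have /cvgrPdist_le/(_ 1 ltr01)[N _ hN] := cu.
rewrite -(cvg_shiftn N).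
have hu k : `|(u (k + N)%N).1| <= `|p| + 1 /\ `|(u (k + N)%N).2| <= `|p| + 1.
  have /= h1 := hN (k + N)%N (leq_addl _ _).
  have h2 : `|u (k + N)%N| <= `|p| + 1.
    have -> : u (k + N)%N = p - (p - u (k + N)%N) by rewrite opprB addrC subrK.
    by apply: (le_trans (ler_normB _ _)); rewrite lerD2l.
  by split; apply: le_trans h2; rewrite prod_normE le_max lexx ?orbT.
have cu' : u (k + N)%N @[k --> \oo] --> p by rewrite (cvg_shiftn N).
have cf (w : VB) : setT w ->
    (h (u (k + N)%N).1 (u (k + N)%N).2 w)%:E @[k --> \oo] --> (h p.1 p.2 w)%:E.
  move=> _; apply: cvg_EFin; first exact: nearW.
  exact: (@continuous_cvg _ _ _ _ _ (fun k => u (k + N)%N) (fun q : R * V => h q.1 q.2 w) p (ch w p) cu').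
have bf (w : VB) (k : nat) : setT w ->
    (`|(h (u (k + N)%N).1 (u (k + N)%N).2 w)%:E| <= (K * gauss c w)%:E)%E.
  by move=> _; rewrite lee_fin; apply: hK; case: (hu k).
have m1 k : measurable_fun setT (fun w => (h (u (k + N)%N).1 (u (k + N)%N).2 w)%:E).
  by apply/measurable_EFinP; exact: mh.
have m2 : measurable_fun setT (fun w => (h p.1 p.2 w)%:E).
  by apply/measurable_EFinP; exact: mh.
have [_ _] := @dominated_convergence _ _ _ leb setT measurableT _ _
  (fun w => (K * gauss c w)%:E) m1 m2 (aeW _ cf) (integrableK K) (aeW _ bf).
move=> hcv; have fin (t : R) z : (\int[leb]_w (h t z w)%:E)%E \is a fin_num.
  exact: integrable_fin_num (gparam_integrable t z gh).
by apply: fine_cvg; rewrite fineK.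
Qed.

Lemma is_derive_pint h h' k : gparam h -> gparam h' ->
  (forall t z w, is_derive z (E k) (fun z => h t z w) (h' t z w)) ->
  forall t z, is_derive z (E k) (fun z => pint h t z) (pint h' t z).
Proof.
move=> gh gh' hd t z; apply/(is_derive_line (W := R)).
pose f (s : R) (w : VB) := h t (s *: E k + z) w.
pose f' (s : R) (w : VB) := h' t (s *: E k + z) w.
have df (s : R) w : is_derive s 1 (f ^~ w) (f' s w).
  apply/(is_derive_line (W := R)).
  have := (is_derive_line (W := R) _ _ _ _).1 (hd t (s *: E k + z) w).
  by apply: is_derive_ext => r; rewrite /f [_%:A]mulr1 scalerDl addrA.
have [_ _ dh'] := gh'.
pose M := Num.max `|t| (`|z| + `|E k|).
have [K K0 hK] := dh' M.
have d1 s w : (partial1of2 f) s w = f' s w.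
  by rewrite partial1of2E (@derive_val _ _ _ _ _ _ _ (df s w)).
have cv := @cvg_differentiation_under_integral R _ VB leb f setT measurableT 0 (-1) 1.
have {}cv : (fun r : R => r^-1 *: (pint h t (r *: E k + z) - pint h t z)) @ 0^' --> pint h' t z.
  have <- : (\int[leb]_y (partial1of2 f) 0 y) = pint h' t z.
    by apply: eq_Rintegral => w _; rewrite d1 /f' scale0r add0r.
  have -> : (fun r : R => r^-1 *: (pint h t (r *: E k + z) - pint h t z)) =
      (fun r : R => r^-1 *: ((\int[leb]_w f (r + 0) w) - \int[leb]_w f 0 w)).
    by apply/funext => r; rewrite addr0 /f scale0r add0r.
  apply: (cv _ _ _ (fun w => K * gauss c w)).
  - by rewrite /= in_itv/= ltrN10 ltr01.
  - by move=> s _; exact: gparam_integrable.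
  - by move=> s w _ _; exact: (@ex_derive _ _ _ _ _ _ _ (df s w)).
  - by move=> w; rewrite mulr_ge0// ltW// gauss_gt0.
  - exact: integrableK.
  - move=> s w; rewrite /= in_itv/= => /andP[s1 s2] _; rewrite d1; apply: hK.
      by rewrite le_max lexx.
    rewrite le_max; apply/orP; right; apply: (le_trans (ler_normD _ _)).
    rewrite addrC lerD2l normrZ ler_piMl// ler_norml; lra.
have E0 : (fun r : R => r^-1 *: (((fun r : R => pint h t (r *: E k + z)) \o shift 0) r%:A
    - pint h t (0 *: E k + z))) @ 0^' --> pint h' t z.
  by rewrite scale0r add0r; under eq_fun do rewrite /= addr0 [_%:A]mulr1.
apply: DeriveDef; first by apply/cvg_ex; exists (pint h' t z).
exact: cvg_lim E0.
Qed.

End Parametric.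

(** * Regularity of the potentials *)

Section SortedIndices.
Context {n : nat}.
Implicit Types s : seq 'I_n.
Notation leI := (fun i j : 'I_n => (i <= j)%N).

Lemma sum_count_mem s : \sum_i count_mem i s = size s.
Proof.
elim: s => [|i s ih] /=; first by rewrite big1.
rewrite big_split/= ih (bigD1 i)//= eqxx big1 ?addn0// => j /negbTE ji.
by rewrite eq_sym ji.
Qed.

(** [U2] speaks of derivatives along [mseq], which lists indices increasingly. Hence it applies to a
    list of directions exactly as written when the list is sorted. *)
Lemma mseq_count s : sorted leI s -> mseq (fun i => count_mem i s) = s.
Proof.
move=> ss; apply: (@sorted_eq _ leI) => //.
- by move=> x y z; exact: leq_trans.
- by move=> x y /andP[h1 h2]; apply/val_inj/eqP; rewrite eqn_leq h1.
- rewrite /mseq; have : pairwise (fun i j : 'I_n => (i < j)%N) (enum 'I_n).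
    rewrite -(pairwise_map val ltn) val_enum_ord -sorted_pairwise ?iota_ltn_sorted//.
    exact: ltn_trans.
  elim: (enum _) => //= i e ih /andP[hi he].
  have sn k : sorted leI (nseq k i).
    by case: k => //=; elim=> //= k ->; rewrite leqnn.
  rewrite sorted_pairwise; last by move=> x y z; exact: leq_trans.
  rewrite pairwise_cat -!sorted_pairwise; try by move=> x y z; exact: leq_trans.
  rewrite sn ih// andbT andbT; apply/allrelP => x y /nseqP[-> _] /flattenP[t /mapP[j je ->]].
  move=> /nseqP[-> _]; have /allP/(_ j je) := hi; exact: ltnW.
- apply/allP => x _ /=; apply/eqP; rewrite /mseq count_flatten sumnE big_map big_map.
  rewrite big_enum/= (bigD1 x)//= count_nseq/= eqxx mul1n.
  by rewrite big1 ?addn0// => j /negbTE jx; rewrite count_nseq/= jx.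
Qed.

End SortedIndices.

(** * Mixed finite differences *)

Section MixedDifferences.
Context {R : realType} {n : nat}.
Notation V := 'rV[R]_n.
Notation E := (@ebasis R n).
Implicit Types (psi : V -> R) (x y : V) (h k m : R).

Definition incr (i : 'I_n) h psi : V -> R := fun x => psi (x + h *: E i) - psi x.

(** Finite differences commute for every function; this takes the place of symmetry of mixed partial
    derivatives. *)
Lemma incrC i j h k psi : incr i h (incr j k psi) = incr j k (incr i h psi).
Proof.
apply/funext => x; rewrite /incr (addrAC x (k *: E j)); ring.
Qed.

Lemma is_derive_translate psi (v x e : V) dp : is_derive (x + v) e psi dp ->
  is_derive x e (fun x => psi (x + v)) dp.
Proof.
move=> h; apply/(is_derive_line (W := R)).
have := (is_derive_line (W := R) _ _ _ _).1 h.
by apply: is_derive_ext => r; rewrite addrA.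
Qed.

Lemma is_derive_incr i h psi dpsi (e : V) :
  (forall x, is_derive x e psi (dpsi x)) ->
  forall x, is_derive x e (incr i h psi) (incr i h dpsi x).
Proof.
by move=> hp x; apply: is_derB; apply: is_derive_translate.
Qed.

Lemma incr_MVT i h psi dpsi x : (forall x, is_derive x (E i) psi (dpsi x)) ->
  exists y, incr i h psi x = h * dpsi y.
Proof.
move=> hp; pose f (s : R) := psi (x + (s * h) *: E i).
have df (s : R) : is_derive s 1 f (h * dpsi (x + (s * h) *: E i)).
  have h1 : is_derive s 1 (fun s : R => s * h) h.
    have := is_derM (is_derive_id s 1) (is_derive_cst h s 1).
    by rewrite mulr0 addr0 mul1r.
  have h2 : is_derive ((s * h) : R) 1 (fun r : R => psi (x + r *: E i)) (dpsi (x + (s * h) *: E i)).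
    apply/(is_derive_line (W := R)).
    have := (is_derive_line (W := R) _ _ _ _).1 (hp (x + (s * h) *: E i)).
    apply: is_derive_ext => r; rewrite [_%:A]mulr1 scalerDl.
    by rewrite addrCA.
  rewrite mulrC.
  exact: (@is_derive_comp1 R R (fun r : R => psi (x + r *: E i)) (fun s : R => s * h) s 1 _ _ h2 h1).
have [c _ hc] := MVT01 (fun t _ => df t).
exists (x + (c * h) *: E i); rewrite -hc /incr /f mul1r mul0r scale0r addr0.
by [].
Qed.

Lemma incr_limit i psi x dp (K : R) : is_derive x (E i) psi dp ->
  (forall h, `|incr i h psi x| <= K * `|h|) -> `|dp| <= K.
Proof.
move=> hp hK.
have cv : (fun h : R => h^-1 *: (psi (h *: E i + x) - psi x)) @ 0^' --> dp.
  have [d1 <-] := hp; exact: d1.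
have {}cv : (fun h : R => `|h^-1 *: (psi (h *: E i + x) - psi x)|) @ 0^' --> `|dp|.
  exact: (@cvg_norm _ _ _ _ _ _ _ cv).
apply: (closed_cvg (fun y : R => y <= K)) cv; first exact: closed_le.
apply/nbhs_normP; exists 1 => //= h _ h0.
rewrite normrZ normfV ler_pdivrMl ?normr_gt0// mulrC.
by have := hK h; rewrite /incr (addrC x).
Qed.

(** The two increments are sent to zero one after the other, in the order in which the derivatives
    are taken. *)
Lemma mixed_limit i j psi g (x : V) dg (K : R) :
  (forall x, is_derive x (E j) psi (g x)) -> is_derive x (E i) g dg ->
  (forall h k y, `|incr i h (incr j k psi) y| <= K * `|h| * `|k|) -> `|dg| <= K.
Proof.
move=> hg hdg hK; apply: incr_limit hdg _ => h.
apply: (@incr_limit j (incr i h psi) x).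
  exact: is_derive_incr.
by move=> k; rewrite incrC.
Qed.

(** Two applications of the mean value theorem express the double difference by a value of [dij],
    while its limit with the increments in the other order is [dji]; a bound on the first therefore
    bounds the second. *)
Lemma mixed_swap i j psi gi gj dij (x : V) dji (K : R) :
  (forall x, is_derive x (E i) psi (gi x)) -> (forall x, is_derive x (E j) psi (gj x)) ->
  (forall x, is_derive x (E i) gj (dij x)) -> is_derive x (E j) gi dji ->
  (forall x, `|dij x| <= K) -> `|dji| <= K.
Proof.
move=> hi hj hij hji hK; apply: (mixed_limit hi hji) => h k y.
have [y1 ->] := incr_MVT h y (is_derive_incr i k hj).
have [y2 ->] := incr_MVT k y1 hij.
rewrite !normrM.
have -> : `|h| * (`|k| * `|dij y2|) = `|dij y2| * `|h| * `|k| by ring.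
by rewrite !ler_wpM2r.
Qed.

Lemma coord_lipschitz psi (K : R) x (v : V) :
  (forall c (m : R) y, `|incr c m psi y| <= K * `|m|) ->
  `|psi (x + v) - psi x| <= n%:R * K * `|v|.
Proof.
move=> hK.
have tr0 : trunc_row 0 v = 0 by apply/rowP => i; rewrite !mxE.
have trn : trunc_row n v = v by apply/rowP => i; rewrite !mxE ltn_ord.
have -> : psi (x + v) - psi x =
    \sum_(k < n) (psi (x + trunc_row k.+1 v) - psi (x + trunc_row k v)).
  rewrite -(big_mkord xpredT (fun j : nat => psi (x + trunc_row j.+1 v) - psi (x + trunc_row j v))).
  by rewrite telescope_sumr// tr0 trn addr0.
apply: le_trans (ler_norm_sum _ _ _) _.
apply: (@le_trans _ _ (\sum_(k < n) (K * `|v|))); last first.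
  by rewrite sumr_const card_ord -mulrA mulr_natl.
apply: ler_sum => k _.
have trS : trunc_row k.+1 v = trunc_row k v + v 0 k *: E k.
  apply/rowP => i; rewrite !mxE eqxx ltnS leq_eqVlt /=.
  have [->|nik] := eqVneq i k; first by rewrite eqxx ltnn mulr1 add0r.
  by rewrite mulr0 addr0 (negbTE (_ : (i != k :> nat))).
have K0 : 0 <= K.
  by have := hK k 1 x; rewrite normr1 mulr1; exact: le_trans.
rewrite trS addrA; apply: (le_trans (hK k (v 0 k) _)).
by rewrite ler_wpM2l// norm_coord.
Qed.

End MixedDifferences.

Section PotentialRegularity.
Context {R : realType} {n : nat}.
Notation V := 'rV[R]_n.
Notation E := (@ebasis R n).
Variables (phi : V -> R) (beta : R) (C : nat -> R) (Cb : R).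
Hypothesis hbeta : 2 < beta.
Hypothesis hU2 : U2 beta C Cb phi.
Notation N := (Num.ceil beta - 1).

Notation g k := (pds [:: k] phi).
Notation hh j k := (pds [:: j; k] phi).

Lemma potential_derive1 k x : is_derive x (E k) phi (pds [:: k] phi x).
Proof.
have [h1 _] := hU2; apply: DeriveDef => //.
exact: diff_derivable (h1 x).
Qed.

Lemma potential_derive2 j k x : is_derive x (E j) (pds [:: k] phi) (pds [:: j; k] phi x).
Proof.
have [_ [h2 _]] := hU2; apply: DeriveDef => //.
exact: diff_derivable (h2 k x).
Qed.

(** Strictness of [2 < beta] gives [ceil beta >= 3], so second derivatives always lie within the
    bounded range. *)
Lemma ceil_ge2 : (2 <= N)%R.
Proof.
have : (2 < Num.ceil beta)%R.
  by rewrite -(@ltr_int R); apply: lt_le_trans hbeta _; exact: ceil_ge.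
by rewrite lerBrDr; exact.
Qed.

Lemma mnorm_count (s : seq 'I_n) : mnorm (fun i => count_mem i s) = size s.
Proof. exact: sum_count_mem. Qed.

Lemma sorted_pds_exist (s : seq 'I_n) : sorted (fun i j : 'I_n => (i <= j)%N) s ->
  ((size s)%:Z <= N)%R -> pds_exist s phi.
Proof.
move=> ss hs; have [_ [_ [h _]]] := hU2.
by have := h (fun i => count_mem i s); rewrite mnorm_count mseq_count//; apply.
Qed.

Lemma sorted_pds_bound (s : seq 'I_n) : sorted (fun i j : 'I_n => (i <= j)%N) s ->
  (2 <= size s)%N -> ((size s)%:Z <= N)%R -> forall x, `|pds s phi x| <= C (size s).
Proof.
move=> ss s2 hs x; have [_ [_ [_ [h _]]]] := hU2.
have := h (size s) (fun i => count_mem i s) s2 hs (mnorm_count s) x.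
by rewrite /pdk mseq_count.
Qed.

(** Increasing pairs of indices are covered by the hypothesis, decreasing ones by swapping. *)
Lemma potential_hess_bound j k x : `|pds [:: j; k] phi x| <= C 2.
Proof.
have b (a b : 'I_n) : (a <= b)%N -> forall x, `|pds [:: a; b] phi x| <= C 2.
  move=> ab; apply: (@sorted_pds_bound [:: a; b]) => //=; first by rewrite ab.
  exact: ceil_ge2.
have [jk|kj] := leqP j k; first exact: b.
apply: (@mixed_swap R n k j phi (g k) (g j) (hh k j) x _ (C 2)).
- exact: potential_derive1.
- exact: potential_derive1.
- exact: potential_derive2.
- exact: potential_derive2.
- by apply: b; exact: ltnW.
Qed.

(* The top-order case [ceil beta - 1 = 2]: Hoelder increments of the sorted
   second derivatives pass to the unsorted ones. *)
Lemma hess_holder j k (v x : V) : N = 2 -> v != 0 ->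
  `|pds [:: j; k] phi (x + v) - pds [:: j; k] phi x|
     <= Cb * enorm v `^ (beta - (Num.ceil beta)%:~R + 1).
Proof.
move=> N2 v0; have b (a b : 'I_n) : (a <= b)%N -> forall x,
    `|pds [:: a; b] phi (x + v) - pds [:: a; b] phi x|
      <= Cb * enorm v `^ (beta - (Num.ceil beta)%:~R + 1).
  move=> ab y; have [_ [_ [_ [_ h]]]] := hU2.
  have ss : sorted (fun i j : 'I_n => (i <= j)%N) [:: a; b] by rewrite /= ab.
  have hN : (mnorm (fun i => count_mem i [:: a; b]))%:Z = N by rewrite mnorm_count N2.
  have := h _ hN (y + v) y; rewrite /pdk (mseq_count ss) => hb.
  have yv : y + v - y = v by rewrite addrAC subrr add0r.
  by rewrite yv in hb; apply: hb; rewrite -subr_eq0 yv.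
have [jk|kj] := leqP j k; first exact: b.
(* An increment of a second derivative of [phi] is a second derivative of the translated difference
   [tr phi], to which the swap applies. *)
pose tr (f : V -> R) := fun y => f (y + v) - f y.
have dtr (f df : V -> R) (e : V) : (forall y, is_derive y e f (df y)) ->
    forall y, is_derive y e (tr f) (tr df y).
  by move=> hf y; apply: is_derB; apply: is_derive_translate.
apply: (@mixed_swap R n k j (tr phi) (tr (g k)) (tr (g j)) (tr (hh k j)) x (tr (hh j k) x)).
- exact: (dtr _ _ _ (potential_derive1 k)).
- exact: (dtr _ _ _ (potential_derive1 j)).
- exact: (dtr _ _ _ (potential_derive2 k j)).
- exact: (dtr _ _ _ (potential_derive2 j k)).
- by apply: b; exact: ltnW.
Qed.

(** For increasing indices, three mean value theorems give a value of the bounded third derivative.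
    Every other order is reached by adjacent transpositions, since the differences commute. *)
Lemma triple_incr_bound : (3 <= N)%R -> forall (a b c : 'I_n) (h k m : R) x,
  `|incr a h (incr b k (incr c m phi)) x| <= C 3 * `|h| * `|k| * `|m|.
Proof.
move=> N3; pose B (a b c : 'I_n) := forall (h k m : R) x,
  `|incr a h (incr b k (incr c m phi)) x| <= C 3 * `|h| * `|k| * `|m|.
have s12 a b c : B a b c -> B b a c.
  by move=> hB h k m x; rewrite incrC; have := hB k h m x; rewrite -!mulrA (mulrCA `|k|).
have s23 a b c : B a b c -> B a c b.
  move=> hB h k m x; rewrite (incrC c b); have := hB h m k x.
  by rewrite -!mulrA (mulrC `|m|).
have sorted_case (a b c : 'I_n) : (a <= b)%N -> (b <= c)%N -> B a b c.
  move=> ab bc h k m x.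
  have ss : sorted (fun i j : 'I_n => (i <= j)%N) [:: a; b; c] by rewrite /= ab bc.
  have [_ d3] := @sorted_pds_exist [:: a; b; c] ss N3.
  rewrite (incrC b c) (incrC a c).
  have [y1 ->] := incr_MVT m x (is_derive_incr a h (is_derive_incr b k (potential_derive1 c))).
  rewrite incrC.
  have [y2 ->] := incr_MVT k y1 (is_derive_incr a h (potential_derive2 b c)).
  have [y3 ->] := @incr_MVT R n a h (pds [:: b; c] phi) (pds [:: a; b; c] phi) y2
    (fun y => DeriveDef (d3 y) erefl).
  rewrite !normrM.
  have -> : `|m| * (`|k| * (`|h| * `|pds [:: a; b; c] phi y3|)) =
    `|pds [:: a; b; c] phi y3| * `|h| * `|k| * `|m| by ring.
  by rewrite !ler_wpM2r// (@sorted_pds_bound [:: a; b; c]).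
move=> a b c; rewrite -/(B a b c).
have [ab|/ltnW ba] := leqP a b; have [bc|/ltnW cb] := leqP b c;
  have [ac|/ltnW ca] := leqP a c.
- exact: sorted_case.
- exact: sorted_case.
- by apply: s23; exact: sorted_case.
- by apply: s23; apply: s12; exact: sorted_case.
- by apply: s12; exact: sorted_case.
- by apply: s12; apply: s23; exact: sorted_case.
- by apply: (s12); apply: (s23); apply: (s12); apply: sorted_case => //; exact: leq_trans ac.
- by apply: (s12); apply: (s23); apply: (s12); exact: sorted_case.
Qed.

(** Two regimes. If [ceil beta - 1 = 2], the Hoelder condition bears on the second derivatives
    themselves, with positive exponent. Otherwise third derivatives are bounded in increasing order,
    and triple differences make every second derivative Lipschitz. *)
Lemma potential_hess_continuous j k : continuous (pds [:: j; k] phi).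
Proof.
have : (2 <= N)%R by exact: ceil_ge2.
rewrite le_eqVlt => /predU1P[N2|N3] x.
  pose gam := beta - (Num.ceil beta)%:~R + 1.
  have gam0 : 0 < gam.
    have := ceilB1_lt beta; rewrite /gam intrB.
    lra.
  apply: continuous_eps => e e0.
  (* [Cb] is not assumed positive. *)
  pose D := Num.max Cb 1.
  have D0 : 0 < D by rewrite lt_max ltr01 orbT.
  (* Solves [D * r ^ gam = e]; dividing by [n + 1] then passes from [enorm] to the maximum norm. *)
  pose r := (e / D) `^ (gam^-1).
  have r0 : 0 < r by rewrite powR_gt0// divr_gt0.
  exists (r / (n%:R + 1)) => [|y hy]; first by rewrite divr_gt0// ltr_wpDl.
  have [->|xy] := eqVneq x y; first by rewrite subrr normr0 ltW.
  have -> : x = y + (x - y) by rewrite addrC subrK.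
  have xy0 : x - y != 0 by rewrite subr_eq0.
  apply: (le_trans (hess_holder j k y (esym N2) xy0)).
  have en0 : 0 <= enorm (x - y) by exact: sqrtr_ge0.
  have en : enorm (x - y) <= r.
    apply: (@le_trans _ _ ((n%:R + 1) * `|x - y|)).
      rewrite -ler_sqr ?nnegrE ?mulr_ge0 ?addr_ge0//.
      rewrite sqr_sqrtr; last by apply: sumr_ge0 => i _; exact: sqr_ge0.
      apply: (le_trans (sqr_le_norm _)); rewrite exprMn ler_wpM2r ?sqr_ge0//.
      have : 0 <= n%:R :> R by []; nra.
    by rewrite mulrC -ler_pdivlMr ?ltr_wpDl// ltW.
  apply: (@le_trans _ _ (D * enorm (x - y) `^ gam)).
    by rewrite ler_wpM2r ?powR_ge0// le_max lexx.
  rewrite mulrC -ler_pdivlMr//.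
  have -> : e / D = r `^ gam.
    by rewrite /r -powRrM mulVf ?gt_eqF// powRr1// ltW// divr_gt0.
  by apply: ge0_ler_powR => //; rewrite ?nnegrE ?ltW.
have {}N3 : (3 <= N)%R by rewrite -lezD1 in N3.
(* Two of the three increments become derivatives in the limit, and the third remains as the
   increment of the second derivative. *)
have lip c (m : R) y : `|incr c m (hh j k) y| <= C 3 * `|m|.
  apply: (@mixed_limit R n j k (incr c m phi) (incr c m (g k)) y).
  - by apply: is_derive_incr => z; exact: potential_derive1.
  - by apply: is_derive_incr => z; exact: potential_derive2.
  - move=> h l z; have := triple_incr_bound N3 j k c h l m z.
    by congr (_ <= _); ring.
apply: continuous_eps => e e0.
have C0 : 0 <= Num.max (C 3) 0 by rewrite le_max lexx orbT.
exists (e / (n%:R * Num.max (C 3) 0 + 1)) => [|y hy].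
  by rewrite divr_gt0// ltr_wpDl// mulr_ge0.
have -> : x = y + (x - y) by rewrite addrC subrK.
apply: (@le_trans _ _ (n%:R * Num.max (C 3) 0 * `|x - y|)).
  apply: coord_lipschitz => c m z; apply: (le_trans (lip c m z)).
  by rewrite ler_wpM2r// le_max lexx.
rewrite ltr_pdivlMr in hy; last by rewrite ltr_wpDl// mulr_ge0.
by apply: le_trans (ltW hy); rewrite mulrC ler_wpM2l// lerDl.
Qed.

End PotentialRegularity.

(** * Strongly convex potentials with bounded Hessian *)

Section SmoothConvex.
Context {R : realType} {n : nat}.
Notation V := 'rV[R]_n.
Notation E := (@ebasis R n).

Lemma C1_continuous (g : V -> R) (dg : 'I_n -> V -> R) :
  (forall k x, is_derive x (E k) g (dg k x)) -> (forall k, continuous (dg k)) ->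
  continuous g.
Proof.
move=> hg cg x.
have dE k : 'D_(E k) g = dg k.
  by apply/funext => y; exact: (@derive_val _ _ _ _ _ _ _ (hg k y)).
have h := @C1_is_diff R n g x (fun y k => @ex_derive _ _ _ _ _ _ _ (hg k y)).
apply: differentiable_continuous; apply: (@ex_diff _ _ _ _ _ _ _ (h _)) => k.
by rewrite dE; exact: cg.
Qed.

(** What is kept of the hypotheses from here on: a bounded, continuous Hessian for every order of
    the indices, together with strong convexity. *)
Definition smooth_convex (phi : V -> R) (al C : R) : Prop :=
  [/\ forall k x, is_derive x (E k) phi (pds [:: k] phi x),
      forall j k x, is_derive x (E j) (pds [:: k] phi) (pds [:: j; k] phi x),
      forall j k x, `|pds [:: j; k] phi x| <= C,
      forall j k, continuous (pds [:: j; k] phi) & U3 al phi].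

Lemma U2_smooth_convex (phi : V -> R) (beta al : R) C Cb : 2 < beta ->
  U2 beta C Cb phi -> U3 al phi -> smooth_convex phi al (C 2).
Proof.
move=> b2 h2 h3; split => //.
- exact: potential_derive1 h2.
- exact: potential_derive2 h2.
- exact: potential_hess_bound b2 h2.
- exact: potential_hess_continuous b2 h2.
Qed.

Lemma enorm_sqr (x : V) : enorm x ^+ 2 = sqn x.
Proof. by rewrite sqr_sqrtr//; apply: sumr_ge0 => i _; exact: sqr_ge0. Qed.

Lemma sqn_ge0 (x : V) : 0 <= sqn x.
Proof. by apply: sumr_ge0 => i _; exact: sqr_ge0. Qed.

Lemma sqnZ (a : R) (x : V) : sqn (a *: x) = a ^+ 2 * sqn x.
Proof. by rewrite /sqn mulr_sumr; apply: eq_bigr => i _; rewrite mxE exprMn. Qed.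

Lemma sqnB_le (x y : V) : sqn (x - y) <= 2 * (sqn x + sqn y).
Proof.
rewrite /sqn -big_split mulr_sumr /=; apply: ler_sum => i _; rewrite !mxE.
by have := sqr_ge0 (x 0 i + y 0 i); nra.
Qed.

Section Facts.
Variables (phi : V -> R) (al C : R).
Hypothesis al0 : 0 < al.
Hypothesis C0 : 0 <= C.
Hypothesis hphi : smooth_convex phi al C.
Notation g k := (pds [:: k] phi).

Lemma sc_continuous1 k : continuous (g k).
Proof.
have [_ h2 _ h4 _] := hphi.
exact: (@C1_continuous (g k) (fun j => pds [:: j; k] phi)).
Qed.

Lemma sc_continuous0 : continuous phi.
Proof.
have [h1 _ _ _ _] := hphi.
by apply: (@C1_continuous phi (fun k => g k)) => // k; exact: sc_continuous1.
Qed.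

Lemma sc_lipschitz k x y : `|g k y - g k x| <= n%:R * C * `|y - x|.
Proof.
have [_ h2 h3 _ _] := hphi; apply: lipschitz_coord.
  by move=> z j; exact: (@ex_derive _ _ _ _ _ _ _ (h2 j k z)).
by move=> z j _; rewrite (@derive_val _ _ _ _ _ _ _ (h2 j k z)) h3.
Qed.

Lemma sc_growth1 : exists2 A : R, 0 <= A & forall k x, `|g k x| <= A * (1 + `|x|).
Proof.
pose S := \sum_k `|g k 0|.
have S0 : 0 <= S by apply: sumr_ge0.
exists (S + n%:R * C) => [|k x]; first by rewrite addr_ge0// mulr_ge0.
have h := sc_lipschitz k 0 x; rewrite subr0 in h.
have hs : `|g k 0| <= S by rewrite /S (bigD1 k)//= lerDl; apply: sumr_ge0.
have -> : g k x = g k x - g k 0 + g k 0 by rewrite subrK.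
apply: (le_trans (ler_normD _ _)).
have nC : 0 <= n%:R * C by rewrite mulr_ge0.
by have := mulr_ge0 S0 (normr_ge0 x); nra.
Qed.

(** Strong convexity at the origin; completing the square absorbs the linear term into half of the
    quadratic one. *)
Lemma sc_lower : exists A : R, forall x, - A + al / 4 * sqn x <= phi x.
Proof.
exists (\sum_k g k 0 ^+ 2 / al - phi 0) => x.
have [_ _ _ _ h5] := hphi; apply: le_trans (h5 x 0).
rewrite subr0 enorm_sqr.
have h : 0 <= (\sum_k g k 0 ^+ 2 / al) + (\sum_k g k 0 * x 0 k) + al / 4 * sqn x.
  rewrite /sqn mulr_sumr -!big_split/=; apply: sumr_ge0 => i _.
  have -> : g i 0 ^+ 2 / al + g i 0 * x 0 i + al / 4 * x 0 i ^+ 2 =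
      (g i 0 + al / 2 * x 0 i) ^+ 2 / al by field; rewrite gt_eqF.
  by rewrite divr_ge0 ?sqr_ge0// ltW.
lra.
Qed.

(** One factor [n] comes from the staircase estimate, the other from the Lipschitz constant [n C] of
    the gradient. *)
Lemma sc_upper x z :
  phi (x + z) <= phi x + \sum_k g k x * z 0 k + n%:R ^+ 2 * C * `|z| ^+ 2.
Proof.
have [h1 _ _ _ _] := hphi.
have := @MVT_coord R n phi x z (\row_k g k x) (n%:R * C * `|z|).
have -> : \sum_k (\row_k0 g k0 x) 0 k * z 0 k = \sum_k g k x * z 0 k.
  by apply: eq_bigr => k _; rewrite mxE.
move=> h; have {}h : `|phi (x + z) - phi x - \sum_k g k x * z 0 k| <= n%:R * (n%:R * C * `|z|) * `|z|.
  apply: h => [y k|y k hy]; first exact: (@ex_derive _ _ _ _ _ _ _ (h1 k y)).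
  rewrite mxE (@derive_val _ _ _ _ _ _ _ (h1 k y)).
  by apply: (le_trans (sc_lipschitz k x y)); rewrite ler_wpM2l// mulr_ge0.
have := le_trans (ler_norm _) h.
have -> : n%:R * (n%:R * C * `|z|) * `|z| = n%:R ^+ 2 * C * `|z| ^+ 2 by ring.
lra.
Qed.

End Facts.
End SmoothConvex.

(** * The interpolation density and its velocity field *)

Section Density.
Context {R : realType} {n : nat}.
Notation V := 'rV[R]_n.
Notation E := (@ebasis R n).
Variables (phi0 phi1 : V -> R) (al C : R).
Hypothesis al0 : 0 < al.
Hypothesis C0 : 0 <= C.
Hypothesis sc0 : smooth_convex phi0 al C.
Hypothesis sc1 : smooth_convex phi1 al C.
Implicit Types (t : R) (z w : V).

Definition arg0 t z w : V := z - t *: w.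
Definition arg1 t z w : V := z + (1 - t) *: w.
Definition joint_potential t z w := phi0 (arg0 t z w) + phi1 (arg1 t z w).
Definition joint_grad k t z w := pds [:: k] phi0 (arg0 t z w) + pds [:: k] phi1 (arg1 t z w).
Definition joint_hess j k t z w :=
  pds [:: j; k] phi0 (arg0 t z w) + pds [:: j; k] phi1 (arg1 t z w).
Definition dens t z w : R := expR (- joint_potential t z w).

Lemma dens_gt0 t z w : 0 < dens t z w. Proof. exact: expR_gt0. Qed.

Lemma continuous_affine (T : topologicalType) (a : T -> R) (b y : T -> V) (x : T) :
  {for x, continuous a} -> {for x, continuous b} -> {for x, continuous y} ->
  {for x, continuous (fun p => y p + a p *: b p)}.
Proof.
move=> ca cb cy; have h := @continuousZ R V T a b x ca cb.
exact: (@continuousD R V T y (fun p => a p *: b p) x cy h).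
Qed.

Lemma jcont_arg0 w : continuous (fun p : R * V => arg0 p.1 p.2 w).
Proof.
move=> p; have -> : (fun p : R * V => arg0 p.1 p.2 w) = (fun p => p.2 + (- p.1) *: w).
  by apply/funext => q; rewrite /arg0 scaleNr.
apply: (@continuous_affine (R * V)%type (fun p => - p.1) (cst w) snd).
- apply: (@continuousN R R (R * V)%type fst); exact: cvg_fst.
- exact: cst_continuous.
- exact: cvg_snd.
Qed.

Lemma jcont_arg1 w : continuous (fun p : R * V => arg1 p.1 p.2 w).
Proof.
move=> p; apply: (@continuous_affine (R * V)%type (fun p => 1 - p.1) (cst w) snd).
- apply: (@continuousB R R (R * V)%type (cst 1) fst); first exact: cst_continuous.
  exact: cvg_fst.
- exact: cst_continuous.
- exact: cvg_snd.
Qed.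

Lemma continuous_arg0 t z : continuous (arg0 t z).
Proof.
move=> w; have -> : arg0 t z = (fun w => z + (- t) *: w).
  by apply/funext => q; rewrite /arg0 scaleNr.
by apply: (@continuous_affine V (cst (- t)) id (cst z)); [exact: cst_continuous| exact: cvg_id | exact: cst_continuous].
Qed.

Lemma continuous_arg1 t z : continuous (arg1 t z).
Proof.
move=> w.
by apply: (@continuous_affine V (cst (1 - t)) id (cst z)); [exact: cst_continuous| exact: cvg_id | exact: cst_continuous].
Qed.

(** Continuity in [(t, z)] makes the integrals over [w] continuous; continuity in [w] makes the
    integrands measurable. *)
Definition bicont (b : R -> V -> V -> R) : Prop :=
  (forall w, jcont (fun t z => b t z w)) /\ (forall t z, continuous (b t z)).

Lemma bicont_arg (f0 f1 : V -> R) : continuous f0 -> continuous f1 ->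
  bicont (fun t z w => f0 (arg0 t z w) + f1 (arg1 t z w)).
Proof.
move=> c0 c1; split=> [w p|t z w].
  apply: (@continuousD R R (R * V)%type (fun p => f0 (arg0 p.1 p.2 w)) (fun p => f1 (arg1 p.1 p.2 w))).
    apply: (@continuous_comp _ _ _ (fun p : R * V => arg0 p.1 p.2 w) f0); last exact: c0.
    exact: jcont_arg0.
  apply: (@continuous_comp _ _ _ (fun p : R * V => arg1 p.1 p.2 w) f1); last exact: c1.
  exact: jcont_arg1.
apply: (@continuousD R R V (fun w => f0 (arg0 t z w)) (fun w => f1 (arg1 t z w))).
  apply: (@continuous_comp _ _ _ (arg0 t z) f0); last exact: c0.
  exact: continuous_arg0.
apply: (@continuous_comp _ _ _ (arg1 t z) f1); last exact: c1.
exact: continuous_arg1.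
Qed.

Lemma bicontM b1 b2 : bicont b1 -> bicont b2 -> bicont (fun t z w => b1 t z w * b2 t z w).
Proof.
move=> [h1 h2] [h3 h4]; split=> [w p|t z w].
  exact: (@continuousM R (R * V)%type (fun p => b1 p.1 p.2 w) (fun p => b2 p.1 p.2 w) p (h1 w p) (h3 w p)).
exact: (@continuousM R V (b1 t z) (b2 t z) w (h2 t z w) (h4 t z w)).
Qed.

Lemma bicontN b1 : bicont b1 -> bicont (fun t z w => - b1 t z w).
Proof.
move=> [h1 h2]; split=> [w p|t z w].
  exact: (@continuousN R R (R * V)%type (fun p => b1 p.1 p.2 w) p (h1 w p)).
exact: (@continuousN R R V (b1 t z) w (h2 t z w)).
Qed.

Lemma bicontB b1 b2 : bicont b1 -> bicont b2 -> bicont (fun t z w => b1 t z w - b2 t z w).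
Proof.
move=> [h1 h2] [h3 h4]; split=> [w p|t z w].
  exact: (@continuousB R R (R * V)%type (fun p => b1 p.1 p.2 w) (fun p => b2 p.1 p.2 w) p (h1 w p) (h3 w p)).
exact: (@continuousB R R V (b1 t z) (b2 t z) w (h2 t z w) (h4 t z w)).
Qed.

Lemma bicont_weight (a : V -> R) : continuous a -> bicont (fun _ _ => a).
Proof. by move=> ca; split=> [w p|t z]; [exact: cst_continuous | exact: ca]. Qed.

Lemma bicont_PhiG k : bicont (joint_grad k).
Proof. by apply: bicont_arg; [exact: sc_continuous1 sc0 _ | exact: sc_continuous1 sc1 _]. Qed.

Lemma bicont_PhiH j k : bicont (joint_hess j k).
Proof.
have [_ _ _ c0 _] := sc0; have [_ _ _ c1 _] := sc1.
exact: bicont_arg.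
Qed.

Lemma bicont_Phi : bicont joint_potential.
Proof. by apply: bicont_arg; [exact: sc_continuous0 sc0 | exact: sc_continuous0 sc1]. Qed.

Lemma bicont_dens : bicont dens.
Proof.
have [h1 h2] := bicontN bicont_Phi; split=> [w p|t z w].
  apply: (@continuous_comp _ _ _ (fun p : R * V => - joint_potential p.1 p.2 w) (@expR R)); first exact: h1.
  exact: continuous_expR.
apply: (@continuous_comp _ _ _ (fun w => - joint_potential t z w) (@expR R)); first exact: h2.
exact: continuous_expR.
Qed.

(** Since [w = arg1 t z w - arg0 t z w], the quadratic lower bounds at the two arguments add up to
    coercivity in [w], uniformly in [t] and [z]. *)
Lemma Phi_lower : exists A : R, forall t z w, - A + al / 8 * sqn w <= joint_potential t z w.
Proof.
have [A0 h0] := sc_lower al0 sc0; have [A1 h1] := sc_lower al0 sc1.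
exists (A0 + A1) => t z w.
have hw : w = arg1 t z w - arg0 t z w.
  by rewrite /arg1 /arg0 opprB addrC addrA subrK -scalerDl addrC subrK scale1r.
have := sqnB_le (arg1 t z w) (arg0 t z w); rewrite -hw => hs.
have := h0 (arg0 t z w); have := h1 (arg1 t z w); rewrite /joint_potential.
set s0 := sqn (arg0 t z w) in hs *; set s1 := sqn (arg1 t z w) in hs *.
set s := sqn w in hs *; move=> e1 e0.
have : al / 8 * s <= al / 8 * (2 * (s1 + s0)) by rewrite ler_wpM2l// divr_ge0// ltW.
lra.
Qed.

(** The cube is what second derivatives of moments require: a weight and two gradients, each of
    linear growth. Absorbing it halves the exponent [al / 8]. *)
Lemma dens_bound : exists2 K : R, 0 < K & forall t z w,
  (1 + `|w|) ^+ 3 * dens t z w <= K * gauss (al / 16) w.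
Proof.
have [A hA] := Phi_lower.
have [K K0 hK] := @poly_gauss R n (al / 8) 3 (divr_gt0 al0 (ltr0n _ 8)).
exists (K * expR A) => [|t z w]; first by rewrite mulr_gt0// expR_gt0.
apply: (@le_trans _ _ (expR A * ((1 + `|w|) ^+ 3 * gauss (al / 8) w))).
  rewrite mulrCA ler_wpM2l ?exprn_ge0 ?addr_ge0// -expRD ler_expR.
  by have := hA t z w; lra.
have := hK w; have -> : al / 8 / 2 = al / 16 by field.
by move=> h; rewrite (mulrC K) -(mulrA (expR A)); apply: ler_wpM2l => //; exact: expR_ge0.
Qed.

Definition polybound (b : R -> V -> V -> R) : Prop := forall M : R, exists2 K : R, 0 <= K &
  forall t z w, `|t| <= M -> `|z| <= M -> `|b t z w| <= K * (1 + `|w|) ^+ 3.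

Lemma gparam_poly b : bicont b -> polybound b ->
  gparam (al / 16) (fun t z w => b t z w * dens t z w).
Proof.
move=> cb pb; have [h1 h2] := bicontM cb bicont_dens; split=> //.
  by move=> t z; apply: continuous_measurable_rV; exact: h2.
move=> M; have [K K0 hK] := pb M; have [K' K'0 hK'] := dens_bound.
exists (K * K') => [|t z w ht hz]; first by rewrite mulr_ge0// ltW.
rewrite normrM (gtr0_norm (dens_gt0 t z w)).
apply: (@le_trans _ _ (K * (1 + `|w|) ^+ 3 * dens t z w)).
  by rewrite ler_wpM2r ?(ltW (dens_gt0 _ _ _))// hK.
by rewrite -(mulrA K) -(mulrA K); apply: ler_wpM2l.
Qed.

Lemma norm_arg0 t z w : `|arg0 t z w| <= `|z| + `|t| * `|w|.
Proof. by apply: (le_trans (ler_normB _ _)); rewrite normrZ. Qed.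

Lemma norm_arg1 t z w : `|arg1 t z w| <= `|z| + (1 + `|t|) * `|w|.
Proof.
apply: (le_trans (ler_normD _ _)); rewrite normrZ lerD2l ler_wpM2r//.
by apply: (le_trans (ler_normB _ _)); rewrite normr1.
Qed.

Lemma PhiG_bound (M : R) : exists2 K : R, 0 <= K & forall k t z w,
  `|t| <= M -> `|z| <= M -> `|joint_grad k t z w| <= K * (1 + `|w|).
Proof.
have [A0 A00 h0] := sc_growth1 C0 sc0; have [A1 A10 h1] := sc_growth1 C0 sc1.
have AA : 0 <= A0 + A1 by rewrite addr_ge0.
exists ((A0 + A1) * (2 + `|M|)) => [|k t z w ht hz]; first by rewrite mulr_ge0// addr_ge0.
have hM := ler_norm M.
apply: (le_trans (ler_normD _ _)).
have e0 : `|arg0 t z w| <= `|M| + (1 + `|M|) * `|w|.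
  apply: (le_trans (norm_arg0 _ _ _)); apply: lerD; first exact: le_trans hM.
  by rewrite ler_wpM2r//; lra.
have e1 : `|arg1 t z w| <= `|M| + (1 + `|M|) * `|w|.
  apply: (le_trans (norm_arg1 _ _ _)); apply: lerD; first exact: le_trans hM.
  by rewrite ler_wpM2r//; lra.
have f0 := h0 k (arg0 t z w); have f1 := h1 k (arg1 t z w).
have g0 : A0 * (1 + `|arg0 t z w|) <= A0 * ((2 + `|M|) * (1 + `|w|)).
  by rewrite ler_wpM2l//; have := normr_ge0 w; have := normr_ge0 M; nra.
have g1 : A1 * (1 + `|arg1 t z w|) <= A1 * ((2 + `|M|) * (1 + `|w|)).
  by rewrite ler_wpM2l//; have := normr_ge0 w; have := normr_ge0 M; nra.
lra.
Qed.

Lemma PhiH_bound j k t z w : `|joint_hess j k t z w| <= 2 * C.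
Proof.
have [_ _ h0 _ _] := sc0; have [_ _ h1 _ _] := sc1.
apply: (le_trans (ler_normD _ _)).
have -> : 2 * C = C + C by ring.
by apply: lerD; [exact: h0|exact: h1].
Qed.

Lemma is_derive_arg (f0 f1 : V -> R) (d0 d1 : V -> R) k t z w :
  (forall x, is_derive x (E k) f0 (d0 x)) -> (forall x, is_derive x (E k) f1 (d1 x)) ->
  is_derive z (E k) (fun z => f0 (arg0 t z w) + f1 (arg1 t z w))
    (d0 (arg0 t z w) + d1 (arg1 t z w)).
Proof. by move=> h0 h1; apply: is_derD; exact: is_derive_translate. Qed.

Lemma is_derive_Phi k t z w : is_derive z (E k) (fun z => joint_potential t z w) (joint_grad k t z w).
Proof. by have [h0 _ _ _ _] := sc0; have [h1 _ _ _ _] := sc1; exact: is_derive_arg. Qed.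

Lemma is_derive_PhiG j k t z w : is_derive z (E j) (fun z => joint_grad k t z w) (joint_hess j k t z w).
Proof.
have [_ h0 _ _ _] := sc0; have [_ h1 _ _ _] := sc1.
exact: (@is_derive_arg (pds [:: k] phi0) (pds [:: k] phi1) (pds [:: j; k] phi0)
  (pds [:: j; k] phi1) j t z w (h0 j k) (h1 j k)).
Qed.

Lemma is_derive_dens k t z w :
  is_derive z (E k) (fun z => dens t z w) (- joint_grad k t z w * dens t z w).
Proof.
rewrite mulrC; apply: (is_derive_comp1 (is_derive_expR _)).
exact: is_derN (is_derive_Phi k t z w).
Qed.

Section Weight.
Variable a : V -> R.
Hypothesis ca : continuous a.
Hypothesis ba : forall w, `|a w| <= 1 + `|w|.

(** The weighted integrand, followed by its first and second derivatives in [z]. The weights used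
    are [1], the coordinates of [w], and their positive and negative parts. *)
Definition A0f t z w := a w * dens t z w.
Definition A1f k t z w := - (a w * joint_grad k t z w) * dens t z w.
Definition A2f j k t z w := (a w * (joint_grad j t z w * joint_grad k t z w - joint_hess j k t z w)) * dens t z w.

Lemma one_le_cube w (m : nat) : (m <= 3)%N -> (1 + `|w|) ^+ m <= (1 + `|w|) ^+ 3.
Proof. by move=> m3; apply: ler_weXn2l => //; rewrite lerDl. Qed.

Lemma gparam_A0 : gparam (al / 16) A0f.
Proof.
apply: (@gparam_poly (fun _ _ => a)); first exact: bicont_weight.
move=> M; exists 1 => // t z w _ _; rewrite mul1r; apply: (le_trans (ba w)).
by have := @one_le_cube w 1 isT; rewrite expr1.
Qed.

Lemma gparam_A1 k : gparam (al / 16) (A1f k).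
Proof.
apply: (@gparam_poly (fun t z w => - (a w * joint_grad k t z w))).
  by apply: bicontN; apply: bicontM (bicont_weight ca) (bicont_PhiG k).
move=> M; have [K K0 hK] := PhiG_bound M; exists K => // t z w ht hz.
rewrite normrN normrM; apply: (@le_trans _ _ ((1 + `|w|) * (K * (1 + `|w|)))).
  by apply: ler_pM => //; exact: hK.
rewrite mulrCA -expr2 ler_wpM2l//; exact: one_le_cube.
Qed.

Lemma gparam_A2 j k : gparam (al / 16) (A2f j k).
Proof.
apply: (@gparam_poly (fun t z w => a w * (joint_grad j t z w * joint_grad k t z w - joint_hess j k t z w))).
  apply: bicontM (bicont_weight ca) _; apply: bicontB (bicont_PhiH j k).
  exact: bicontM (bicont_PhiG j) (bicont_PhiG k).
move=> M; have [K K0 hK] := PhiG_bound M.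
exists (K ^+ 2 + 2 * C) => [|t z w ht hz]; first by rewrite addr_ge0 ?sqr_ge0// mulr_ge0.
rewrite normrM; have w1 : 0 <= 1 + `|w| by rewrite addr_ge0.
have -> : (K ^+ 2 + 2 * C) * (1 + `|w|) ^+ 3 = (1 + `|w|) * ((K ^+ 2 + 2 * C) * (1 + `|w|) ^+ 2).
  by ring.
apply: ler_pM => //; apply: (le_trans (ler_normB _ _)).
rewrite (mulrDl (K ^+ 2)); apply: lerD.
  have -> : K ^+ 2 * (1 + `|w|) ^+ 2 = (K * (1 + `|w|)) * (K * (1 + `|w|)) by ring.
  by rewrite normrM; apply: ler_pM => //; exact: hK.
apply: (le_trans (PhiH_bound _ _ _ _ _)); rewrite ler_peMr ?mulr_ge0//.
by rewrite -(expr0 (1 + `|w|)); apply: ler_weXn2l => //; rewrite lerDl.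
Qed.

Definition A0 t z := pint A0f t z.
Definition A1 k t z := pint (A1f k) t z.
Definition A2 j k t z := pint (A2f j k) t z.

Let c16 : 0 < al / 16. Proof. by rewrite divr_gt0. Qed.

Lemma jcont_A0 : jcont A0. Proof. exact: (@jcont_pint _ _ _ c16 _ gparam_A0). Qed.
Lemma jcont_A1 k : jcont (A1 k). Proof. exact: (@jcont_pint _ _ _ c16 _ (gparam_A1 k)). Qed.
Lemma jcont_A2 j k : jcont (A2 j k). Proof. exact: (@jcont_pint _ _ _ c16 _ (gparam_A2 j k)). Qed.

Lemma is_derive_A0 k t z : is_derive z (E k) (A0 t) (A1 k t z).
Proof.
apply: (is_derive_pint c16 gparam_A0 (gparam_A1 k)) => {}t {}z w.
have := is_derZ (a w) (is_derive_dens k t z w).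
by rewrite /A1f mulrA mulrN mulNr.
Qed.

Lemma is_derive_A1 j k t z : is_derive z (E j) (A1 k t) (A2 j k t z).
Proof.
apply: (is_derive_pint c16 (gparam_A1 k) (gparam_A2 j k)) => {}t {}z w.
have h := is_derN (is_derZ (a w) (is_derive_PhiG j k t z w)).
have := is_derM h (is_derive_dens j t z w).
by congr is_derive; rewrite /A2f; ring.
Qed.

End Weight.
End Density.

(** * The velocity field, its Jacobian and its Hessian *)

Section Velocity.
Context {R : realType} {n : nat}.
Notation V := 'rV[R]_n.
Notation VB := (g_sigma_algebraType (@open V)).
Notation E := (@ebasis R n).
Notation leb := (@lebV R n).

Lemma gauss_shift (c : R) (a : V) : 0 < c ->
  leb.-integrable setT (EFin \o (fun w : VB => gauss c (w - a))) /\
  \int[leb]_w gauss c (w - a) = \int[leb]_w gauss c w.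
Proof.
move=> c0; have nf : nnm (fun w : VB => (gauss c w)%:E).
  by apply: nnm_EFin; [exact: measurable_gauss | move=> w; exact: ltW (gauss_gt0 _ _)].
have e := integral_lebV_shift (- a) nf.
split; last by rewrite /Rintegral e.
have [mf f0] := nnm_shift (- a) nf.
apply/integrableP; split; first exact: mf.
rewrite [X in (X < _)%E](_ : _ = \int[leb]_w (gauss c (w - a))%:E)%E; last first.
  by apply: eq_integral => w _; rewrite /= ger0_norm// ltW// gauss_gt0.
by rewrite e; have [I I0 ->] := @integral_gauss R n c c0; rewrite ltry.
Qed.

Lemma Rintegral_gauss_gt0 (c : R) : 0 < c -> 0 < \int[leb]_w gauss c w.
Proof. by move=> c0; rewrite /Rintegral; have [I I0 ->] := @integral_gauss R n c c0. Qed.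

Lemma integrable_lin2 (f g : VB -> R) (a b : R) :
  leb.-integrable setT (EFin \o f) -> leb.-integrable setT (EFin \o g) ->
  leb.-integrable setT (EFin \o (fun w => a * f w + b * g w)).
Proof.
move=> hf hg.
have := @integrableD _ _ _ leb setT measurableT _ _ (integrableZl measurableT a hf)
  (integrableZl measurableT b hg).
by [].
Qed.

Lemma Rintegral_lin2 (f g : VB -> R) (a b : R) :
  leb.-integrable setT (EFin \o f) -> leb.-integrable setT (EFin \o g) ->
  \int[leb]_w (a * f w + b * g w) = a * \int[leb]_w f w + b * \int[leb]_w g w.
Proof.
move=> hf hg; rewrite RintegralD ?RintegralZl//.
- exact: (integrableZl measurableT a hf).
- exact: (integrableZl measurableT b hg).
Qed.

(** By translation invariance the constant [M] does not depend on the centre [a]. *)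
Lemma gauss_moment_bound (c : R) : 0 < c -> exists2 M : R, 0 < M &
  forall (h : VB -> R) (a : V) (K : R), 0 <= K -> leb.-integrable setT (EFin \o h) ->
  (forall w, `|h w| <= K * ((1 + `|w - a|) ^+ 2 * gauss c (w - a))) ->
  `|\int[leb]_w h w| <= K * M.
Proof.
move=> c0; have [k k0 hk] := @poly_gauss R n c 2 c0.
have c2 : 0 < c / 2 by rewrite divr_gt0.
exists (k * \int[leb]_w gauss (c / 2) w) => [|h a K K0 ih hh].
  by apply: mulr_gt0 => //; exact: Rintegral_gauss_gt0.
have [ig eg] := gauss_shift a c2.
apply: (le_trans (le_normr_Rintegral measurableT ih)).
rewrite mulrA -eg -(RintegralZl _ measurableT ig); apply: le_Rintegral => //.
- exact: (integrable_norm ih).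
- exact: (integrableZl measurableT (K * k) ig).
- move=> w _; apply: (le_trans (hh w)); rewrite -mulrA; exact: ler_wpM2l.
Qed.

Variables (phi0 phi1 : V -> R) (al C : R).
Hypothesis al0 : 0 < al.
Hypothesis C0 : 0 <= C.
Hypothesis sc0 : smooth_convex phi0 al C.
Hypothesis sc1 : smooth_convex phi1 al C.
Notation Phi := (joint_potential phi0 phi1).
Notation PhiG := (joint_grad phi0 phi1).
Notation dens := (dens phi0 phi1).
Implicit Types (t : R) (z w u : V).

(** Coercivity confines the search to a compact cube outside of which the potential exceeds its
    value at the origin. *)
Lemma Phi_min t z : exists ws, forall w, Phi t z ws <= Phi t z w.
Proof.
have [A hA] := Phi_lower al0 sc0 sc1.
(* Beyond [r >= 1] one has [|w| <= sqn w], and the second summand makes [al / 8 * |w| - A] at least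
   [Phi t z 0]. *)
pose r : R := 1 + `|8 / al * (A + Phi t z 0)|.
pose K := [set w : V | forall i, `[- r, r]%classic (w ord0 i)].
have r1 : 1 <= r by rewrite lerDl.
have cK : compact K.
  by apply: (@rV_compact _ _ (fun=> `[- r, r]%classic)) => i; exact: segment_compact.
have K00 : K 0 by move=> i /=; rewrite in_itv/= mxE; apply/andP; split; lra.
have cP : {within K, continuous (Phi t z)}.
  by apply: continuous_subspaceT; exact: (bicont_Phi sc0 sc1).2.
have [c _ hc] := EVT_min_rV (ex_intro _ _ K00) cK cP.
exists c => w; have [wr|wr] := leP `|w| r.
  apply: hc; rewrite inE => i /=; rewrite in_itv/= -ler_norml.
  exact: le_trans (norm_coord _ _) wr.
have h0 := hc 0 (mem_set K00); apply: (le_trans h0); apply: le_trans (hA t z w).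
have hr : 8 / al * (A + Phi t z 0) <= `|w|.
  by apply: le_trans (ltW wr); apply: (le_trans (ler_norm _)); rewrite lerDr.
have hw : `|w| <= sqn w.
  apply: le_trans (norm_sqr_le w); rewrite expr2 ler_peMr//.
  exact: le_trans r1 (ltW wr).
have := ler_wpM2l (ltW (divr_gt0 al0 (ltr0n _ 8))) (le_trans hr hw).
have -> : al / 8 * (8 / al * (A + Phi t z 0)) = A + Phi t z 0 by field; rewrite gt_eqF.
lra.
Qed.

Lemma sc_below (phi : V -> R) (x u : V) : smooth_convex phi al C ->
  phi x + \sum_k pds [:: k] phi x * u 0 k + al / 2 * sqn u <= phi (x + u).
Proof.
move=> [_ _ _ _ h]; have := h (x + u) x.
have -> : x + u - x = u by rewrite addrAC subrr add0r.
by rewrite enorm_sqr.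
Qed.

(** The derivative of [Phi t z] at [w] in the direction [u]. *)
Definition Dphi t z w u : R := \sum_k pds [:: k] phi0 (arg0 t z w) * (- t *: u) 0 k +
  \sum_k pds [:: k] phi1 (arg1 t z w) * ((1 - t) *: u) 0 k.

Lemma DphiZ t z w (s : R) u : Dphi t z w (s *: u) = s * Dphi t z w u.
Proof.
rewrite /Dphi mulrDr !mulr_sumr; congr (_ + _); apply: eq_bigr => k _; rewrite !mxE; ring.
Qed.

Lemma arg0D t z w u : arg0 t z (w + u) = arg0 t z w + - t *: u.
Proof. by rewrite /arg0 scalerDr opprD addrA scaleNr. Qed.

Lemma arg1D t z w u : arg1 t z (w + u) = arg1 t z w + (1 - t) *: u.
Proof. by rewrite /arg1 scalerDr addrA. Qed.

(** Moving [w] by [u] moves the two arguments by [- t u] and [(1 - t) u]. Since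
    [t ^ 2 + (1 - t) ^ 2 >= 1 / 2], strong convexity in [w] holds with a modulus that does not
    depend on [t]. *)
Lemma Phi_below t z w u : Phi t z w + Dphi t z w u + al / 4 * sqn u <= Phi t z (w + u).
Proof.
have := sc_below (arg0 t z w) (- t *: u) sc0; have := sc_below (arg1 t z w) ((1 - t) *: u) sc1.
rewrite -arg0D -arg1D !sqnZ /Phi /Dphi => h1 h0; have := lerD h0 h1.
have h : al / 4 * sqn u <= al / 2 * ((- t) ^+ 2 * sqn u) + al / 2 * ((1 - t) ^+ 2 * sqn u).
  have -> : al / 2 * ((- t) ^+ 2 * sqn u) + al / 2 * ((1 - t) ^+ 2 * sqn u) =
    al / 4 * sqn u + al * (t - 2^-1) ^+ 2 * sqn u by field.
  by rewrite lerDl; apply: mulr_ge0 (sqn_ge0 _); apply: mulr_ge0 (ltW al0) (sqr_ge0 _).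
move: h; set a := al / 4 * _; set b := al / 2 * _; set c := al / 2 * _.
set s0 := \sum_k _; set s1 := \sum_k _; lra.
Qed.

Definition growth t : R := n%:R ^+ 2 * C * (t ^+ 2 + (1 - t) ^+ 2).

Lemma growth_ge0 t : 0 <= growth t.
Proof. 
by apply: mulr_ge0; [apply: mulr_ge0 => //; exact: sqr_ge0 | rewrite addr_ge0 ?sqr_ge0]. Qed.

Lemma Phi_above t z w u :
  Phi t z (w + u) <= Phi t z w + Dphi t z w u + growth t * `|u| ^+ 2.
Proof.
have := sc_upper C0 sc0 (arg0 t z w) (- t *: u).
have := sc_upper C0 sc1 (arg1 t z w) ((1 - t) *: u).
rewrite -arg0D -arg1D !normrZ !exprMn !real_normK ?num_real// => h1 h0; have := lerD h0 h1.
rewrite /Dphi.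
have -> : growth t * `|u| ^+ 2 = n%:R ^+ 2 * C * ((- t) ^+ 2 * `|u| ^+ 2) +
   n%:R ^+ 2 * C * ((1 - t) ^+ 2 * `|u| ^+ 2) by rewrite /growth; ring.
set a := _ * ((- t) ^+ 2 * _); set b := _ * ((1 - t) ^+ 2 * _).
set s0 := \sum_k _; set s1 := \sum_k _; rewrite /Phi; lra.
Qed.

(** At a minimizer the linear term vanishes, and the convexity bounds on both sides become purely
    quadratic. *)
Lemma Phi_sandwich t z : exists ws, forall u,
  Phi t z ws + al / 4 * sqn u <= Phi t z (ws + u) <= Phi t z ws + growth t * `|u| ^+ 2.
Proof.
have [ws hws] := Phi_min t z; exists ws.
have D_ge0 u : 0 <= Dphi t z ws u.
  rewrite leNgt; apply/negP => D0.
  pose k := growth t * `|u| ^+ 2; have k0 : 0 <= k by rewrite mulr_ge0 ?growth_ge0 ?exprn_ge0.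
  (* A step short enough for the negative linear term to outweigh the quadratic one: [Dphi + s * k]
     is then [Dphi / (k + 1)], still negative. *)
  pose s := - Dphi t z ws u / (k + 1).
  have s0 : 0 < s by rewrite divr_gt0// ?oppr_gt0// ltr_wpDl.
  have := le_trans (hws (ws + s *: u)) (Phi_above t z ws (s *: u)).
  rewrite DphiZ normrZ (gtr0_norm s0) exprMn.
  have -> : growth t * (s ^+ 2 * `|u| ^+ 2) = s * (s * k) by rewrite /k; ring.
  rewrite -addrA lerDl -mulrDr pmulr_rge0// leNgt => /negP; apply.
  have -> : Dphi t z ws u + s * k = Dphi t z ws u / (k + 1).
    by rewrite /s; field; rewrite gt_eqF// ltr_wpDl.
  by rewrite ltr_pdivrMr ?mul0r// ltr_wpDl.
have D0 u : Dphi t z ws u = 0.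
  apply/eqP; rewrite eq_le D_ge0 andbT -oppr_ge0.
  by have := D_ge0 (- 1 *: u); rewrite DphiZ mulN1r.
move=> u; have := Phi_below t z ws u; have := Phi_above t z ws u.
by rewrite D0 addr0 => -> ->.
Qed.

Notation one := (fun _ : V => 1 : R).
Notation co i := (fun w : V => w 0 i).

Lemma bound_one w : `|(one w : R)| <= 1 + `|w|.
Proof. by rewrite normr1 lerDl. Qed.

Lemma bound_coord i w : `|co i w| <= 1 + `|w|.
Proof. by apply: (le_trans (norm_coord _ _)); rewrite lerDr. Qed.

Lemma continuous_one : continuous one.
Proof. by move=> x; exact: cst_continuous. Qed.

Lemma continuous_co i : continuous (co i).
Proof. exact: coord_continuous. Qed.

(** The density of the interpolant at time [t]. Below, [mom i] is the unnormalised conditional mean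
    of the [i]-th coordinate of the increment, and suffixes [1] and [2] mark derivatives in [z]. *)
Definition rho t z := A0 phi0 phi1 one t z.
Definition rho1 k t z := A1 phi0 phi1 one k t z.
Definition rho2 j k t z := A2 phi0 phi1 one j k t z.
Definition mom i t z := A0 phi0 phi1 (co i) t z.
Definition mom1 k i t z := A1 phi0 phi1 (co i) k t z.
Definition mom2 j k i t z := A2 phi0 phi1 (co i) j k t z.

Lemma norm_arg_diff t z w ws k : `|PhiG k t z w - PhiG k t z ws| <=
  n%:R * C * (`|t| + `|1 - t|) * `|w - ws|.
Proof.
have -> : PhiG k t z w - PhiG k t z ws =
  (pds [:: k] phi0 (arg0 t z w) - pds [:: k] phi0 (arg0 t z ws)) +
  (pds [:: k] phi1 (arg1 t z w) - pds [:: k] phi1 (arg1 t z ws)).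
  by rewrite /PhiG opprD addrACA.
apply: (le_trans (ler_normD _ _)); rewrite mulrDr mulrDl; apply: lerD.
  apply: (le_trans (sc_lipschitz sc0 _ _ _)).
  have -> : arg0 t z w - arg0 t z ws = - t *: (w - ws).
    have -> : arg0 t z w = arg0 t z ws + - t *: (w - ws) by rewrite -arg0D addrC subrK.
    by rewrite [LHS]addrAC subrr add0r.
  by rewrite normrZ normrN mulrA.
apply: (le_trans (sc_lipschitz sc1 _ _ _)).
have -> : arg1 t z w - arg1 t z ws = (1 - t) *: (w - ws).
  have -> : arg1 t z w = arg1 t z ws + (1 - t) *: (w - ws) by rewrite -arg1D addrC subrK.
  by rewrite [LHS]addrAC subrr add0r.
by rewrite normrZ mulrA.
Qed.

(** Both Gaussian exponents depend on [N] alone; [t] and [z] only affect the mode [ws] and the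
    height there. The constant [c] dominates [growth t] over [|t| <= N], with [1] added for
    positivity. *)
Lemma dens_sandwich (N : R) : exists2 c : R, 0 < c & forall t z, `|t| <= N ->
  exists ws, forall w, dens t z ws * gauss c (w - ws) <= dens t z w <=
    dens t z ws * gauss (al / 4) (w - ws).
Proof.
pose c := n%:R ^+ 2 * C * (`|N| ^+ 2 + (1 + `|N|) ^+ 2) + 1.
have c0 : 0 < c.
  rewrite ltr_wpDl//; apply: mulr_ge0; last by rewrite addr_ge0 ?sqr_ge0.
  by apply: mulr_ge0 => //; exact: sqr_ge0.
exists c => // t z tN; have [ws hws] := Phi_sandwich t z; exists ws => w.
have := hws (w - ws); rewrite (addrC ws) subrK => /andP[h1 h2].
rewrite /dens -!expRD !ler_expR; apply/andP; split; last by lra.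
have hc : growth t * `|w - ws| ^+ 2 <= c * sqn (w - ws).
  apply: ler_pM; rewrite ?growth_ge0 ?exprn_ge0 ?norm_sqr_le//.
  rewrite /growth /c -[leLHS]addr0 lerD// ler_wpM2l ?mulr_ge0 ?exprn_ge0//.
  have tN' : `|t| <= `|N| by apply: (le_trans tN); exact: ler_norm.
  rewrite -[t ^+ 2]real_normK ?num_real// -[(1 - t) ^+ 2]real_normK ?num_real//.
  apply: lerD; apply: lerXn2r; rewrite ?nnegrE ?addr_ge0//.
  by apply: (le_trans (ler_normB _ _)); rewrite normr1 lerD2l.
lra.
Qed.

Lemma al16 : 0 < al / 16. Proof. by rewrite divr_gt0. Qed.

Lemma rho_gt0 t z : 0 < rho t z.
Proof.
have [c c0 /(_ t z (lexx _))[ws hws]] := dens_sandwich `|t|.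
have [ig eg] := gauss_shift ws c0.
have : 0 < dens t z ws * \int[leb]_w gauss c w.
  by rewrite mulr_gt0 ?dens_gt0 ?Rintegral_gauss_gt0.
move=> /lt_le_trans; apply; rewrite -eg -(RintegralZl _ measurableT ig); apply: le_Rintegral => //.
- exact: (integrableZl measurableT _ ig).
- exact: (gparam_integrable al16 t z (gparam_A0 al0 sc0 sc1 continuous_one bound_one)).
- by move=> w _; rewrite /A0f mul1r; have /andP[] := hws w.
Qed.

(* The left-hand side is minus [rho ^ 2] times the covariance of [w_i] and the
   [k]-th partial of the joint potential; both factors are centred at the
   minimizer [ws], around which the density lies between two Gaussians. *)
Lemma covariance_bound (N : R) : exists2 L : R, 0 <= L & forall k i t z, `|t| <= N ->
  `|mom1 k i t z * rho t z - mom i t z * rho1 k t z| <= L * rho t z ^+ 2.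
Proof.
have [c c0 hc] := dens_sandwich N.
have a4 : 0 < al / 4 by rewrite divr_gt0.
have [M M0 hM] := gauss_moment_bound a4.
pose B : R := \int[leb]_w gauss c w; have B0 : 0 < B by exact: Rintegral_gauss_gt0.
(* Lipschitz constant of the joint gradient in [w], from [|t| + |1 - t| <= 2 |N| + 1]. *)
pose L := n%:R * C * (2 * `|N| + 1).
have L0 : 0 <= L by rewrite !mulr_ge0// addr_ge0.
(* The unknown height at the mode cancels: centred moments are at most a constant times height times
   [M], while the mass [rho] is at least height times [B]. *)
exists (L * (M / B) + L * (M / B) ^+ 2) => [|k i t z tN].
  by apply: addr_ge0; apply: mulr_ge0 => //; rewrite ?sqr_ge0// divr_ge0// ltW.
have [ws hws] := hc t z tN; pose I := dens t z ws.
have I0 : 0 < I by exact: dens_gt0.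
have iX := gparam_integrable al16 t z (gparam_A1 al0 C0 sc0 sc1 (@continuous_co i) (bound_coord i) k).
have iM := gparam_integrable al16 t z (gparam_A0 al0 sc0 sc1 (@continuous_co i) (bound_coord i)).
have iY := gparam_integrable al16 t z (gparam_A1 al0 C0 sc0 sc1 continuous_one bound_one k).
have iD := gparam_integrable al16 t z (gparam_A0 al0 sc0 sc1 continuous_one bound_one).
have rhoB : I * B <= rho t z.
  have [ig eg] := gauss_shift ws c0.
  rewrite /B -eg -(RintegralZl _ measurableT ig); apply: le_Rintegral => //.
    exact: (integrableZl measurableT _ ig).
  by move=> w _; rewrite /A0f mul1r; have /andP[] := hws w.
pose ai := ws 0 i; pose bk := PhiG k t z ws.
have ha w : `|w 0 i - ai| <= `|w - ws|.
  by have := norm_coord (w - ws) i; rewrite !mxE.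
have hb w : `|PhiG k t z w - bk| <= L * `|w - ws|.
  apply: (le_trans (norm_arg_diff _ _ _ _ _)); rewrite ler_wpM2r// ler_wpM2l ?mulr_ge0//.
  have := ler_normB 1 t; rewrite normr1; have := le_trans tN (ler_norm _); lra.
have hd w : 0 <= dens t z w <= I * gauss (al / 4) (w - ws).
  by rewrite (ltW (dens_gt0 _ _ _ _ _)); have /andP[] := hws w.
have wt (b : R) w (K : R) : 0 <= K -> `|b| <= K * (1 + `|w - ws|) ^+ 2 ->
    `|b * dens t z w| <= K * I * ((1 + `|w - ws|) ^+ 2 * gauss (al / 4) (w - ws)).
  move=> K0 hbw; have /andP[d0 d1] := hd w; rewrite normrM (ger0_norm d0).
  have -> : K * I * ((1 + `|w - ws|) ^+ 2 * gauss (al / 4) (w - ws)) =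
     K * (1 + `|w - ws|) ^+ 2 * (I * gauss (al / 4) (w - ws)) by ring.
  exact: ler_pM.
have le1 (x : R) : 0 <= x -> x <= (1 + x) ^+ 2 by move=> x0; nra.
have le2 (x : R) : 0 <= x -> x ^+ 2 <= (1 + x) ^+ 2 by move=> x0; nra.
have ip := integrable_lin2 1 (- ai) iM iD; have ep := Rintegral_lin2 1 (- ai) iM iD.
have iq := integrable_lin2 (- 1) (- bk) iY iD; have eq := Rintegral_lin2 (- 1) (- bk) iY iD.
have i1 := integrable_lin2 (- 1) (- bk) iX iM; have e1 := Rintegral_lin2 (- 1) (- bk) iX iM.
have i2 := integrable_lin2 ai (ai * bk) iY iD; have e2 := Rintegral_lin2 ai (ai * bk) iY iD.
have iP := integrable_lin2 1 1 i1 i2; have eP := Rintegral_lin2 1 1 i1 i2.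
have hp := hM _ ws (1 * I) _ ip; have hq := hM _ ws (L * I) _ iq.
have hP := hM _ ws (L * I) _ iP.
have {}hp : `|mom i t z - ai * rho t z| <= I * M.
  rewrite -(mul1r I) /mom /rho /A0 /pint -[X in X - _]mul1r -mulNr -ep.
  apply: hp => [|w]; first by rewrite mul1r ltW.
  have -> : 1 * A0f phi0 phi1 (co i) t z w + - ai * A0f phi0 phi1 one t z w =
     (w 0 i - ai) * dens t z w by rewrite /A0f; ring.
  by apply: wt => //; rewrite mul1r; apply: (le_trans (ha w)); exact: le1.
have {}hq : `|- rho1 k t z - bk * rho t z| <= L * I * M.
  rewrite /rho1 /rho /A0 /A1 /pint -mulN1r -[X in _ + X]mulNr -eq.
  apply: hq => [|w]; first by rewrite mulr_ge0// ltW.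
  have -> : -1 * A1f phi0 phi1 one k t z w + - bk * A0f phi0 phi1 one t z w =
     (PhiG k t z w - bk) * dens t z w by rewrite /A0f /A1f; ring.
  by apply: wt => //; apply: (le_trans (hb w)); apply: ler_wpM2l => //; exact: le1.
have {}hP : `|- mom1 k i t z - bk * mom i t z + ai * rho1 k t z + ai * bk * rho t z| <= L * I * M.
  have -> : - mom1 k i t z - bk * mom i t z + ai * rho1 k t z + ai * bk * rho t z =
    1 * (-1 * mom1 k i t z + - bk * mom i t z) + 1 * (ai * rho1 k t z + ai * bk * rho t z) by ring.
  rewrite /mom1 /mom /rho1 /rho /A0 /A1 /pint -e1 -e2 -eP.
  apply: hP => [|w]; first by rewrite mulr_ge0// ltW.
  rewrite [X in `|X|](_ : _ = ((w 0 i - ai) * (PhiG k t z w - bk)) * dens t z w); last first.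
    by rewrite /A0f /A1f; ring.
  apply: wt => //; rewrite normrM; apply: (@le_trans _ _ (`|w - ws| * (L * `|w - ws|))).
    by apply: ler_pM.
  by rewrite mulrCA -expr2; apply: ler_wpM2l => //; exact: le2.
move: hp hq hP rhoB.
set m := mom i t z; set X := mom1 k i t z; set Y := rho1 k t z; set r := rho t z.
set P := - X - bk * m + ai * Y + ai * bk * r; set p := m - ai * r; set q := - Y - bk * r.
move=> hp hq hP rB.
(* Here [p], [q] and [P] are the integrals against the density of the first centred factor, the
   second, and their product; centring does not change a covariance. *)
have -> : X * r - m * Y = p * q - P * r by rewrite /p /q /P; ring.
have r0 : 0 < r by exact: rho_gt0.
have hI : I * M <= (M / B) * r.
  have -> : I * M = (M / B) * (I * B) by field; rewrite gt_eqF.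
  by apply: ler_wpM2l => //; rewrite divr_ge0 ?ltW.
have hp' := le_trans hp hI.
have hLI : L * I * M <= L * ((M / B) * r) by rewrite -mulrA; apply: ler_wpM2l.
have hq' := le_trans hq hLI; have hP' := le_trans hP hLI.
apply: (le_trans (ler_normB _ _)); rewrite !normrM (gtr0_norm r0) mulrDl addrC.
have -> : L * (M / B) * r ^+ 2 = (L * ((M / B) * r)) * r by ring.
have -> : L * (M / B) ^+ 2 * r ^+ 2 = ((M / B) * r) * (L * ((M / B) * r)) by ring.
by apply: lerD; [exact: ler_wpM2r (ltW r0) _ _ hP' | exact: ler_pM].
Qed.

Notation iv t z := ((rho t z)^-1).
Definition vel t z : V := \row_i (mom i t z * iv t z).
Definition vel1 k i t z := mom1 k i t z * iv t z + mom i t z * (- (iv t z * iv t z) * rho1 k t z).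
Definition vel2 j k i t z :=
  (mom2 j k i t z * iv t z + mom1 k i t z * (- (iv t z * iv t z) * rho1 j t z)) +
  (mom1 j i t z * (- (iv t z * iv t z) * rho1 k t z) +
   mom i t z * (- (2 * iv t z * (- (iv t z * iv t z) * rho1 j t z)) * rho1 k t z
                + - (iv t z * iv t z) * rho2 j k t z)).

Lemma is_derive_rho k t z : is_derive z (E k) (rho t) (rho1 k t z).
Proof. exact: (is_derive_A0 al0 C0 sc0 sc1 continuous_one bound_one). Qed.

Lemma is_derive_rho1 j k t z : is_derive z (E j) (rho1 k t) (rho2 j k t z).
Proof. exact: (is_derive_A1 al0 C0 sc0 sc1 continuous_one bound_one). Qed.

Lemma is_derive_mom k i t z : is_derive z (E k) (mom i t) (mom1 k i t z).
Proof. exact: (is_derive_A0 al0 C0 sc0 sc1 (@continuous_co i) (bound_coord i)). Qed.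

Lemma is_derive_mom1 j k i t z : is_derive z (E j) (mom1 k i t) (mom2 j k i t z).
Proof. exact: (is_derive_A1 al0 C0 sc0 sc1 (@continuous_co i) (bound_coord i)). Qed.

Lemma is_derive_u k t z :
  is_derive z (E k) (fun z => iv t z) (- (iv t z * iv t z) * rho1 k t z).
Proof.
apply: (is_derive_comp1 (g := fun x : R => x^-1)); last exact: is_derive_rho.
have r0 : rho t z != 0 by rewrite gt_eqF// rho_gt0.
have := @is_deriveV R id (rho t z) 1 1 r0 (is_derive_id _ _).
by rewrite [_ *: 1]mulr1 expr2 -invfM.
Qed.

Lemma is_derive_vel t z k i : is_derive z (E k) (fun z => vel t z 0 i) (vel1 k i t z).
Proof.
apply: (@is_derive_ext _ _ (fun z => mom i t z * iv t z)) => [y|]; first by rewrite mxE.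
rewrite /vel1 addrC; have := is_derM (is_derive_mom k i t z) (is_derive_u k t z).
by congr is_derive; ring.
Qed.

Lemma is_derive_vel1 t z j k i : is_derive z (E j) (vel1 k i t) (vel2 j k i t z).
Proof.
have h1 := is_derM (is_derive_mom1 j k i t z) (is_derive_u j t z).
have h2 := is_derN (is_derM (is_derive_u j t z) (is_derive_u j t z)).
have h3 := is_derM (is_derive_mom j i t z) (is_derM h2 (is_derive_rho1 j k t z)).
have h := is_derD h1 h3; apply: (is_derive_eq h); rewrite /vel2.
move: (mom2 j k i t z) (mom1 k i t z) (mom1 j i t z) (mom i t z) => a b c m.
move: (rho1 j t z) (rho1 k t z) (rho2 j k t z) (iv t z) => r s q w.
ring.
Qed.

Lemma jcontM (f g : R -> V -> R) : jcont f -> jcont g -> jcont (fun t z => f t z * g t z).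
Proof.
move=> cf cg p.
exact: (@continuousM R (R * V)%type (fun p => f p.1 p.2) (fun p => g p.1 p.2) p (cf p) (cg p)).
Qed.

Lemma jcontD (f g : R -> V -> R) : jcont f -> jcont g -> jcont (fun t z => f t z + g t z).
Proof.
move=> cf cg p.
exact: (@continuousD R R (R * V)%type (fun p => f p.1 p.2) (fun p => g p.1 p.2) p (cf p) (cg p)).
Qed.

Lemma jcontN (f : R -> V -> R) : jcont f -> jcont (fun t z => - f t z).
Proof.
by move=> cf p; exact: (@continuousN R R (R * V)%type (fun p => f p.1 p.2) p (cf p)).
Qed.

Lemma jcont_cst (c : R) : jcont (fun (_ : R) (_ : V) => c).
Proof. by move=> p; exact: cst_continuous. Qed.

Lemma jcont_rho : jcont rho.
Proof. exact: (jcont_A0 al0 sc0 sc1 continuous_one bound_one). Qed.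

Lemma jcont_rho1 k : jcont (rho1 k).
Proof. exact: (jcont_A1 al0 C0 sc0 sc1 continuous_one bound_one). Qed.

Lemma jcont_rho2 j k : jcont (rho2 j k).
Proof. exact: (jcont_A2 al0 C0 sc0 sc1 continuous_one bound_one). Qed.

Lemma jcont_mom i : jcont (mom i).
Proof. exact: (jcont_A0 al0 sc0 sc1 (@continuous_co i) (bound_coord i)). Qed.

Lemma jcont_mom1 k i : jcont (mom1 k i).
Proof. exact: (jcont_A1 al0 C0 sc0 sc1 (@continuous_co i) (bound_coord i)). Qed.

Lemma jcont_mom2 j k i : jcont (mom2 j k i).
Proof. exact: (jcont_A2 al0 C0 sc0 sc1 (@continuous_co i) (bound_coord i)). Qed.

Lemma jcont_u : jcont (fun t z => iv t z).
Proof.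
move=> p; apply: (@continuousV R (R * V)%type (fun p => rho p.1 p.2)); last exact: jcont_rho.
by rewrite gt_eqF// rho_gt0.
Qed.

Lemma jcont_vel : jcont vel.
Proof.
move=> p; apply/continuous_coordP => i.
have -> : (fun p : R * V => vel p.1 p.2 0 i) = (fun p => mom i p.1 p.2 * iv p.1 p.2).
  by apply/funext => q; rewrite mxE.
by have := @jcontM (mom i) (fun t z => iv t z) (@jcont_mom i) jcont_u; exact.
Qed.

Lemma jcont_vel1 k i : jcont (vel1 k i).
Proof.
have cu := jcont_u; have cm := @jcont_mom i; have cm1 := @jcont_mom1 k i.
have cr1 := @jcont_rho1 k.
apply: jcontD; first exact: jcontM.
by apply: jcontM => //; apply: jcontM => //; apply: jcontN; exact: jcontM.
Qed.

Lemma jcont_vel2 j k i : jcont (vel2 j k i).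
Proof.
have cu := jcont_u; have cm := @jcont_mom i; have cm1 := @jcont_mom1 k i.
have cm1' := @jcont_mom1 j i; have cm2 := @jcont_mom2 j k i.
have cr1 := @jcont_rho1 k; have cr1' := @jcont_rho1 j; have cr2 := @jcont_rho2 j k.
have cuu : jcont (fun t z => - (iv t z * iv t z)) by apply: jcontN; exact: jcontM.
have cj : jcont (fun t z => - (iv t z * iv t z) * rho1 j t z) by exact: jcontM.
have ck : jcont (fun t z => - (iv t z * iv t z) * rho1 k t z) by exact: jcontM.
exact: (jcontD (jcontD (jcontM cm2 cu) (jcontM cm1 cj)) (jcontD (jcontM cm1' ck)
  (jcontM cm (jcontD (jcontM (jcontN (jcontM (jcontM (@jcont_cst 2) cu) cj)) cr1)
    (jcontM cuu cr2))))).
Qed.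

Lemma vel1_bound (N : R) : exists2 L : R, 0 <= L &
  forall k i t z, `|t| <= N -> `|vel1 k i t z| <= L.
Proof.
have [L L0 hL] := covariance_bound N; exists L => // k i t z tN.
have r0 := rho_gt0 t z.
have -> : vel1 k i t z =
    (mom1 k i t z * rho t z - mom i t z * rho1 k t z) / rho t z ^+ 2.
  by rewrite /vel1; field; rewrite gt_eqF.
rewrite normrM normfV (ger0_norm (sqr_ge0 _)) ler_pdivrMr ?exprn_gt0//.
exact: hL.
Qed.

End Velocity.

(** * Laws and conditional expectations *)

Section Laws.
Context {R : realType} {n : nat}.
Notation V := 'rV[R]_n.
Notation VB := (g_sigma_algebraType (@open V)).
Notation leb := (@lebV R n).
Context {dO : measure_display} {Om : measurableType dO} (P : probability Om R).

Lemma random_vectorP (X : Om -> V) :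
  random_vector X -> measurable_fun setT (X : Om -> VB).
Proof. by move=> hX _ B mB; rewrite setTI; exact: hX. Qed.

Lemma nnm_mulEFin d (U : measurableType d) (f : U -> \bar R) (p : U -> R) :
  nnm f -> measurable_fun setT p -> (forall x, 0 <= p x) -> nnm (fun x => (f x * (p x)%:E)%E).
Proof.
move=> [mf f0] mp p0; split; last by move=> x; rewrite mule_ge0// lee_fin.
by apply: emeasurable_funM => //; apply/measurable_EFinP.
Qed.

Section OneLaw.
Variables (X : Om -> V) (p : V -> R).
Hypothesis mX : measurable_fun setT (X : Om -> VB).
Hypothesis dX : has_density P X p.
Hypothesis mp : measurable_fun [set: VB] p.
Hypothesis p0 : forall x, 0 <= p x.

Definition law : {mfun Om >-> VB} := mfun_Sub (mem_set mX).

Lemma integral_law (h : VB -> \bar R) : nnm h ->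
  (\int[distribution P law]_x h x = \int[leb]_x (h x * (p x)%:E))%E.
Proof.
move=> nh; apply: (@integral_functional _ _ _ (distribution P law)
  (fun h => \int[leb]_x (h x * (p x)%:E))%E) => //.
- move=> A mA; transitivity (P (X @^-1` A)); last by [].
  rewrite (dX mA) integral_lebV; last exact: (@nnm_mulEFin _ VB _ _ (nnm_indic mA) mp p0).
  by congr intRd; apply/funext => x; rewrite -EFinM mulrC.
- move=> r f r0 nf; under eq_integral do rewrite -muleA.
  have nn := @nnm_mulEFin _ VB _ _ nf mp p0.
  by rewrite ge0_integralZl_EFin//; [move=> x _; exact: nn.2 | exact: nn.1].
- move=> f g nf ng.
  have n1 := @nnm_mulEFin _ VB _ _ nf mp p0; have n2 := @nnm_mulEFin _ VB _ _ ng mp p0.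
  rewrite -ge0_integralD//; first last.
  + exact: n2.1.
  + by move=> x _; exact: n2.2.
  + exact: n1.1.
  + by move=> x _; exact: n1.2.
  by apply: eq_integral => x _; rewrite ge0_muleDl//; [exact: nf.2 | exact: ng.2].
- move=> g f ng nf ndg cg.
  have nn k := @nnm_mulEFin _ VB _ _ (ng k) mp p0.
  rewrite (_ : \int[leb]_x (f x * (p x)%:E) = \int[leb]_x lim ((g k x * (p x)%:E) @[k --> \oo]))%E; last first.
    apply: eq_integral => x _; apply/esym/cvg_lim => //.
    by apply: cvgeZr => //; exact: cg.
  apply: cvg_monotone_convergence => //.
  + by move=> k; exact: (nn k).1.
  + by move=> k x _; exact: (nn k).2.
  + by move=> x _ k l kl; apply: lee_wpmul2r; [rewrite lee_fin | exact: ndg].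
Qed.

Lemma integral_density (h : VB -> \bar R) : nnm h ->
  (\int[P]_w h (X w) = \int[leb]_x (h x * (p x)%:E))%E.
Proof.
move=> nh; rewrite -integral_law//.
by rewrite (@ge0_integral_distribution _ _ _ _ _ P law h nh.1 nh.2).
Qed.

End OneLaw.

Section TwoLaws.
Variables (X0 X1 : Om -> V) (p0 p1 : V -> R).
Hypothesis mX0 : measurable_fun setT (X0 : Om -> VB).
Hypothesis mX1 : measurable_fun setT (X1 : Om -> VB).
Hypothesis d0 : has_density P X0 p0.
Hypothesis d1 : has_density P X1 p1.
Hypothesis mp0 : measurable_fun [set: VB] p0.
Hypothesis mp1 : measurable_fun [set: VB] p1.
Hypothesis p00 : forall x, 0 <= p0 x.
Hypothesis p10 : forall x, 0 <= p1 x.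
Hypothesis ind : indep_vec P X0 X1.

(** Independence identifies the law of the pair with the product of the laws on rectangles, hence
    everywhere; Tonelli then brings in the two densities. *)
Lemma integral_joint (f : VB * VB -> \bar R) : nnm f ->
  (\int[P]_w f (X0 w, X1 w) =
   \int[leb]_x \int[leb]_y (f (x, y) * (p1 y)%:E * (p0 x)%:E))%E.
Proof.
move=> nf; have [mf f0] := nf.
have mZ : measurable_fun setT (fun w => (X0 w : VB, X1 w : VB)) by exact: measurable_fun_pair.
pose Z : {mfun Om >-> (VB * VB)%type} := mfun_Sub (mem_set mZ).
rewrite -(@ge0_integral_distribution _ _ _ _ _ P Z f mf f0).
rewrite -(@eq_measure_integral _ _ _ setT _ (distribution P (law mX0) \x distribution P (law mX1))%E).
  rewrite fubini_tonelli1// /fubini_F.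
  have nf1 x : nnm (fun y : VB => f (x, y) : \bar R).
    by split => //; exact: (measurableT_comp mf (measurable_pair1 _)).
  have nF : nnm (fun x : VB => \int[distribution P (law mX1)]_y f (x, y))%E.
    split; last by move=> x; exact: integral_ge0.
    exact: measurable_fun_fubini_tonelli_F.
  rewrite (integral_law mX0 d0 mp0 p00 nF); apply: eq_integral => x _.
  rewrite (integral_law mX1 d1 mp1 p10 (nf1 x)) muleC -ge0_integralZl_EFin//; first last.
  - by move: (@nnm_mulEFin _ VB _ _ (nf1 x) mp1 p10) => [].
  - by move=> y _; move: (@nnm_mulEFin _ VB _ _ (nf1 x) mp1 p10) => [].
  by apply: eq_integral => y _; rewrite muleC.
by move=> A mA _; apply: product_measure_unique => // B C mB mC; exact: ind.
Qed.

(** Passing from [(X0, X1)] to interpolant and increment is the linear change of variables of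
    [integral_shear], which preserves Lebesgue measure. *)
Lemma integral_interp (t : R) (g h : V -> \bar R) : nnm (g : VB -> \bar R) ->
  nnm (h : VB -> \bar R) ->
  (\int[P]_w (g ((1 - t) *: X0 w + t *: X1 w)%R * h (X1 w - X0 w)%R) =
   \int[leb]_z (g z * \int[leb]_w (h w * (p0 (arg0 t z w) * p1 (arg1 t z w))%:E)))%E.
Proof.
move=> ng nh.
pose F (q : VB * VB) : \bar R := (g ((1 - t) *: q.1 + t *: q.2)%R * h (q.2 - q.1)%R)%E.
have m1 : measurable_fun setT (fst : VB * VB -> VB) by exact: measurable_fst.
have m2 : measurable_fun setT (snd : VB * VB -> VB) by exact: measurable_snd.
have m0 : measurable_fun setT (fun _ : VB * VB => 0 : VB) by [].
have mi : measurable_fun setT (fun q : VB * VB => (1 - t) *: q.1 + t *: q.2 : VB).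
  apply: measurable_scale_add => //.
  rewrite (_ : (fun x => _) = (fun q : VB * VB => 0 + (1 - t) *: q.1)); last first.
    by apply/funext => q; rewrite add0r.
  exact: measurable_scale_add.
have md : measurable_fun setT (fun q : VB * VB => q.2 - q.1 : VB).
  rewrite (_ : (fun x => _) = (fun q : VB * VB => q.2 + (-1) *: q.1)); last first.
    by apply/funext => q; rewrite scaleN1r.
  exact: measurable_scale_add.
have mgi := measurableT_comp ng.1 mi; have mhd := measurableT_comp nh.1 md.
have nF : nnm F.
  split; last by move=> q; rewrite mule_ge0 ?ng.2 ?nh.2.
  exact: emeasurable_funM.
rewrite (integral_joint nF).
pose G (q : VB * VB) : \bar R := (F q * (p1 q.2)%:E * (p0 q.1)%:E)%E.
have nG : nnm G.
  apply: (@nnm_mulEFin _ _ (fun q => F q * (p1 q.2)%:E)%E (fun q => p0 q.1)) => //.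
    apply: (@nnm_mulEFin _ _ F (fun q => p1 q.2)) => //.
    exact: (measurableT_comp mp1 m2).
  exact: (measurableT_comp mp0 m1).
rewrite (integral_shear t nG); apply: eq_integral => z _.
have ez w : (1 - t) *: (z - t *: w) + t *: (z + (1 - t) *: w) = z.
  by apply/rowP => i; rewrite !mxE; ring.
have ew w : (z + (1 - t) *: w) - (z - t *: w) = w.
  by apply/rowP => i; rewrite !mxE; ring.
have np : nnm (fun w : VB => h w * (p0 (arg0 t z w) * p1 (arg1 t z w))%:E)%E.
  have nGz : measurable_fun setT (fun w : VB => p0 (arg0 t z w) * p1 (arg1 t z w)).
    have ma0 : measurable_fun setT (fun w : VB => arg0 t z w : VB).
      rewrite (_ : (fun w => _) = (fun w : VB => z + (- t) *: w)); last first.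
        by apply/funext => w; rewrite /arg0 scaleNr.
      exact: measurable_scale_add.
    have ma1 : measurable_fun setT (fun w : VB => arg1 t z w : VB).
      exact: measurable_scale_add.
    by apply: measurable_funM; [exact: (measurableT_comp mp0 ma0) | exact: (measurableT_comp mp1 ma1)].
  by apply: (@nnm_mulEFin _ VB) => // w; rewrite mulr_ge0.
rewrite -ge0_integralZl//; first last.
- exact: ng.2.
- by move=> w _; exact: np.2.
- exact: np.1.
apply: eq_integral => w _; rewrite /G /F/= ez ew -!muleA; congr (_ * (_ * _))%E.
by rewrite -EFinM mulrC.
Qed.

End TwoLaws.
End Laws.

Section BoundedMultiplier.
Context {R : realType} {dO : measure_display} {Om : measurableType dO} (P : probability Om R).

Lemma integrable_mul_bounded (f g : Om -> R) (K : R) : measurable_fun setT g ->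
  (forall w, `|g w| <= K) -> P.-integrable setT (EFin \o f) ->
  P.-integrable setT (EFin \o (fun w => g w * f w)).
Proof.
move=> mg gK hf; have mf : measurable_fun setT f.
  by apply/measurable_EFinP; exact: (measurable_int P hf).
have hK := integrableZl measurableT K hf.
apply: (le_integrable measurableT _ _ hK); first by apply/measurable_EFinP; exact: measurable_funM.
move=> w _; rewrite lee_fin !normrM; apply: ler_wpM2r => //.
exact: le_trans (gK w) (ler_norm _).
Qed.

Lemma integrable_dominated (f g : Om -> R) : measurable_fun setT f ->
  (forall w, `|f w| <= g w) -> P.-integrable setT (EFin \o g) ->
  P.-integrable setT (EFin \o f).
Proof.
move=> mf fg hg; apply: (le_integrable measurableT _ _ hg); first by apply/measurable_EFinP.
by move=> w _; rewrite lee_fin; apply: (le_trans (fg w)); exact: ler_norm.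
Qed.

Lemma integrable_EFinD (f g : Om -> R) : P.-integrable setT (EFin \o f) ->
  P.-integrable setT (EFin \o g) -> P.-integrable setT (EFin \o (fun w => f w + g w)).
Proof. by move=> hf hg; have := integrableD measurableT hf hg. Qed.

Lemma integrable_EFinZ (f : Om -> R) (K : R) : P.-integrable setT (EFin \o f) ->
  P.-integrable setT (EFin \o (fun w => K * f w)).
Proof. by move=> hf; have := integrableZl measurableT K hf. Qed.

Lemma integral_preimage (f : Om -> R) (A : set Om) : measurable A ->
  P.-integrable setT (EFin \o f) ->
  (\int[P]_(w in A) (f w)%:E = (\int[P]_w (\1_A w * f w))%:E)%E.
Proof.
move=> mA hf; rewrite integral_mkcond epatch_indic /Rintegral fineK.
  by apply: eq_integral => w _; rewrite /= -EFinM mulrC.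
apply: integrable_fin_num => //.
apply: (@integrable_mul_bounded f (\1_A) 1) => //.
by move=> w; rewrite indicE; case: (_ \in _); rewrite ?normr1 ?normr0.
Qed.

End BoundedMultiplier.

(** * Conditional expectation of the increment given the interpolant *)

Section Interpolation.
Context {R : realType} {n : nat}.
Notation V := 'rV[R]_n.
Notation VB := (g_sigma_algebraType (@open V)).
Notation leb := (@lebV R n).
Context {dO : measure_display} {Om : measurableType dO} (P : probability Om R).
Variables (phi0 phi1 : V -> R) (al C : R).
Hypothesis al0 : 0 < al.
Hypothesis C0 : 0 <= C.
Hypothesis sc0 : smooth_convex phi0 al C.
Hypothesis sc1 : smooth_convex phi1 al C.
Variables (X0 X1 : Om -> V).
Hypothesis mX0 : measurable_fun setT (X0 : Om -> VB).
Hypothesis mX1 : measurable_fun setT (X1 : Om -> VB).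
Hypothesis d0 : has_density P X0 (fun x => expR (- phi0 x)).
Hypothesis d1 : has_density P X1 (fun x => expR (- phi1 x)).
Hypothesis ind : indep_vec P X0 X1.
Notation rho := (rho phi0 phi1).
Notation vel := (vel phi0 phi1).
Notation dens := (dens phi0 phi1).

Definition interpolant (t : R) w : V := (1 - t) *: X0 w + t *: X1 w.
Definition increment w : V := X1 w - X0 w.

Lemma measurable_expRN (phi : V -> R) : smooth_convex phi al C ->
  measurable_fun [set: VB] (fun x => expR (- phi x)).
Proof.
move=> sc; apply: continuous_measurable_rV => x.
apply: (@continuous_comp _ _ _ (fun x => - phi x) (@expR R)); last exact: continuous_expR.
by apply: (@continuousN R R V phi); exact: sc_continuous0 sc x.
Qed.

Lemma measurable_normV : measurable_fun [set: VB] (fun x : V => `|x|).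
Proof. by apply: continuous_measurable_rV => x; exact: norm_continuous. Qed.

Lemma measurable_interp t : measurable_fun setT (interpolant t : Om -> VB).
Proof.
apply: measurable_scale_add => //.
rewrite (_ : (fun x => _) = (fun w => 0 + (1 - t) *: X0 w)); last first.
  by apply/funext => w; rewrite add0r.
exact: measurable_scale_add.
Qed.

Lemma measurable_incrX : measurable_fun setT (increment : Om -> VB).
Proof.
rewrite (_ : increment = (fun w => X1 w + (-1) *: X0 w)); last first.
  by apply/funext => w; rewrite scaleN1r.
exact: measurable_scale_add.
Qed.

Lemma integrable_norm_law (phi : V -> R) (X : Om -> V) : smooth_convex phi al C ->
  measurable_fun setT (X : Om -> VB) -> has_density P X (fun x => expR (- phi x)) ->
  P.-integrable setT (EFin \o (fun w => 1 + `|X w|)).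
Proof.
move=> sc mX dX; have [A hA] := sc_lower al0 sc.
have a4 : 0 < al / 4 by rewrite divr_gt0.
have [K K0 hK] := @poly_gauss R n (al / 4) 1 a4.
have mN : measurable_fun [set: VB] (fun x : V => 1 + `|x|).
  by apply: measurable_funD => //; exact: measurable_normV.
have nN : nnm (fun x : VB => (1 + `|x|)%:E : \bar R).
  by apply: nnm_EFin => // x; rewrite addr_ge0.
apply/integrableP; split; first by apply/measurable_EFinP; exact: (measurableT_comp mN mX).
rewrite [X in (X < _)%E](_ : _ = \int[P]_w ((1 + `|X w|)%:E))%E; last first.
  by apply: eq_integral => w _; rewrite /= ger0_norm// addr_ge0.
rewrite (integral_density mX dX (measurable_expRN sc) (fun x => expR_ge0 _) nN).
have ig := @integrableZl _ _ _ leb setT measurableT (expR A * K) _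
  (@integrable_gauss R n (al / 4 / 2) (divr_gt0 a4 (ltr0n _ 2))).
apply: le_lt_trans (integrable_lty measurableT ig); apply: ge0_le_integral => //.
- exact: (nnm_mulEFin nN (measurable_expRN sc) (fun x => expR_ge0 _)).1.
- exact: (measurable_int leb ig).
move=> x _; rewrite -!EFinM lee_fin; have := hK x; rewrite expr1 => h.
apply: (@le_trans _ _ (expR A * ((1 + `|x|) * gauss (al / 4) x))).
  rewrite mulrCA; apply: ler_wpM2l; first by rewrite addr_ge0.
  by rewrite -expRD ler_expR; have := hA x; lra.
by rewrite -(mulrA (expR A)); apply: ler_wpM2l => //; exact: expR_ge0.
Qed.

(** One integrable envelope, at least [1], controlling both the increment and the interpolant at
    every time. *)
Definition size_bound w : R := 2 + `|X0 w| + `|X1 w|.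

Lemma integrable_size0 : P.-integrable setT (EFin \o size_bound).
Proof.
have := integrable_EFinD (integrable_norm_law sc0 mX0 d0) (integrable_norm_law sc1 mX1 d1).
by congr (_.-integrable _ _); apply/funext => w /=; congr EFin; rewrite /size_bound; ring.
Qed.

Lemma norm_incrX w : 1 + `|increment w| <= size_bound w.
Proof. by have := ler_normB (X1 w) (X0 w); rewrite /size_bound /increment; lra. Qed.

Lemma norm_interp t w : `|interpolant t w| <= (1 + `|t|) * size_bound w.
Proof.
apply: (le_trans (ler_normD _ _)); rewrite !normrZ /size_bound.
have := ler_normB 1 t; rewrite normr1.
have := normr_ge0 (X0 w); have := normr_ge0 (X1 w); have := normr_ge0 t.
have := normr_ge0 (1 - t); nra.
Qed.

Lemma mul_expRN t z w : expR (- phi0 (arg0 t z w)) * expR (- phi1 (arg1 t z w)) = dens t z w.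
Proof. by rewrite -expRD -opprD. Qed.

Section Weighted.
Variable a : V -> R.
Hypothesis ca : continuous a.
Hypothesis ba : forall w, `|a w| <= 1 + `|w|.
Hypothesis a0 : forall w, 0 <= a w.
Notation Aa := (A0 phi0 phi1 a).

Lemma cond_weight_joint t (g : V -> \bar R) : nnm (g : VB -> \bar R) ->
  (\int[P]_w (g (interpolant t w) * (a (increment w))%:E) = \int[leb]_z (g z * (Aa t z)%:E))%E.
Proof.
move=> ng; have na : nnm (fun w : VB => (a w)%:E).
  by apply: nnm_EFin => //; exact: continuous_measurable_rV.
rewrite (integral_interp mX0 mX1 d0 d1 (measurable_expRN sc0) (measurable_expRN sc1)
  (fun x => expR_ge0 _) (fun x => expR_ge0 _) ind t ng na).
apply: eq_integral => z _; congr (_ * _)%E.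
rewrite /A0 /pint /Rintegral fineK; last first.
  exact: integrable_fin_num (gparam_integrable (al16 al0) t z (gparam_A0 al0 sc0 sc1 ca ba)).
by apply: eq_integral => w _; rewrite mul_expRN -EFinM.
Qed.

Lemma A0_ge0 t z : 0 <= Aa t z.
Proof. by apply: Rintegral_ge0 => w _; rewrite mulr_ge0// ltW// dens_gt0. Qed.

Lemma continuous_cond t : continuous (fun z => Aa t z / rho t z).
Proof.
move=> z; have h1 := jcont_A0 al0 sc0 sc1 ca ba; have h2 := jcont_u al0 C0 sc0 sc1.
have h3 := jcontM h1 h2.
by apply: (@jcont_comp R n V R (fun t z => Aa t z / rho t z) (fun=> t) id z h3);
  [exact: cst_continuous | exact: cvg_id].
Qed.

Lemma cond_ge0 t z : 0 <= Aa t z / rho t z.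
Proof. by apply: divr_ge0; [exact: A0_ge0 | exact: ltW (rho_gt0 al0 C0 sc0 sc1 t z)]. Qed.

Lemma measurable_cond t : measurable_fun setT (fun w => Aa t (interpolant t w) / rho t (interpolant t w)).
Proof.
exact: (measurableT_comp (continuous_measurable_rV (@continuous_cond t)) (measurable_interp t)).
Qed.

End Weighted.

Lemma rho_law t (g : V -> \bar R) : nnm (g : VB -> \bar R) ->
  (\int[P]_w g (interpolant t w) = \int[leb]_z (g z * (rho t z)%:E))%E.
Proof.
move=> ng; have := cond_weight_joint (@continuous_one R n) (@bound_one R n) (fun _ => ler01) t ng.
by move=> <-; apply: eq_integral => w _; rewrite mule1.
Qed.

(** [A0 a / rho] is the conditional expectation of [a] of the increment: multiplying by the density
    [rho] of the interpolant gives back the joint integral. With nonnegative functions this needs no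
    prior integrability. *)
Lemma cond_nn (a : V -> R) t (g : V -> \bar R) : continuous a ->
  (forall w, `|a w| <= 1 + `|w|) -> (forall w, 0 <= a w) -> nnm (g : VB -> \bar R) ->
  (\int[P]_w (g (interpolant t w) * (a (increment w))%:E) =
   \int[P]_w (g (interpolant t w) * (A0 phi0 phi1 a t (interpolant t w) / rho t (interpolant t w))%:E))%E.
Proof.
move=> ca ba a0 ng; rewrite cond_weight_joint//.
have nq := nnm_mulEFin ng (continuous_measurable_rV (@continuous_cond a ca ba t))
   (cond_ge0 a0 t).
rewrite (rho_law t nq); apply: eq_integral => z _.
by rewrite -muleA -EFinM divfK// gt_eqF// (rho_gt0 al0 C0 sc0 sc1).
Qed.

Lemma integrable_weight (a : V -> R) : continuous a -> (forall w, `|a w| <= 1 + `|w|) ->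
  P.-integrable setT (EFin \o (fun w => a (increment w))).
Proof.
move=> ca ba; apply: (integrable_dominated _ _ integrable_size0).
  exact: (measurableT_comp (continuous_measurable_rV ca) measurable_incrX).
by move=> w; apply: le_trans (ba _) (norm_incrX w).
Qed.

(** Taking [g = 1] in the nonnegative identity, the conditional expectation inherits the finite
    integral of the weight. *)
Lemma integrable_cond (a : V -> R) t : continuous a -> (forall w, `|a w| <= 1 + `|w|) ->
  (forall w, 0 <= a w) ->
  P.-integrable setT (EFin \o (fun w => A0 phi0 phi1 a t (interpolant t w) / rho t (interpolant t w))).
Proof.
move=> ca ba a0; apply/integrableP; split.
  by apply/measurable_EFinP; exact: measurable_cond.
rewrite [X in (X < _)%E](_ : _ = \int[P]_w (a (increment w))%:E)%E.
  exact: (integrable_lty measurableT (integrable_weight ca ba)).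
have n1 : nnm (fun _ : VB => 1%E : \bar R) by split.
transitivity (\int[P]_w (1 * (A0 phi0 phi1 a t (interpolant t w) / rho t (interpolant t w))%:E))%E.
  by apply: eq_integral => w _; rewrite mul1e /= ger0_norm// cond_ge0.
by rewrite -(cond_nn t ca ba a0 n1); apply: eq_integral => w _; rewrite mul1e.
Qed.

(** The identity for nonnegative functions applies to [g + K] and to the constant [1]; subtracting
    [K] times the latter leaves [g]. *)
Lemma cond_bounded_weight (a : V -> R) t (g : V -> R) (K : R) : continuous a ->
  (forall w, `|a w| <= 1 + `|w|) -> (forall w, 0 <= a w) ->
  measurable_fun [set: VB] g -> (forall z, `|g z| <= K) ->
  \int[P]_w (g (interpolant t w) * a (increment w)) =
  \int[P]_w (g (interpolant t w) * (A0 phi0 phi1 a t (interpolant t w) / rho t (interpolant t w))).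
Proof.
move=> ca ba a0 mg gK; have ia := integrable_weight ca ba; have ic := integrable_cond t ca ba a0.
have K0 : 0 <= K by apply: le_trans (gK 0).
have mgi : measurable_fun setT (fun w => g (interpolant t w)).
  exact: (measurableT_comp mg (measurable_interp t)).
have bg w : `|g (interpolant t w)| <= K by exact: gK.
have i1 := integrable_mul_bounded mgi bg ia; have i2 := integrable_mul_bounded mgi bg ic.
have n1 : nnm (fun _ : VB => 1%E : \bar R) by split.
have ng : nnm (fun z : VB => (g z + K)%:E).
  apply: nnm_EFin; first by apply: measurable_funD.
  by move=> z; have := gK z; rewrite ler_norml => /andP[h _]; lra.
have e1 := cond_nn t ca ba a0 n1; have e2 := cond_nn t ca ba a0 ng.
have {}e1 : \int[P]_w a (increment w) =
    \int[P]_w (A0 phi0 phi1 a t (interpolant t w) / rho t (interpolant t w)).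
  rewrite /Rintegral; congr fine; transitivity (\int[P]_w (1 * (a (increment w))%:E))%E.
    by apply: eq_integral => w _; rewrite mul1e.
  by rewrite e1; apply: eq_integral => w _; rewrite mul1e.
have {}e2 : \int[P]_w (g (interpolant t w) * a (increment w) + K * a (increment w)) =
    \int[P]_w (g (interpolant t w) * (A0 phi0 phi1 a t (interpolant t w) / rho t (interpolant t w)) +
      K * (A0 phi0 phi1 a t (interpolant t w) / rho t (interpolant t w))).
  rewrite /Rintegral; congr fine.
  transitivity (\int[P]_w ((g (interpolant t w) + K)%:E * (a (increment w))%:E))%E.
    by apply: eq_integral => w _; rewrite -EFinM mulrDl.
  by rewrite e2; apply: eq_integral => w _; rewrite -EFinM mulrDl.
move: e2; rewrite !RintegralD// ?RintegralZl//.
- by rewrite e1 => /addIr.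
- exact: integrable_EFinZ ic.
- exact: integrable_EFinZ ia.
Qed.

(** The coordinate is split into positive and negative parts, each a nonnegative weight of linear
    growth. *)
Lemma cond_bounded t i (g : V -> R) (K : R) :
  measurable_fun [set: VB] g -> (forall z, `|g z| <= K) ->
  P.-integrable setT (EFin \o (fun w => vel t (interpolant t w) 0 i)) /\
  \int[P]_w (g (interpolant t w) * (increment w) 0 i) =
  \int[P]_w (g (interpolant t w) * vel t (interpolant t w) 0 i).
Proof.
move=> mg gK.
(* [a 1] and [a (-1)] are the positive and the negative part of the coordinate [i]. *)
pose a (s : R) (w : V) := 2^-1 * (`|w 0 i| + s * w 0 i).
have ca s : continuous (a s).
  move=> w; apply: (@continuousM R V (cst 2^-1)); first exact: cst_continuous.
  apply: (@continuousD R R V (fun w : V => `|w 0 i|) (fun w : V => s * w 0 i)).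
    apply: (@continuous_comp _ _ _ (fun w : V => w 0 i) (fun x : R => `|x|)).
      exact: coord_continuous.
    exact: norm_continuous.
  by apply: (@continuousM R V (cst s)); [exact: cst_continuous | exact: coord_continuous].
have sb s w : `|s| = 1 -> `|s * (w : V) 0 i| <= `|w 0 i|.
  by move=> s1; rewrite normrM s1 mul1r.
have s1 : `|1 : R| = 1 by exact: normr1.
have sN1 : `|-1 : R| = 1 by rewrite normrN normr1.
have a0 s w : `|s| = 1 -> 0 <= a s w.
  move=> hs; have := sb s w hs; rewrite ler_norml => /andP[h _].
  by rewrite /a mulr_ge0//; lra.
have ba s w : `|s| = 1 -> `|a s w| <= 1 + `|w|.
  move=> hs; rewrite ger0_norm ?a0//; have := sb s w hs; rewrite ler_norml => /andP[_ h].
  by have := norm_coord w i; rewrite /a; lra.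
have aE (w : V) : w 0 i = a 1 w - a (-1) w by rewrite /a; field.
have bap w := ba 1 w s1; have ban w := ba (-1) w sN1.
have a0p w := a0 1 w s1; have a0n w := a0 (-1) w sN1.
have velE z : vel t z 0 i =
    A0 phi0 phi1 (a 1) t z / rho t z - A0 phi0 phi1 (a (-1)) t z / rho t z.
  rewrite mxE -mulrBl; congr (_ / _); rewrite /mom /A0 /pint -RintegralB//.
  - by apply: eq_Rintegral => w _; rewrite /A0f -mulrBl -aE.
  - exact: (gparam_integrable (al16 al0) t z (gparam_A0 al0 sc0 sc1 (ca 1) bap)).
  - exact: (gparam_integrable (al16 al0) t z (gparam_A0 al0 sc0 sc1 (ca (-1)) ban)).
have ip := integrable_cond t (ca 1) bap a0p; have iN := integrable_cond t (ca (-1)) ban a0n.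
have wp := integrable_weight (ca 1) bap; have wn := integrable_weight (ca (-1)) ban.
have ep := cond_bounded_weight t (ca 1) bap a0p mg gK.
have en := cond_bounded_weight t (ca (-1)) ban a0n mg gK.
have mgi : measurable_fun setT (fun w => g (interpolant t w)).
  exact: (measurableT_comp mg (measurable_interp t)).
have bg w : `|g (interpolant t w)| <= K by exact: gK.
split.
  have := integrable_EFinD ip (integrable_EFinZ (-1) iN).
  by congr (_.-integrable _ _); apply/funext => w /=; congr EFin; rewrite velE mulN1r.
transitivity (\int[P]_w (g (interpolant t w) * a 1 (increment w) - g (interpolant t w) * a (-1) (increment w))).
  by apply: eq_Rintegral => w _; rewrite -mulrBr -aE.
rewrite RintegralB//; [|exact: integrable_mul_bounded mgi bg wp|exact: integrable_mul_bounded mgi bg wn].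
rewrite ep en -RintegralB//; [|exact: integrable_mul_bounded mgi bg ip|exact: integrable_mul_bounded mgi bg iN].
by apply: eq_Rintegral => w _; rewrite -mulrBr -velE.
Qed.

Lemma integrable_incrX i : P.-integrable setT (EFin \o (fun w => increment w 0 i)).
Proof. exact: (@integrable_weight (fun w : V => w 0 i) (@coord_continuous _ _ _ _ _) (bound_coord i)). Qed.

Lemma continuous_vel t : continuous (vel t).
Proof.
move=> z; apply: (@jcont_comp R n V V vel (fun=> t) id z (jcont_vel al0 C0 sc0 sc1)).
  exact: cst_continuous.
exact: cvg_id.
Qed.

Lemma vel_cond_exp t : cond_exp_version P increment (interpolant t) (vel t).
Proof.
split=> [B mB|i].
  by have := continuous_measurable_rVV (@continuous_vel t) measurableT mB; rewrite setTI.
have [iv _] := @cond_bounded t i (cst 0) 0 (measurable_cst _) (fun z => ltac:(by rewrite normr0)).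
split=> // B mB.
have mB' : measurable (B : set VB) := mB.
have mIB : measurable (interpolant t @^-1` B).
  by have := measurable_interp t measurableT mB; rewrite setTI.
rewrite (integral_preimage mIB (integrable_incrX i)) (integral_preimage mIB iv).
have [|_ h] := @cond_bounded t i (\1_B) 1 (measurable_indic mB').
  by move=> z; rewrite indicE; case: (_ \in _); rewrite ?normr1 ?normr0.
by congr EFin; exact: h.
Qed.

(** On a smaller open set around [z] the continuous density exceeds half its value at [z], and
    nonempty open sets have positive Lebesgue measure. *)
Lemma interp_open_gt0 t (U : set V) z : open U -> U z -> (0 < P (interpolant t @^-1` U))%E.
Proof.
move=> oU Uz; pose r := rho t z; have r0 : 0 < r by exact: rho_gt0 al0 C0 sc0 sc1 t z.
pose U' := U `&` [set y | r / 2 < rho t y].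
have cr : continuous (rho t).
  move=> y; apply: (@jcont_comp R n V R rho (fun=> t) id y (jcont_rho al0 sc0 sc1)).
    exact: cst_continuous.
  exact: cvg_id.
have oU' : open U'.
  apply: openI => //.
  by move/continuousP : cr => /(_ _ (@open_gt R (r / 2))).
have U'z : U' z by split=> //=; rewrite -/r; lra.
have mU' : measurable (U' : set VB) by exact: measurable_open.
have nU' : nnm (fun x : VB => (\1_U' x)%:E : \bar R) by exact: nnm_indic.
have e : P (interpolant t @^-1` U') = (\int[leb]_x ((\1_U' x)%:E * (rho t x)%:E))%E.
  have mA : measurable (interpolant t @^-1` U').
    by have := measurable_interp t measurableT mU'; rewrite setTI.
  by rewrite -(rho_law t nU') -[interpolant t @^-1` U']setIT -(integral_indic P measurableT mA).
apply: (@lt_le_trans _ _ (P (interpolant t @^-1` U'))); last first.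
  apply: le_measure; rewrite ?inE.
  - by have := measurable_interp t measurableT mU'; rewrite setTI.
  - by have := measurable_interp t measurableT (measurable_open oU); rewrite setTI.
  - by move=> w [].
rewrite e; apply: (@lt_le_trans _ _ ((r / 2)%:E * leb U')%E).
  by rewrite mule_gt0 ?lte_fin ?divr_gt0//; exact: lebV_open_gt0 oU' U'z.
have -> : leb U' = (\int[leb]_x (\1_U' x)%:E)%E by rewrite (integral_indic _ measurableT mU') setIT.
rewrite -ge0_integralZl_EFin//; last by rewrite divr_ge0// ltW.
apply: ge0_le_integral => //.
- by move=> x _; rewrite mule_ge0// lee_fin ?divr_ge0// ltW.
- exact: (nnm_scale (ltW (divr_gt0 r0 (ltr0n _ 2))) nU').1.
- apply: emeasurable_funM => //; first exact: nU'.1.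
  by apply/measurable_EFinP; exact: continuous_measurable_rV.
move=> x _; rewrite -!EFinM lee_fin indicE mulrC.
have [/set_mem[_ /= h]|_] := boolP (x \in U'); last by rewrite !mul0r.
  by rewrite !mul1r ltW.
exact: nU'.1.
Qed.

(** If the inequality failed at [z], then [g1 - g2] would exceed some [e > 0] in the coordinate [i]
    on an open set. Testing both versions on the corresponding event, which has positive
    probability, gives a contradiction. *)
Lemma cond_exp_le t (g1 g2 : V -> V) z i : continuous g1 -> continuous g2 ->
  cond_exp_version P increment (interpolant t) g1 -> cond_exp_version P increment (interpolant t) g2 ->
  g1 z 0 i <= g2 z 0 i.
Proof.
move=> c1 c2 [_ /(_ i)[i1 e1]] [_ /(_ i)[i2 e2]]; rewrite leNgt; apply/negP => lt21.
pose h y := g1 y 0 i - g2 y 0 i; pose e := h z / 2.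
have e0 : 0 < e by rewrite divr_gt0// subr_gt0.
have ch : continuous h.
  move=> y; apply: (@continuousB R R V (fun y => g1 y 0 i) (fun y => g2 y 0 i)).
    exact: ((continuous_coordP _ _).1 (c1 y)).
  exact: ((continuous_coordP _ _).1 (c2 y)).
pose U := h @^-1` [set x | e < x].
have oU : open U by move/continuousP : ch => /(_ _ (@open_gt R e)).
have hz0 : 0 < h z by rewrite subr_gt0.
have Uz : U z by rewrite /U/= /e; lra.
pose A := interpolant t @^-1` U.
have mA : measurable A by have := measurable_interp t measurableT (measurable_open oU); rewrite setTI.
have PA := interp_open_gt0 t oU Uz; rewrite -/A in PA.
have bA w : `|(\1_A w : R)| <= 1 by rewrite indicE; case: (_ \in _); rewrite ?normr1 ?normr0.
have mU : borel_set U := measurable_open oU.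
have := e1 U mU; rewrite (e2 U mU) !(integral_preimage mA)// => -[eqA].
have j1 := integrable_mul_bounded (measurable_indic mA) bA i1.
have j2 := integrable_mul_bounded (measurable_indic mA) bA i2.
have iA : P.-integrable setT (EFin \o (fun w => e * \1_A w)).
  have := integrable_EFinZ e (integrable_mul_bounded (measurable_indic mA) bA
     (finite_measure_integrable_cst P 1 measurableT)).
  by congr (_.-integrable _ _); apply/funext => w /=; rewrite mulr1.
have : \int[P]_w (e * \1_A w) <= \int[P]_w (\1_A w * g1 (interpolant t w) 0 i - \1_A w * g2 (interpolant t w) 0 i).
  apply: le_Rintegral => //.
    by have := integrable_EFinD j1 (integrable_EFinZ (-1) j2);
      congr (_.-integrable _ _); apply/funext => w /=; rewrite mulN1r.
  move=> w _; rewrite -mulrBr indicE.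
  have [/set_mem/= hw|_] := boolP (w \in A); last by rewrite mulr0 mul0r.
  by rewrite mulr1 mul1r; exact: ltW.
rewrite RintegralB// eqA subrr; apply/negP; rewrite -ltNge /Rintegral.
under eq_integral do rewrite EFinM.
rewrite ge0_integralZl_EFin ?ltW//; last by apply/measurable_EFinP; exact: measurable_indic.
rewrite integral_indic// setIT fineM ?mulr_gt0//.
  by apply: fine_gt0; rewrite PA/= ltey_eq fin_num_measure.
exact: fin_num_measure.
Qed.

End Interpolation.

(** * Transport of the law along the flow *)

Lemma is_derive_eps {R : realType} {W : normedModType R} (f : R -> W) (x : R) (df : W) :
  (forall eps : R, 0 < eps -> \forall h \near (0 : R),
    `|f (x + h) - f x - h *: df| <= eps * `|h|) -> is_derive x 1 f df.
Proof.
move=> key.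
have lim : (fun h : R => h^-1 *: (f (h *: (1 : R) + x) - f x)) @ 0^' --> df.
  apply/cvgrPdist_le => eps eps0.
  have /nbhs_norm0P[r /= r0 hr] := key eps eps0.
  apply/nbhs_normP; exists r => //= h; rewrite /ball_/= sub0r normrN => hhr hn0.
  rewrite distrC; have := hr h hhr; rewrite /= [_%:A]mulr1 (addrC h).
  have -> : f (x + h) - f x - h *: df = h *: (h^-1 *: (f (x + h) - f x) - df).
    by rewrite scalerBr scalerA divff// scale1r.
  by rewrite normrZ mulrC ler_pM2r ?normr_gt0.
apply: DeriveDef; first by apply/cvg_ex; exists df.
exact: cvg_lim lim.
Qed.

Section BackwardFlow.
Context {R : realType} {n : nat}.
Notation V := 'rV[R]_n.

Lemma norm_MVT_vec (f df : R -> V) (a b M : R) : 0 <= M ->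
  (forall t : R, is_derive t 1 f (df t)) ->
  (forall t, `|t - a| <= `|b - a| -> `|df t| <= M) -> `|f b - f a| <= M * `|b - a|.
Proof.
move=> M0 hf hM; apply: norm_le_coord => [|i]; first by rewrite mulr_ge0.
rewrite !mxE; have hfi (t : R) := (is_derive_coord f t 1 (df t)).1 (hf t) i.
have ci (c e : R) : {within `[c, e], continuous (fun t : R => f t 0 i)}.
  by apply: continuous_subspaceT => t; exact: (is_derive_continuous hfi).
have bi t : `|t - a| <= `|b - a| -> `|df t 0 i| <= M.
  by move=> ht; exact: le_trans (norm_coord _ _) (hM t ht).
have [ab|ba] := leP a b.
  rewrite (ger0_norm (x := b - a)) ?subr_ge0//.
  apply: (norm_MVT ab (fun t _ => hfi t) (ci a b)) => t /andP[t1 t2]; apply: bi.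
  by rewrite !ger0_norm ?subr_ge0 ?lerB// ltW.
rewrite distrC (distrC b) (ger0_norm (x := a - b)) ?subr_ge0 ?(ltW ba)//.
apply: (norm_MVT (ltW ba) (fun t _ => hfi t) (ci b a)) => t /andP[t1 t2]; apply: bi.
by rewrite distrC (distrC b) !ger0_norm ?subr_ge0 ?lerB// ltW.
Qed.

Variable v : R -> V -> V.
Hypothesis cv : jcont v.
Hypothesis lv : lipx v.
Variable flow : R -> V -> R -> V.
Hypothesis flow_s : forall s x, flow s x s = x.
Hypothesis flow_ode : forall s x (t : R), is_derive t 1 (flow s x) (v t (flow s x t)).

Lemma jcont_bounded_vec (N B : R) : exists2 L, 0 <= L &
  forall t x, `|t| <= N -> `|x| <= B -> `|v t x| <= L.
Proof.
have cn : jcont (fun t x => `|v t x|).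
  move=> p; apply: (@continuous_comp _ _ _ (fun p : R * V => v p.1 p.2) (fun x : V => `|x|)).
    exact: cv.
  exact: norm_continuous.
have [L L0 hL] := jbounded N B cn; exists L => // t x ht hx.
by have := hL t x ht hx; rewrite normr_id.
Qed.

(** To first order, flowing from time [s + h] back to [s] removes the displacement [h v (s, y s)]
    from the point [y (s + h)]. This takes the place of differentiating the flow in its starting
    time. *)
Lemma is_derive_backward (y : R -> V) (s : R) (dy : V) : is_derive s 1 y dy ->
  is_derive s 1 (fun r => flow r (y r) s) (dy - v s (y s)).
Proof.
move=> hy; apply: is_derive_eps => eps eps0.
pose a := v s (y s).
have cy : {for s, continuous y}.
  by apply: differentiable_continuous; apply/derivable1_diffP; exact: ex_derive.
have e2 : 0 < eps / 2 by rewrite divr_gt0.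
pose N := `|s| + 2; have [C C0 hC] := ode_growth N cv lv.
pose M := C * (`|y s| + 2); have [B B0 hB] := jcont_bounded_vec N M.
have /cvgrPdist_le/(_ _ e2)/nbhs_normP[eta /= eta0 heta] := @cv (s, y s).
have heta' t x : `|s - t| < eta -> `|y s - x| < eta -> `|a - v t x| <= eps / 2.
  by move=> h1 h2; apply: (heta (t, x)); rewrite /ball_/= prod_normE gt_max/= h1 h2.
have m0 : 0 < Num.min 1 (eta / 2) by rewrite lt_min ltr01 divr_gt0.
have /cvgrPdist_lt/(_ _ m0)/nbhs_normP[r1 /= r10 hr1] := cy.
have lim : (fun h : R => h^-1 *: (y (h *: (1 : R) + s) - y s)) @ 0^' --> dy.
  by have := (@ex_derive _ _ _ _ _ _ _ hy); rewrite /derivable => /cvg_ex[l hl];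
    have := @derive_val _ _ _ _ _ _ _ hy; rewrite /derive (cvg_lim _ hl)// => <-.
have /cvgrPdist_le/(_ _ e2)/nbhs_normP[r2 /= r20 hr2] := lim.
pose r3 := eta / (2 * (B + 1)); have r30 : 0 < r3 by rewrite divr_gt0// mulr_gt0// ltr_wpDl.
(* [r1] keeps [y (s + h)] near [y s], [r2] controls the difference quotient of [y], [r3] keeps the
   drift along the flow below [eta / 2], and the last two bound the times. *)
apply/nbhs_norm0P; exists (Num.min (Num.min r1 r2) (Num.min r3 (Num.min 1 (eta / 2)))) => /=.
  by rewrite !lt_min r10 r20 r30 ltr01 divr_gt0.
move=> h /=; rewrite !lt_min => /andP[/andP[h1 h2] /andP[h3 /andP[h4 h5]]].
have yr : `|y s - y (s + h)| < Num.min 1 (eta / 2).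
  by apply: (hr1 (s + h)); rewrite /ball_/= opprD addrA subrr sub0r normrN.
move: yr; rewrite lt_min => /andP[yr1 yr2].
have hyr : `|y (s + h)| + 1 <= `|y s| + 2.
  have -> : y (s + h) = y s - (y s - y (s + h)) by rewrite subKr.
  by have := ler_normB (y s) (y s - y (s + h)); lra.
have sN : `|s + h| <= N by apply: (le_trans (ler_normD _ _)); rewrite /N; lra.
have tN t : `|t - (s + h)| <= `|h| -> `|t| <= N.
  move=> ht; have -> : t = (t - (s + h)) + (s + h) by rewrite subrK.
  by apply: (le_trans (ler_normD _ _)); have := ler_normD s h; rewrite /N; lra.
have fM t : `|t| <= N -> `|flow (s + h) (y (s + h)) t| <= M.
  move=> ht; have := hC (s + h) _ sN (flow_ode (s + h) (y (s + h))) t ht.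
  by rewrite flow_s => /le_trans; apply; apply: ler_wpM2l.
have near_y t : `|t - (s + h)| <= `|h| -> `|y s - flow (s + h) (y (s + h)) t| < eta.
  move=> ht.
  have hd : `|flow (s + h) (y (s + h)) t - y (s + h)| <= B * `|t - (s + h)|.
    have -> : flow (s + h) (y (s + h)) t - y (s + h) =
      flow (s + h) (y (s + h)) t - flow (s + h) (y (s + h)) (s + h) by rewrite flow_s.
    apply: (norm_MVT_vec B0 (flow_ode (s + h) (y (s + h)))) => t' ht'.
    by apply: hB; [|apply: fM]; exact: tN (le_trans ht' ht).
  have -> : y s - flow (s + h) (y (s + h)) t =
     (y s - y (s + h)) - (flow (s + h) (y (s + h)) t - y (s + h)) by rewrite opprB addrA subrK.
  apply: (le_lt_trans (ler_normB _ _)).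
  have : B * `|t - (s + h)| <= eta / 2.
    apply: (@le_trans _ _ (B * r3)); first by apply: ler_wpM2l => //; apply: (le_trans ht); exact: ltW.
    rewrite /r3 mulrA ler_pdivrMr ?mulr_gt0 ?ltr_wpDl//.
    have -> : eta / 2 * (2 * (B + 1)) = eta * (B + 1) by field.
    by rewrite mulrC; apply: ler_wpM2l; [exact: ltW | rewrite lerDl].
  lra.
(* Removing the uniform motion with velocity [a] leaves a curve whose speed is at most [eps / 2]
   between [s] and [s + h]. *)
pose psi t := flow (s + h) (y (s + h)) t - t *: a.
have dpsi (t : R) : is_derive t 1 psi (v t (flow (s + h) (y (s + h)) t) - a).
  apply/is_derive_coord => i; rewrite !mxE.
  apply: (@is_derive_ext _ _ (fun t => flow (s + h) (y (s + h)) t 0 i - a 0 i * t)).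
    by move=> r; rewrite !mxE mulrC.
  apply: is_derB; first exact: ((is_derive_coord _ _ _ _).1 (flow_ode _ _ t) i).
  by have := is_derZ (a 0 i) (is_derive_id t (1 : R)); rewrite mulr1.
have es : s - (s + h) = - h by rewrite opprD addrA subrr sub0r.
have hpsi : `|psi s - psi (s + h)| <= eps / 2 * `|h|.
  rewrite -(normrN h) -es; apply: (norm_MVT_vec (ltW e2) dpsi) => t.
  rewrite es normrN => ht; rewrite distrC; apply: heta'; last exact: near_y.
  have -> : s - t = - h - (t - (s + h)) by rewrite opprB addrA [- h + _]addrC addrK.
  by apply: (le_lt_trans (ler_normB _ _)); rewrite normrN; lra.
have hdy : `|y (s + h) - y s - h *: dy| <= eps / 2 * `|h|.
  have [->|h0] := eqVneq h 0; first by rewrite addr0 subrr scale0r subr0 !normr0 mulr0.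
  have := hr2 h; rewrite /ball_/= sub0r normrN => /(_ h2 h0); rewrite distrC [_%:A]mulr1 (addrC h).
  have -> : y (s + h) - y s - h *: dy = h *: (h^-1 *: (y (s + h) - y s) - dy).
    by rewrite scalerBr scalerA divff// scale1r.
  by move=> hh; rewrite normrZ mulrC; exact: ler_wpM2r.
have -> : flow (s + h) (y (s + h)) s - flow s (y s) s - h *: (dy - v s (y s)) =
    (psi s - psi (s + h)) + (y (s + h) - y s - h *: dy).
  rewrite /psi !flow_s -/a; apply/rowP => i; rewrite !mxE; ring.
by apply: (le_trans (ler_normD _ _)); rewrite (splitr eps) mulrDl lerD.
Qed.

End BackwardFlow.

Section Transport.
Context {R : realType} {n : nat}.
Notation V := 'rV[R]_n.
Notation VB := (g_sigma_algebraType (@open V)).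
Notation E := (@ebasis R n).
Context {dO : measure_display} {Om : measurableType dO} (P : probability Om R).
Variables (phi0 phi1 : V -> R) (al C : R).
Hypothesis al0 : 0 < al.
Hypothesis C0 : 0 <= C.
Hypothesis sc0 : smooth_convex phi0 al C.
Hypothesis sc1 : smooth_convex phi1 al C.
Variables (X0 X1 : Om -> V).
Hypothesis mX0 : measurable_fun setT (X0 : Om -> VB).
Hypothesis mX1 : measurable_fun setT (X1 : Om -> VB).
Hypothesis d0 : has_density P X0 (fun x => expR (- phi0 x)).
Hypothesis d1 : has_density P X1 (fun x => expR (- phi1 x)).
Hypothesis ind : indep_vec P X0 X1.
Notation vel := (vel phi0 phi1).
Notation vel1 := (vel1 phi0 phi1).
Notation interp := (interpolant X0 X1).
Notation incrX := (increment X0 X1).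
Notation size0 := (size_bound X0 X1).
Notation hd := (is_derive_vel al0 C0 sc0 sc1).
Notation bd := (vel1_bound al0 C0 sc0 sc1).
Notation cv := (jcont_vel al0 C0 sc0 sc1).

Lemma jcont_velD k l : jcont (vel1 k l).
Proof. exact: (jcont_vel1 al0 C0 sc0 sc1). Qed.
Notation cd := jcont_velD.

Lemma Rintegral_sum0 (I : Type) (s : seq I) (F : I -> Om -> R) :
  (forall i, P.-integrable setT (EFin \o F i)) -> (forall i, \int[P]_w F i w = 0) ->
  P.-integrable setT (EFin \o (fun w => \sum_(i <- s) F i w)) /\
  \int[P]_w (\sum_(i <- s) F i w) = 0.
Proof.
move=> iF F0; elim: s => [|i s [h1 h2]].
  have e : (fun w : Om => \sum_(i <- [::]) F i w) = cst 0 by apply/funext => w; rewrite big_nil.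
  rewrite e; split; first exact: (finite_measure_integrable_cst P 0 measurableT).
  by rewrite /Rintegral integral0.
have e : (fun w : Om => \sum_(i <- i :: s) F i w) = (fun w => F i w + \sum_(i <- s) F i w).
  by apply/funext => w; rewrite big_cons.
rewrite e; split; first exact: (integrable_EFinD (iF i) h1).
by rewrite RintegralD// F0 h2 addr0.
Qed.

Lemma vel_growth (N : R) : exists2 K : R, 0 <= K & forall s z, `|s| <= N ->
  `|vel s z| <= K * (1 + `|z|).
Proof.
have [L L0 hL] := lipx_v hd bd N; have [B B0 hB] := jcont_bounded_vec cv N 0.
exists (L + B) => [|s z hs]; first exact: addr_ge0.
have -> : vel s z = (vel s z - vel s 0) + vel s 0 by rewrite subrK.
apply: (le_trans (ler_normD _ _)).
have h1 := hL s hs z 0; rewrite subr0 in h1.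
have h2 : `|vel s 0| <= B by apply: hB => //; rewrite normr0.
by have := mulr_ge0 B0 (normr_ge0 z); lra.
Qed.

Variable flow : R -> V -> R -> V.
Hypothesis flow_s : forall s x, flow s x s = x.
Hypothesis flow_ode : forall s x (t : R), is_derive t 1 (flow s x) (vel t (flow s x t)).
Variable Y : V -> R -> V -> R -> V.
Hypothesis Y_s : forall e s x, Y e s x s = e.
Hypothesis Y_ode : forall e s x (t : R),
  is_derive t 1 (Y e s x) (lin vel1 t (flow s x t) (Y e s x t)).

Variables (f : V -> R) (df : 'I_n -> V -> R) (K T : R).
Hypothesis hf : forall k x, is_derive x (E k) f (df k x).
Hypothesis cf : forall k, continuous (df k).
Hypothesis K0 : 0 <= K.
Hypothesis bf : forall x, `|f x| <= K.
Hypothesis bdf : forall k x, `|df k x| <= K.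

(** The function [u (s, x)] of the overview, constant along trajectories; [dpull s k] is its [k]-th
    space derivative. *)
Definition pull s x : R := f (flow s x T).
Definition dpull s k x : R := \sum_l df l (flow s x T) * Y (E k) s x T 0 l.

Lemma continuous_pull s : continuous (pull s).
Proof.
move=> x; apply: (@continuous_comp _ _ _ (fun x => flow s x T) f).
  exact: (continuous_flow0 hd cv cd bd flow_s flow_ode).
exact: (C1_continuous hf cf).
Qed.

Lemma is_derive_pull s k x : is_derive x (E k) (pull s) (dpull s k x).
Proof.
apply/(is_derive_line (W := R)).
have dE l : 'D_(E l) f = df l.
  by apply/funext => y; exact: (@derive_val _ _ _ _ _ _ _ (hf l y)).
have hz := (is_derive_line (W := V) _ _ _ _).1
  (is_derive_flow1 hd cv cd bd flow_s flow_ode Y_s Y_ode (E k) s x T).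
have := @is_derive_comp_C1 R n f (fun h : R => flow s (h *: E k + x) T) 0 (Y (E k) s x T)
  (fun y l => @ex_derive _ _ _ _ _ _ _ (hf l y)) _ hz.
rewrite scale0r add0r => h.
rewrite /dpull; under eq_bigr do rewrite -dE.
by apply: h => l; rewrite dE; exact: cf.
Qed.

Lemma continuous_dpull s k : continuous (dpull s k).
Proof.
move=> x; apply: continuous_sumr => l.
have c1 := @continuous_flow1 _ _ _ _ hd cv cd bd flow flow_s flow_ode Y Y_s Y_ode (E k) s T x.
apply: (@continuousM R V (fun x => df l (flow s x T)) (fun x => Y (E k) s x T 0 l)).
  apply: (@continuous_comp _ _ _ (fun x => flow s x T) (df l)); last exact: cf.
  exact: (continuous_flow0 hd cv cd bd flow_s flow_ode).
exact: ((continuous_coordP _ _).1 c1 l).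
Qed.

(** Uniformity in [x] comes from the bound on [Y]; it makes the gradient an admissible bounded
    multiplier for the conditional expectation. *)
Lemma dpull_bound (N : R) : exists2 B : R, 0 <= B & forall s k x, `|s| <= N ->
  `|dpull s k x| <= B.
Proof.
have [B B0 hB] := Y_growth bd Y_s Y_ode (Num.max N `|T|).
exists (n%:R * (K * B)) => [|s k x sN]; first by rewrite !mulr_ge0.
apply: (le_trans (ler_norm_sum _ _ _)).
have -> : n%:R * (K * B) = \sum_(l < n) K * B by rewrite sumr_const card_ord mulr_natl.
apply: ler_sum => l _; rewrite normrM; apply: ler_pM => //.
apply: (le_trans (norm_coord _ _)); apply: (le_trans (hB _ _ _ _ _ _)).
- by rewrite le_max sN.
- by rewrite le_max lexx orbT.
rewrite -[leRHS]mulr1; apply: ler_wpM2l => //; apply: norm_le_coord => // i.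
by rewrite ebasisE; case: (_ == _); rewrite ?normr1 ?normr0.
Qed.

(** By the group property, [pull r (y r)] is [pull s] at the point flowed from [y r] back to time
    [s]. The function is now fixed, and only its argument moves, with the velocity found in
    [is_derive_backward]. *)
Lemma is_derive_pull_path w (s : R) : is_derive s 1 (fun r => pull r (interp r w))
  (\sum_k dpull s k (interp s w) * (incrX w - vel s (interp s w)) 0 k).
Proof.
have hy : is_derive s 1 (fun r => interp r w) (incrX w).
  apply/is_derive_coord => i.
  apply: (@is_derive_ext _ _ (fun r => X0 w 0 i + incrX w 0 i * r)).
    by move=> r; rewrite !mxE; ring.
  have h2 : is_derive s 1 (fun r : R => incrX w 0 i * r) (incrX w 0 i).
    by have := is_derZ (incrX w 0 i) (is_derive_id s (1 : R)); rewrite mulr1.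
  by have := is_derD (is_derive_cst (X0 w 0 i) s (1 : R)) h2; rewrite add0r.
have hz := is_derive_backward cv (lipx_v hd bd) flow_s flow_ode hy.
have dE k : 'D_(E k) (pull s) = dpull s k.
  by apply/funext => y; exact: (@derive_val _ _ _ _ _ _ _ (is_derive_pull s k y)).
have := @is_derive_comp_C1 R n (pull s) (fun r => flow r (interp r w) s) s
  (incrX w - vel s (interp s w))
  (fun y k => @ex_derive _ _ _ _ _ _ _ (is_derive_pull s k y)) _ hz.
rewrite flow_s => h; under eq_bigr do rewrite -dE.
have -> : (fun r => pull r (interp r w)) = (fun r => pull s (flow r (interp r w) s)).
  by apply/funext => r; rewrite /pull (flow_group hd bd flow_s flow_ode).
by apply: h => k; rewrite dE; exact: continuous_dpull.
Qed.

Lemma measurable_pull s : measurable_fun setT (fun w => pull s (interp s w)).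
Proof.
exact: (measurableT_comp (continuous_measurable_rV (@continuous_pull s)) (measurable_interp mX0 mX1 s)).
Qed.

Lemma integrable_pull s : P.-integrable setT (EFin \o (fun w => pull s (interp s w))).
Proof.
apply: (integrable_dominated (measurable_pull s) _ (finite_measure_integrable_cst P K measurableT)).
by move=> w; exact: bf.
Qed.

Lemma mean_derivative0 s :
  \int[P]_w (\sum_k dpull s k (interp s w) * (incrX w - vel s (interp s w)) 0 k) = 0.
Proof.
have [B B0 hB] := dpull_bound `|s|.
have mg k : measurable_fun setT (fun w => dpull s k (interp s w)).
  exact: (measurableT_comp (continuous_measurable_rV (@continuous_dpull s k)) (measurable_interp mX0 mX1 s)).
have bg k w : `|dpull s k (interp s w)| <= B by exact: hB.
have hc k := cond_bounded al0 C0 sc0 sc1 mX0 mX1 d0 d1 ind s k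
  (continuous_measurable_rV (@continuous_dpull s k)) (fun z => hB s k z (lexx _)).
have i1 k := integrable_mul_bounded (mg k) (bg k)
  (integrable_incrX al0 sc0 sc1 mX0 mX1 d0 d1 k).
have i2 k := integrable_mul_bounded (mg k) (bg k) (hc k).1.
pose F k w := dpull s k (interp s w) * incrX w 0 k +
   (-1) * (dpull s k (interp s w) * vel s (interp s w) 0 k).
have iF k : P.-integrable setT (EFin \o F k).
  exact: integrable_EFinD (i1 k) (integrable_EFinZ (-1) (i2 k)).
have F0 k : \int[P]_w F k w = 0.
  rewrite RintegralD//; last exact: integrable_EFinZ (i2 k).
  by rewrite RintegralZl// (hc k).2 mulN1r subrr.
rewrite -[RHS](Rintegral_sum0 (index_enum 'I_n) iF F0).2.
apply: eq_Rintegral => w _ /=; apply: eq_bigr => k _.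
by rewrite /F mulN1r -mulrBr !mxE.
Qed.

Lemma mean_pull_cst (s : R) : is_derive s 1 (fun r => \int[P]_w pull r (interp r w)) 0.
Proof.
pose N := `|s| + 1.
have [B B0 hB] := dpull_bound N; have [L L0 hL] := vel_growth N.
have N0 : 0 <= N by rewrite addr_ge0.
(* Each of [n] terms is at most [B] times the size of the increment minus the velocity, and linear
   growth of the velocity bounds that size by [(1 + L (2 + N)) * size0]. *)
pose G w := n%:R * B * (1 + L * (2 + N)) * size0 w.
have c0 : 0 <= n%:R * B * (1 + L * (2 + N)).
  by apply: mulr_ge0; [exact: mulr_ge0 | rewrite addr_ge0// mulr_ge0// addr_ge0].
have size1 w : 1 <= size0 w.
  by have := normr_ge0 (X0 w); have := normr_ge0 (X1 w); rewrite /size_bound; lra.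
pose F (r : R) w := pull r (interp r w).
have dF (r : R) w : is_derive r 1 (F ^~ w)
    (\sum_k dpull r k (interp r w) * (incrX w - vel r (interp r w)) 0 k).
  exact: is_derive_pull_path.
have pF r w : partial1of2 F r w =
    \sum_k dpull r k (interp r w) * (incrX w - vel r (interp r w)) 0 k.
  by rewrite partial1of2E (@derive_val _ _ _ _ _ _ _ (dF r w)).
have rN r : `]s - 1, s + 1[%classic r -> `|r| <= N.
  rewrite /= in_itv/= => /andP[r1 r2]; have -> : r = (r - s) + s by rewrite subrK.
  apply: (le_trans (ler_normD _ _)); rewrite /N addrC lerD2l ler_norml; lra.
have := @cvg_differentiation_under_integral R _ Om P F setT measurableT s (s - 1) (s + 1) _
  (fun r _ => integrable_pull r)
  (fun r w _ _ => @ex_derive _ _ _ _ _ _ _ (dF r w)) G _ _ _.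
have sI : `]s - 1, s + 1[%classic s by rewrite /= in_itv/=; apply/andP; split; lra.
have G0 w : 0 <= G w by rewrite mulr_ge0//; exact: le_trans (size1 w).
have iG : P.-integrable setT (EFin \o G).
  exact: integrable_EFinZ (integrable_size0 al0 sc0 sc1 mX0 mX1 d0 d1).
have bG r w : `]s - 1, s + 1[%classic r -> setT w -> `|partial1of2 F r w| <= G w.
  move=> /rN hr _; rewrite pF; apply: (le_trans (ler_norm_sum _ _ _)).
  have hv : `|incrX w - vel r (interp r w)| <= (1 + L * (2 + N)) * size0 w.
    apply: (le_trans (ler_normB _ _)).
    have h1 := norm_incrX X0 X1 w; have h2 := hL r (interp r w) hr.
    have h3 := norm_interp X0 X1 r w.
    have h4 : (1 + `|r|) * size0 w <= (1 + N) * size0 w.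
      by apply: ler_wpM2r; [exact: le_trans (size1 w) | rewrite lerD2l].
    have h5 : L * (1 + `|interp r w|) <= L * ((2 + N) * size0 w).
      by apply: ler_wpM2l => //; have := size1 w; lra.
    by have := size1 w; lra.
  have -> : G w = \sum_(k < n) B * ((1 + L * (2 + N)) * size0 w).
    by rewrite sumr_const card_ord -[RHS]mulr_natl /G; ring.
  apply: ler_sum => k _; rewrite normrM; apply: ler_pM => //; first exact: hB.
  exact: le_trans (norm_coord _ _) hv.
move=> /(_ sI G0 iG bG) lim.
have m0 : \int[P]_w partial1of2 F s w = 0.
  by rewrite -[RHS](mean_derivative0 s); apply: eq_Rintegral => w _; exact: pF.
rewrite m0 in lim.
have lim' : (fun h : R => h^-1 *: (((fun r => \int[P]_w pull r (interp r w)) \o shift s) h%:A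
    - \int[P]_w pull s (interp s w))) @ 0^' --> (0 : R).
  by under eq_fun do rewrite /= [_%:A]mulr1; exact: lim.
apply: DeriveDef; first by apply/cvg_ex; exists (0 : R).
exact: cvg_lim lim'.
Qed.

Lemma mean_transport : 0 <= T ->
  \int[P]_w f (flow 0 (X0 w) T) = \int[P]_w f (interp T w).
Proof.
move=> T0; pose m r := \int[P]_w pull r (interp r w).
have : `|m T - m 0| <= 0 * (T - 0).
  apply: (@norm_MVT R m (fun=> 0)) => //.
  - by move=> t _; exact: mean_pull_cst.
  - by apply: continuous_subspaceT; exact: (is_derive_continuous mean_pull_cst).
  - by move=> t _; rewrite normr0.
rewrite mul0r normr_le0 subr_eq0 => /eqP e.
transitivity (m 0).
  by apply: eq_Rintegral => w _; rewrite /pull /interpolant subr0 scale1r scale0r addr0.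
by rewrite -e; apply: eq_Rintegral => w _; rewrite /pull flow_s.
Qed.

End Transport.

(** * Smooth approximation of closed boxes and equality of laws *)

Section BoxFunctions.
Context {R : realType}.

Definition pospart (y : R) : R := (y + `|y|) / 2.

Lemma pospart_ge0 y : 0 <= pospart y.
Proof. by rewrite /pospart divr_ge0//; have := ler_norm (- y); rewrite normrN; lra. Qed.

Lemma pospart_eq0 y : y <= 0 -> pospart y = 0.
Proof. by move=> y0; rewrite /pospart ler0_norm// subrr mul0r. Qed.

Lemma pospart_gt0 y : 0 < y -> 0 < pospart y.
Proof. by move=> y0; rewrite /pospart gtr0_norm//; lra. Qed.

Lemma continuous_pospart : continuous pospart.
Proof.
move=> y; apply: (@continuousM R R (fun y => y + `|y|) (cst 2^-1)); last exact: cst_continuous.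
by apply: (@continuousD R R R id Num.norm); [exact: cvg_id | exact: norm_continuous].
Qed.

(** Squaring removes the kink at zero: the first-order remainder is at most [h ^ 2] whatever the
    signs of [y] and [y + h]. *)
Lemma is_derive_pospart_sqr (y : R) : is_derive y 1 (fun y => pospart y ^+ 2) (2 * pospart y).
Proof.
apply: is_derive_eps => eps eps0; apply/nbhs_norm0P; exists eps => //= h he.
have main : `|pospart (y + h) ^+ 2 - pospart y ^+ 2 - h * (2 * pospart y)| <= `|h| ^+ 2.
  rewrite real_normK ?num_real// /pospart.
  have [h1|h1] := leP 0 (y + h); have [h2|h2] := leP 0 y.
  - by rewrite (ger0_norm h1) (ger0_norm h2) ler_norml; apply/andP; split; nra.
  - by rewrite (ger0_norm h1) (ltr0_norm h2) ler_norml; apply/andP; split; nra.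
  - by rewrite (ltr0_norm h1) (ger0_norm h2) ler_norml; apply/andP; split; nra.
  - by rewrite (ltr0_norm h1) (ltr0_norm h2) ler_norml; apply/andP; split; nra.
apply: (le_trans main); rewrite expr2; apply: ler_wpM2r => //; exact: ltW.
Qed.

(** The squared distance from [y] to [[a, b]] if [a <= b]; everywhere positive if the interval is
    empty. *)
Definition boxgap (a b y : R) : R := pospart (a - y) ^+ 2 + pospart (y - b) ^+ 2.
Definition boxgap1 (a b y : R) : R := - (2 * pospart (a - y)) + 2 * pospart (y - b).

Lemma is_derive_boxgap a b (y : R) : is_derive y 1 (boxgap a b) (boxgap1 a b y).
Proof.
apply: is_derD.
  have ha : is_derive y 1 (fun y : R => a - y) (-1).
    by have := is_derB (is_derive_cst a y (1 : R)) (is_derive_id y (1 : R)); rewrite sub0r.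
  have := is_derive_comp1 (f := fun y : R => a - y) (is_derive_pospart_sqr (a - y)) ha.
  by rewrite mulrN1.
have hb : is_derive y 1 (fun y : R => y - b) 1.
  by have := is_derB (is_derive_id y (1 : R)) (is_derive_cst b y (1 : R)); rewrite subr0.
have := is_derive_comp1 (f := fun y : R => y - b) (is_derive_pospart_sqr (y - b)) hb.
by rewrite mulr1.
Qed.

Lemma continuous_boxgap1 a b : continuous (boxgap1 a b).
Proof.
move=> y.
have ca : {for y, continuous (fun y : R => pospart (a - y))}.
  apply: (@continuous_comp _ _ _ (fun y : R => a - y) pospart); last exact: continuous_pospart.
  by apply: (@continuousB R R R (cst a) id); [exact: cst_continuous | exact: cvg_id].
have cb : {for y, continuous (fun y : R => pospart (y - b))}.
  apply: (@continuous_comp _ _ _ (fun y : R => y - b) pospart); last exact: continuous_pospart.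
  by apply: (@continuousB R R R id (cst b)); [exact: cvg_id | exact: cst_continuous].
have c2 : {for y, continuous (cst (2 : R) : R -> R)} by exact: cst_continuous.
exact: (@continuousD R R R _ _ y (@continuousN R R R _ y (@continuousM R R _ _ y c2 ca))
  (@continuousM R R _ _ y c2 cb)).
Qed.

Lemma boxgap_ge0 a b y : 0 <= boxgap a b y.
Proof. by rewrite addr_ge0 ?sqr_ge0. Qed.

Lemma boxgap1_le a b y : `|boxgap1 a b y| <= 2 * (1 + boxgap a b y).
Proof.
rewrite /boxgap1 /boxgap; have := pospart_ge0 (a - y); have := pospart_ge0 (y - b).
set p := pospart _; set q := pospart _ => p0 q0; rewrite ler_norml; apply/andP; split; nra.
Qed.

Lemma boxgap_eq0 a b y : a <= y <= b -> boxgap a b y = 0.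
Proof. by move=> /andP[h1 h2]; rewrite /boxgap !pospart_eq0 ?subr_le0// expr0n addr0. Qed.

Lemma boxgap_gt0 a b y : ~~ (a <= y <= b) -> 0 < boxgap a b y.
Proof.
rewrite negb_and -!ltNge => /orP[h|h].
  by rewrite ltr_wpDr ?sqr_ge0// exprn_gt0// pospart_gt0// subr_gt0.
by rewrite ltr_wpDl ?sqr_ge0// exprn_gt0// pospart_gt0// subr_gt0.
Qed.

End BoxFunctions.

Section BoxLaw.
Context {R : realType} {n : nat}.
Notation V := 'rV[R]_n.
Notation VB := (g_sigma_algebraType (@open V)).
Notation E := (@ebasis R n).

Definition C1_bounded (f : V -> R) : Prop := exists (df : 'I_n -> V -> R) (K : R),
  [/\ 0 <= K, forall k x, is_derive x (E k) f (df k x), forall k, continuous (df k),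
    forall x, `|f x| <= K & forall k x, `|df k x| <= K].

Definition gap (a b x : V) : R := \sum_i boxgap (a 0 i) (b 0 i) (x 0 i).
Definition gap1 (a b : V) k (x : V) : R := \sum_i boxgap1 (a 0 i) (b 0 i) (x 0 i) * E k 0 i.

Lemma gap_ge0 a b x : 0 <= gap a b x.
Proof. by apply: sumr_ge0 => i _; exact: boxgap_ge0. Qed.

Lemma is_derive_gap a b k x : is_derive x (E k) (gap a b) (gap1 a b k x).
Proof.
apply: is_der_sum => i.
exact: (is_derive_comp1 (f := fun x : V => x 0 i) (is_derive_boxgap _ _ _) (is_derive_coordinate x (E k) i)).
Qed.

Lemma continuous_gap1 a b k : continuous (gap1 a b k).
Proof.
move=> x; apply: continuous_sumr => i.
apply: (@continuousM R V (fun x : V => boxgap1 (a 0 i) (b 0 i) (x 0 i)) (cst (E k 0 i))).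
  apply: (@continuous_comp _ _ _ (fun x : V => x 0 i) (boxgap1 (a 0 i) (b 0 i))).
    exact: coord_continuous.
  exact: continuous_boxgap1.
exact: cst_continuous.
Qed.

Lemma gap1_le a b k x : `|gap1 a b k x| <= 2 * (n%:R + gap a b x).
Proof.
apply: (le_trans (ler_norm_sum _ _ _)).
have -> : 2 * (n%:R + gap a b x) = \sum_i 2 * (1 + boxgap (a 0 i) (b 0 i) (x 0 i)).
  by rewrite -mulr_sumr big_split/= sumr_const card_ord.
apply: ler_sum => i _; rewrite normrM; apply: le_trans (boxgap1_le _ _ _).
by rewrite ler_piMr// ebasisE; case: (_ == _); rewrite ?normr1 ?normr0.
Qed.

Definition boxfun (a b : V) (m : nat) (x : V) : R := expR (m%:R * - gap a b x).

Lemma boxfun_le1 a b m x : `|boxfun a b m x| <= 1.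
Proof.
rewrite ger0_norm ?expR_ge0// -[leRHS]expR0 ler_expR mulrN oppr_le0.
by rewrite mulr_ge0// gap_ge0.
Qed.

(** With [s = m * gap], differentiation brings down [m * gap1], of size at most [2 (m n + s)]; the
    growing part is absorbed by [s * exp (- s) <= 1]. *)
Lemma C1_bounded_boxfun a b m : C1_bounded (boxfun a b m).
Proof.
exists (fun k x => boxfun a b m x * (m%:R * - gap1 a b k x)), (2 * (m%:R * n%:R + 1) + 1).
have mn : 0 <= m%:R * n%:R :> R by rewrite mulr_ge0.
have hd k x : is_derive x (E k) (boxfun a b m) (boxfun a b m x * (m%:R * - gap1 a b k x)).
  apply: (is_derive_comp1 (is_derive_expR _)).
  exact: is_derZ (is_derN (is_derive_gap a b k x)).
have cE : continuous (boxfun a b m).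
  move=> x; apply: (@continuous_comp _ _ _ (fun x => m%:R * - gap a b x) (@expR R)).
    apply: (@continuousM R V (cst m%:R) (fun x => - gap a b x)); first exact: cst_continuous.
    apply: (@continuousN R R V (gap a b)).
    exact: (C1_continuous (is_derive_gap a b) (@continuous_gap1 a b)).
  exact: continuous_expR.
have K0 : 0 <= 2 * (m%:R * n%:R + 1) + 1 :> R by lra.
split=> //.
- move=> k x; apply: (@continuousM R V (boxfun a b m) (fun x => m%:R * - gap1 a b k x)).
    exact: cE.
  apply: (@continuousM R V (cst m%:R) (fun x => - gap1 a b k x)); first exact: cst_continuous.
  by apply: (@continuousN R R V (gap1 a b k)); exact: continuous_gap1.
- by move=> x; apply: (le_trans (boxfun_le1 _ _ _ _)); lra.
move=> k x; rewrite normrM normrM normrN (ger0_norm (expR_ge0 _)) (ger0_norm (ler0n _ _)).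
have m0 : 0 <= m%:R :> R by [].
pose s := m%:R * gap a b x; have s0 : 0 <= s by rewrite mulr_ge0// gap_ge0.
have es : boxfun a b m x * s <= 1.
  rewrite /boxfun mulrN expRN mulrC ler_pdivrMr ?expR_gt0// mul1r.
  by have := expR_ge1Dx s; rewrite -/s; lra.
have e1 : boxfun a b m x <= 1 by have := boxfun_le1 a b m x; rewrite ger0_norm ?expR_ge0.
have h1 : m%:R * `|gap1 a b k x| <= 2 * (m%:R * n%:R + s).
  have -> : 2 * (m%:R * n%:R + s) = m%:R * (2 * (n%:R + gap a b x)) by rewrite /s; ring.
  by apply: ler_wpM2l => //; exact: gap1_le.
have h2 := ler_wpM2l (expR_ge0 (m%:R * - gap a b x)) h1; apply: (le_trans h2).
rewrite -/(boxfun a b m x).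
have h3 : boxfun a b m x * (m%:R * n%:R) <= m%:R * n%:R by apply: ler_piMl.
lra.
Qed.

Lemma boxfun_cvg a b x : boxfun a b m x @[m --> \oo] --> (\1_(cbox a b) x : R).
Proof.
rewrite indicE; have [/set_mem hx|/negP hx] := boolP (x \in cbox a b).
  have -> : (fun m => boxfun a b m x) = fun=> 1.
    apply/funext => m; rewrite /boxfun (_ : gap a b x = 0) ?oppr0 ?mulr0 ?expR0//.
    by apply: big1 => i _; apply: boxgap_eq0; exact: hx.
  exact: cvg_cst.
have [i hi] : exists i, ~~ (a 0 i <= x 0 i <= b 0 i).
  apply: contrapT => h; apply: hx; apply/mem_set => i.
  by apply: contrapT => /negP hi; apply: h; exists i.
have g0 : 0 < gap a b x.
  rewrite /gap (bigD1 i)//= ltr_pwDl//; first exact: boxgap_gt0.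
  by apply: sumr_ge0 => j _; exact: boxgap_ge0.
have -> : (fun m => boxfun a b m x) = (fun m : nat => expR (- gap a b x) ^+ m).
  by apply/funext => m; rewrite /boxfun expRM_natl.
apply: cvg_expr; rewrite ger0_norm ?expR_ge0// -[ltRHS]expR0 ltr_expR.
by rewrite oppr_lt0.
Qed.

Context {dO : measure_display} {Om : measurableType dO} (P : probability Om R).

Lemma boxfun_integral_cvg (A : Om -> V) a b : measurable_fun setT (A : Om -> VB) ->
  \int[P]_w boxfun a b m (A w) @[m --> \oo] --> fine (P (A @^-1` cbox a b)).
Proof.
move=> mA.
have cf m : continuous (boxfun a b m).
  by have [df [K [_ h1 h2 _ _]]] := C1_bounded_boxfun a b m; exact: C1_continuous h1 h2.
have mf m : measurable_fun setT (fun w => (boxfun a b m (A w))%:E).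
  apply/measurable_EFinP; exact: (measurableT_comp (continuous_measurable_rV (cf m)) mA).
have mbox : measurable (A @^-1` cbox a b).
  by have := mA measurableT _ (@measurable_cbox R n a b); rewrite setTI.
have mi : measurable_fun setT (fun w => (\1_(A @^-1` cbox a b) w : R)%:E).
  by apply/measurable_EFinP; exact: measurable_indic.
have i1 := finite_measure_integrable_cst P 1 (@measurableT _ Om).
have cw w : setT w -> (boxfun a b m (A w))%:E @[m --> \oo] --> (\1_(A @^-1` cbox a b) w : R)%:E.
  by move=> _; apply: cvg_EFin; [exact: nearW | exact: boxfun_cvg].
have bw w (m : nat) : setT w -> (`|(boxfun a b m (A w))%:E| <= (EFin \o cst (1%R : R)) w)%E.
  by move=> _; rewrite lee_fin; exact: boxfun_le1.
have [_ _] := @dominated_convergence _ _ _ P setT measurableT _ _ _ mf mi (aeW _ cw) i1 (aeW _ bw).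
rewrite integral_indic// setIT => h; apply: fine_cvg.
by rewrite fineK//; exact: fin_num_measure.
Qed.

Lemma borel_cbox : @measurable _ VB = <<s [set S | exists a b, S = @cbox R n a b] >>.
Proof.
apply/seteqP; split; apply: smallest_sub; try exact: smallest_sigma_algebra.
- move=> U oU; rewrite (open_bigcup_cbox oU).
  rewrite bigcup_mkcond.
  apply: (@countable_bigcupT_measurable _
    (g_sigma_algebraType [set S | exists a b, S = @cbox R n a b])); first exact: countableP.
  move=> p; case: ifP => _; last exact: measurable0.
  by apply: sub_sigma_algebra; exists (ratV p.1), (ratV p.2).
by move=> _ [a [b ->]]; exact: measurable_cbox.
Qed.

(** Closed boxes are stable under intersection, generate the Borel sets and exhaust the space, so
    agreement on boxes suffices. There both probabilities are limits of the means of [boxfun]. *)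
Lemma law_eq (A B : Om -> V) : measurable_fun setT (A : Om -> VB) ->
  measurable_fun setT (B : Om -> VB) ->
  (forall f, C1_bounded f -> \int[P]_w f (A w) = \int[P]_w f (B w)) ->
  forall S : set V, borel_set S -> P (A @^-1` S) = P (B @^-1` S).
Proof.
move=> mA mB hf S mS.
pose G := [set S | exists a b, S = @cbox R n a b].
pose g (k : nat) := cbox (const_mx (- k%:R) : V) (const_mx k%:R).
have gT : \bigcup_k g k = [set: V].
  apply/seteqP; split=> // x _; exists (Num.bound `|x|) => // i; rewrite !mxE -ler_norml.
  by apply: (le_trans (norm_coord x i)); apply: ltW; exact: archi_boundP.
apply: (@measure_unique _ R VB G g borel_cbox _ _ gT (distribution P (law mA)) (distribution P (law mB))) => //.
(* The corners of a [cbox] need not be ordered, so an empty intersection is again of this form. *)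
- move=> _ _ [a [b ->]] [a' [b' ->]].
  exists (\row_i Num.max (a 0 i) (a' 0 i)), (\row_i Num.min (b 0 i) (b' 0 i)).
  apply/seteqP; split => [x [h1 h2] i|x h]; rewrite ?mxE.
    by rewrite ge_max le_min; have /andP[-> ->] := h1 i; have /andP[-> ->] := h2 i.
  by split => i; have := h i; rewrite !mxE ge_max le_min => /andP[/andP[h1 h2] /andP[h3 h4]]; apply/andP.
- by move=> k; exists (const_mx (- k%:R)), (const_mx k%:R).
- move=> _ [a [b ->]].
  have h1 := @boxfun_integral_cvg A a b mA; have h2 := @boxfun_integral_cvg B a b mB.
  have e : (fun m => \int[P]_w boxfun a b m (A w)) = (fun m => \int[P]_w boxfun a b m (B w)).
    by apply/funext => m; apply: hf; exact: C1_bounded_boxfun.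
  rewrite e in h1; have := cvg_unique _ h1 h2 => /(_ (@Rhausdorff R)) h.
  have mbox (D : Om -> V) : measurable_fun setT (D : Om -> VB) -> measurable (D @^-1` cbox a b).
    by move=> mD; have := mD measurableT _ (@measurable_cbox R n a b); rewrite setTI.
  have fin (D : Om -> V) (mD : measurable_fun setT (D : Om -> VB)) :=
    fin_num_measure P _ (mbox D mD).
  transitivity (fine (P (A @^-1` cbox a b)))%:E; first by rewrite (fineK (fin A mA)).
  by rewrite h (fineK (fin B mB)).
- by move=> k; rewrite (le_lt_trans (probability_le1 _ _)) ?ltry//; exact: measurable_cbox.
Qed.

End BoxLaw.

(** * Solutions on the unit interval *)

Section UnitInterval.
Context {R : realType} {n : nat}.
Notation V := 'rV[R]_n.

(** A solution in the sense of [ode_solution] is constrained on [[0, 1]] only. Composition with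
    [clamp] makes it continuous on the line without changing its two-sided derivatives inside the
    interval. *)
Definition clamp (s : R) : R := Num.max 0 (Num.min 1 s).

Lemma clamp_unit s : 0 <= clamp s <= 1.
Proof. by rewrite /clamp le_max lexx ge_max ler01 ge_min lexx. Qed.

Lemma clampE s : 0 <= s <= 1 -> clamp s = s.
Proof. by move=> /andP[h0 h1]; rewrite /clamp (min_idPr h1) (max_idPr h0). Qed.

Lemma clamp_lip s t : `|clamp s - clamp t| <= `|s - t|.
Proof.
rewrite /clamp /Num.max /Num.min.
case: (ltP 1 s) => h1; case: (ltP 1 t) => h2; rewrite ?ltr01 ?subrr ?normr0//.
- case: ltP => h3; rewrite (ger0_norm (x := s - t)) ?ger0_norm//; lra.
- case: ltP => h3; rewrite (ler0_norm (x := s - t)) ?ler0_norm//; lra.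
case: ltP => h3; case: ltP => h4; rewrite ?subrr ?normr0//.
- rewrite subr0 (ger0_norm (ltW h3)); apply: le_trans (ler_norm _); lra.
- rewrite sub0r normrN (ger0_norm (ltW h4)) distrC; apply: le_trans (ler_norm _); lra.
Qed.

Variables (v : R -> V -> V) (x : V) (g : R -> V).
Hypothesis gv : ode_solution v x g.

Lemma ode_solution_eps t eps : 0 <= t <= 1 -> 0 < eps ->
  exists2 r : R, 0 < r & forall h, `|h| < r -> 0 <= t + h <= 1 ->
    `|g (t + h) - g t - h *: v t (g t)| <= eps * `|h|.
Proof.
move=> t01 eps0; have [_ /(_ t t01)] := gv.
move=> /cvgrPdist_le/(_ _ eps0)/nbhs_normP[r /= r0 hr]; exists r => // h hh th.
have [->|h0] := eqVneq h 0; first by rewrite addr0 subrr scale0r subr0 !normr0 mulr0.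
have := hr h; rewrite /ball_/= sub0r normrN => /(_ hh h0 th); rewrite distrC => hq.
have -> : g (t + h) - g t - h *: v t (g t) = h *: (h^-1 *: (g (t + h) - g t) - v t (g t)).
  by rewrite scalerBr scalerA divff// scale1r.
by rewrite normrZ mulrC; exact: ler_wpM2r.
Qed.

Lemma continuous_clamped : continuous (fun s => g (clamp s)).
Proof.
move=> s; apply: continuous_eps => e e0.
have c01 := clamp_unit s; set t := clamp s in c01.
have [r r0 hr] := ode_solution_eps c01 ltr01.
pose A := `|v t (g t)| + 1; have A0 : 0 < A by rewrite ltr_wpDl.
exists (Num.min r (e / A)); first by rewrite lt_min r0 divr_gt0.
move=> y; rewrite lt_min => /andP[h1 h2].
pose h := clamp y - t; have hsy : `|h| <= `|s - y| by rewrite distrC; exact: clamp_lip.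
have th : t + h = clamp y by rewrite /h addrC subrK.
have := hr h (le_lt_trans hsy h1); rewrite th => /(_ (clamp_unit y)) hg.
rewrite distrC -/t.
have -> : g (clamp y) - g t = (g (clamp y) - g t - h *: v t (g t)) + h *: v t (g t).
  by rewrite subrK.
apply: (le_trans (ler_normD _ _)); rewrite normrZ.
have : `|h| * A <= e.
  by rewrite -ler_pdivlMr//; exact: le_trans hsy (ltW h2).
rewrite /A; lra.
Qed.

Lemma is_derive_clamped (t : R) : 0 < t < 1 ->
  is_derive t 1 (fun s => g (clamp s)) (v t (g (clamp t))).
Proof.
move=> /andP[t0 t1]; have t01 : 0 <= t <= 1 by rewrite !ltW.
rewrite (clampE t01); apply: is_derive_eps => eps eps0.
have [r r0 hr] := ode_solution_eps t01 eps0.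
apply/nbhs_norm0P; exists (Num.min r (Num.min t (1 - t))) => /=.
  by rewrite !lt_min r0 t0 subr_gt0.
move=> h /=; rewrite !lt_min => /andP[h1 /andP[h2 h3]].
have th : 0 <= t + h <= 1.
  by move: h2 h3; rewrite !ltr_norml => /andP[? ?] /andP[? ?]; apply/andP; split; lra.
by rewrite (clampE t01) (clampE th); exact: hr.
Qed.

End UnitInterval.

Section UnitIntervalFlow.
Context {R : realType} {n : nat}.
Notation V := 'rV[R]_n.
Notation E := (@ebasis R n).
Variable v w : R -> V -> V.
(** [w] stands for the prescribed velocity, known on the unit interval only, and [v] for a field
    defined at all times. *)
Hypothesis vw : forall t z, 0 <= t <= 1 -> w t z = v t z.

Lemma ode_solution_flow (x : V) (y : R -> V) : y 0 = x ->
  (forall t : R, is_derive t 1 y (v t (y t))) -> ode_solution w x y.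
Proof.
move=> y0 hy; split=> // t t01; rewrite (vw _ t01).
have lim : (fun h : R => h^-1 *: (y (h *: (1 : R) + t) - y t)) @ 0^' --> v t (y t).
  have := @ex_derive _ _ _ _ _ _ _ (hy t); rewrite /derivable => /cvg_ex[l hl].
  by have := @derive_val _ _ _ _ _ _ _ (hy t); rewrite /derive (cvg_lim _ hl)// => <-.
have -> : (fun h : R => h^-1 *: (y (t + h) - y t)) =
    (fun h : R => h^-1 *: (y (h *: (1 : R) + t) - y t)).
  by apply/funext => h; rewrite [_%:A]mulr1 (addrC t).
by apply: cvg_trans lim; apply: cvg_app; exact: cvg_within.
Qed.

(** Forward Gronwall for the difference with the clamped curve, which uses derivatives in the open
    interval and continuity at the endpoints. *)
Lemma ode_solution_unique (x : V) (g y : R -> V) : lipx v -> y 0 = x ->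
  (forall t : R, is_derive t 1 y (v t (y t))) -> ode_solution w x g ->
  forall t, 0 <= t <= 1 -> g t = y t.
Proof.
move=> lv y0 hy hg t t01; have [g0 _] := hg.
have [L L0 hL] := lv 1.
pose f s := g (clamp s) - y s.
have cf : continuous f.
  move=> s; apply: (@continuousB R V R (fun s => g (clamp s)) y).
    exact: (continuous_clamped hg).
  exact: (is_derive_continuous hy).
have df (s : R) : 0 < s < 1 -> is_derive s 1 f (w s (g (clamp s)) - v s (y s)).
  by move=> s01; exact: (is_deriveB (is_derive_clamped hg s01) (hy s)).
have := @gronwall_vec_fwd R n f _ L 0 0 1 L0 (lexx _) _ df _ t t01.
have e0 : 0 <= (0 : R) <= 1 by apply/andP; split; lra.
have f0 : f 0 = 0 by rewrite /f (clampE e0) g0 y0 subrr.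
rewrite f0 normr0 addr0 mulr0 mul0r => h.
have : `|f t| <= 0.
  apply: h => [i|s /andP[s0 s1]].
    by apply: continuous_subspaceT => s; exact: ((continuous_coordP _ _).1 (cf s) i).
  have s01 : 0 <= s <= 1 by rewrite (ltW s0) (ltW s1).
  rewrite addr0 (vw _ s01) /f; apply: hL.
  by rewrite ger0_norm ltW.
by rewrite normr_le0 /f (clampE t01) subr_eq0 => /eqP.
Qed.

Lemma C2_partials (f : V -> R) (f1 : 'I_n -> V -> R) (f2 : 'I_n -> 'I_n -> V -> R) :
  (forall k x, is_derive x (E k) f (f1 k x)) ->
  (forall j k x, is_derive x (E j) (f1 k) (f2 j k x)) ->
  (forall j k, continuous (f2 j k)) ->
  (forall x, differentiable f x) /\ (forall i x, differentiable (pds [:: i] f) x) /\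
  (forall i j, continuous (pds [:: i; j] f)).
Proof.
move=> h1 h2 c2.
have e1 k : pds [:: k] f = f1 k.
  by apply/funext => y; exact: (@derive_val _ _ _ _ _ _ _ (h1 k y)).
have e2 j k : pds [:: j; k] f = f2 j k.
  apply/funext => y; rewrite -[LHS]/('D_(E j) (pds [:: k] f) y) e1.
  exact: (@derive_val _ _ _ _ _ _ _ (h2 j k y)).
have c1 k : continuous (f1 k) by exact: (C1_continuous (fun j => h2 j k) (fun j => c2 j k)).
split; last split=> [i x|i j].
- move=> x; have h := @C1_is_diff R n f x (fun y k => @ex_derive _ _ _ _ _ _ _ (h1 k y)).
  apply: (@ex_diff _ _ _ _ _ _ _ (h _)) => k; rewrite (_ : 'D_(E k) f = f1 k); first exact: c1.
  exact: e1.
- rewrite e1.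
  have h := @C1_is_diff R n (f1 i) x (fun y j => @ex_derive _ _ _ _ _ _ _ (h2 j i y)).
  apply: (@ex_diff _ _ _ _ _ _ _ (h _)) => j; rewrite (_ : 'D_(E j) (f1 i) = f2 j i); first exact: c2.
  by apply/funext => y; exact: (@derive_val _ _ _ _ _ _ _ (h2 j i y)).
- by rewrite e2; exact: c2.
Qed.

End UnitIntervalFlow.

Lemma smooth_convexW {R : realType} {n : nat} (phi : 'rV[R]_n -> R) al C C' : C <= C' ->
  smooth_convex phi al C -> smooth_convex phi al C'.
Proof. by move=> CC [h1 h2 h3 h4 h5]; split=> // j k x; exact: le_trans (h3 j k x) CC. Qed.

(** A conditional expectation is determined only almost surely, so the velocity ranges over versions
    continuous in [z]. Such versions exist and agree on the unit interval, hence the flow of the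
    explicit [vel] serves for all of them. *)
Theorem theorem6 (R : realType) (d : nat) (p0 p1 : 'rV[R]_d -> R) (beta alpha : R)
  (hp0 : forall x, 0 < p0 x) (hp1 : forall x, 0 < p1 x)
  (hbeta : 2 < beta)
  (hU2 : exists (C : nat -> R) (Cb : R),
           U2 beta C Cb (potential p0) /\ U2 beta C Cb (potential p1))
  (halpha : 0 < alpha)
  (hU3 : U3 alpha (potential p0) /\ U3 alpha (potential p1))
  (dO : measure_display) (Om : measurableType dO) (P : probability Om R)
  (X0 X1 : Om -> 'rV[R]_d)
  (hX0 : random_vector X0) (hX1 : random_vector X1)
  (hd0 : has_density P X0 p0) (hd1 : has_density P X1 p1)
  (hind : indep_vec P X0 X1) :
  let Xt := fun t w => (1 - t) *: X0 w + t *: X1 w in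
  let is_v := fun v : R -> 'rV[R]_d -> 'rV[R]_d =>
    forall t, 0 <= t <= 1 ->
      continuous (v t) /\ cond_exp_version P (fun w => X1 w - X0 w) (Xt t) (v t) in
  (exists v, is_v v) /\
  forall v, is_v v ->
    exists frakR : R -> 'rV[R]_d -> 'rV[R]_d,
      (forall x, ode_solution v x (fun t => frakR t x)) /\
      (forall x g, ode_solution v x g -> forall t, 0 <= t <= 1 -> g t = frakR t x) /\
      C2map (frakR 1) /\
      (forall t, 0 <= t <= 1 ->
         random_vector (fun w => frakR t (X0 w)) /\
         forall B, borel_set B ->
           P ((fun w => frakR t (X0 w)) @^-1` B) = P (Xt t @^-1` B)).
Proof.
move=> Xt is_v.
have [C [Cb [u0 u1]]] := hU2; have [s0 s1] := hU3.
(* [C 2] can be negative when [d = 0]. *)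
pose phi0 := potential p0; pose phi1 := potential p1; pose K := Num.max 0 (C 2%N).
have K0 : 0 <= K by rewrite le_max lexx.
have CK : C 2%N <= K by rewrite le_max lexx orbT.
have sc0 : smooth_convex phi0 alpha K.
  exact: smooth_convexW CK (U2_smooth_convex hbeta u0 s0).
have sc1 : smooth_convex phi1 alpha K.
  exact: smooth_convexW CK (U2_smooth_convex hbeta u1 s1).
have e0 : p0 = fun x => expR (- phi0 x).
  by apply/funext => x; rewrite /phi0 /potential opprK lnK ?posrE//.
have e1 : p1 = fun x => expR (- phi1 x).
  by apply/funext => x; rewrite /phi1 /potential opprK lnK ?posrE//.
have d0 : has_density P X0 (fun x => expR (- phi0 x)) by rewrite -e0.
have d1 : has_density P X1 (fun x => expR (- phi1 x)) by rewrite -e1.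
have mX0 := random_vectorP hX0; have mX1 := random_vectorP hX1.
have hv : is_v (vel phi0 phi1).
  move=> t t01; split; first exact: continuous_vel halpha K0 sc0 sc1 t.
  exact: (vel_cond_exp halpha K0 sc0 sc1 mX0 mX1 d0 d1 hind t).
split; first by exists (vel phi0 phi1).
move=> v vv.
have vE t z : 0 <= t <= 1 -> v t z = vel phi0 phi1 t z.
  move=> t01; have [c1 h1] := vv t t01; have [c2 h2] := hv t t01.
  apply/rowP => i; apply/eqP; rewrite eq_le; apply/andP; split.
    exact: (cond_exp_le halpha K0 sc0 sc1 mX0 mX1 d0 d1 hind z i c1 c2 h1 h2).
  exact: (cond_exp_le halpha K0 sc0 sc1 mX0 mX1 d0 d1 hind z i c2 c1 h2 h1).
pose hd := is_derive_vel halpha K0 sc0 sc1; pose bd := vel1_bound halpha K0 sc0 sc1.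
have cv := jcont_vel halpha K0 sc0 sc1.
pose hdd := is_derive_vel1 halpha K0 sc0 sc1.
have cd k l : jcont (vel1 phi0 phi1 k l) by exact: (jcont_vel1 halpha K0 sc0 sc1).
have cdd j k l : jcont (vel2 phi0 phi1 j k l) by exact: (jcont_vel2 halpha K0 sc0 sc1).
have [flow [flow_s flow_ode]] := flow_exists hd cv bd.
have cflow s x : continuous (flow s x) by exact: (is_derive_continuous (flow_ode s x)).
have /choice[Y' hY'] : forall q : 'rV[R]_d * R * 'rV[R]_d, exists Y : R -> 'rV[R]_d,
    Y q.1.2 = q.1.1 /\ forall t : R, is_derive t 1 Y
      (lin (vel1 phi0 phi1) t (flow q.1.2 q.2 t) (Y t)).
  by move=> [[e s] x]; have [Y y1 y2] := linear_ode s e cd (cflow s x); exists Y.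
pose Y e s x := Y' (e, s, x).
have Y_s e s x : Y e s x s = e by have [] := hY' (e, s, x).
have Y_ode e s x (t : R) : is_derive t 1 (Y e s x)
    (lin (vel1 phi0 phi1) t (flow s x t) (Y e s x t)) by have [] := hY' (e, s, x).
have cflow0 t : continuous (fun x => flow 0 x t).
  exact: (continuous_flow0 hd cv cd bd flow_s flow_ode).
exists (fun t x => flow 0 x t); split; [|split; [|split]].
- move=> x; apply: (ode_solution_flow vE); [exact: flow_s | exact: flow_ode].
- move=> x g hg t t01.
  exact: (ode_solution_unique vE (lipx_v hd bd) (flow_s 0 x) (flow_ode 0 x) hg t01).
- move=> l.
  have /choice[Z hZ] : forall q : 'I_d * 'I_d, exists Z : 'rV[R]_d -> 'rV[R]_d,
      (forall x, is_derive x (ebasis R q.1) (fun x => Y (ebasis R q.2) 0 x 1) (Z x)) /\ continuous Z.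
    move=> [j k]; have [Z z1 z2] := flow_C2 hd hdd cv cd cdd bd flow_s flow_ode Y_s Y_ode k j 0 1.
    by exists Z.
  apply: (@C2_partials R d (fun x => flow 0 x 1 0 l) (fun k x => Y (ebasis R k) 0 x 1 0 l) (fun j k x => Z (j, k) x 0 l)).
  + move=> k x; apply: ((is_derive_coord _ _ _ _).1 _ l).
    exact: (is_derive_flow1 hd cv cd bd flow_s flow_ode Y_s Y_ode).
  + by move=> j k x; apply: ((is_derive_coord _ _ _ _).1 ((hZ (j, k)).1 x) l).
  + by move=> j k x; exact: ((continuous_coordP _ _).1 ((hZ (j, k)).2 x) l).
- move=> t t01.
  have mF : measurable_fun setT (fun w => flow 0 (X0 w) t : g_sigma_algebraType (@open 'rV[R]_d)).
    exact: (measurableT_comp (continuous_measurable_rVV (cflow0 t)) mX0).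
  split=> [B mB|B mB]; first by have := mF measurableT B mB; rewrite setTI.
  apply: (law_eq mF (measurable_interp mX0 mX1 t)) => // f [df [M [M0 hf cf bf bdf]]].
  have /andP[t0 _] := t01.
  exact: (mean_transport halpha K0 sc0 sc1 mX0 mX1 d0 d1 hind flow_s flow_ode Y_s Y_ode hf cf M0 bf bdf t0).
Qed.
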